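(* Let $X_1,\ldots,X_n$ be an independent random sample from a distribution $P$ on $\mathbb{R}^d$ with continuous marginal cumulative distribution functions $F_1,\ldots,F_d$, and let $P_V$ denote the distribution of $V_1=v(X_1)$, where $v(x)=\bigl(1/(1-F_1(x_1)),\ldots,1/(1-F_d(x_d))\bigr)$. Let $p\in[1,\infty]$ and let $\mu$ be an exponent measure with angular measure $\Phi_p$ with respect to $\|\cdot\|_p$. Let $\mathcal{A}$ be a collection of Borel sets of $\mathbb{S}_p$ satisfying Assumptions (A) and (B) of the context (with constants $\tau\in(0,1)$, $c>0$ and hulls $A_\pm(\varepsilon)$). Let $n,k,\rho$ be such that $\tau n>k>\max(3,6c)$ and $k/n<\rho<\tau$. Let $\delta\in(0,1)$. Put $$\Delta_1=\frac{1}{\sqrt{k\rho}}\Bigl(60+2\sqrt{\log((d+1)/\delta)}\Bigr)+\frac{2}{3k}\log((d+1)/\delta),\qquad \Delta_2=4(\Delta_1+1/k),$$ and for $\sigma\in\{-,+\}$ and $A\in\mathcal{A}$ abbreviate $\Gamma_A^\sigma=\Gamma_A^\sigma(r_\sigma,3\Delta_1)$ with $r_\pm=1\pm\Delta_2$. Suppose $k$ is sufficiently large that $2/k\le\Delta_1<\min\{1/4-1/k,\;1/(3c)\}$ and $\rho/(1-\Delta_1\rho)\le\tau$. Then, with probability at least $1-\delta$, the empirical angular measure $\widehat\Phi_p$ satisfies $$\begin{aligned}\sup_{A\in\mathcal{A}}\bigl|\widehat\Phi_p(A)-\Phi_p(A)\bigr|\le{}&\sup_{A\in\mathcal{A},\,\sigma\in\{+,-\}}\Bigl|\tfrac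 nk P_V\bigl(\tfrac nk\Gamma_A^\sigma\bigr)-\mu(\Gamma_A^\sigma)\Bigr|\\&+\sqrt{\frac{d^{1+1/p}(1+\Delta_2)}{k}}\Bigl(60\sqrt{V_{\mathcal F}}+2\sqrt{\log((d+1)/\delta)}\Bigr)+\frac{2}{3k}\log\bigl((d+1)/\delta\bigr)\\&+2d\Delta_2+3c\bigl(\log(d/(3c))-\log(\Delta_1)+1\bigr)\Delta_1,\end{aligned}$$ where $V_{\mathcal F}$ is the VC-dimension of the collection $\{\Gamma_A^-:A\in\mathcal{A}\}\cup\{\Gamma_A^+:A\in\mathcal{A}\}$.
   Context: Notation. $\|x\|_p$ is the $L_p$-norm on $\mathbb{R}^d$, $1\le p\le\infty$ (with $1/p=0$ if $p=\infty$). $E=[0,\infty)^d\setminus\{0\}$, $\mathbb{S}_p=\{x\in[0,\infty)^d:\|x\|_p=1\}$, $\theta_p(x)=x/\|x\|_p$ for $x\in E$, $\mathbb{B}=[-1,1]^d$, and $A+\varepsilon\mathbb{B}=\{a+\varepsilon b:a\in A,b\in\mathbb{B}\}$. For $\lambda>0$, $\lambda B=\{\lambda x:x\in B\}$. In the definition of $v$, $1/0=\infty$. Exponent and angular measure. An exponent measure is a non-zero Borel measure $\mu$ on $E$, finite on Borel sets bounded away from the origin, homogeneous ($\mu(\lambda\,\cdot)=\lambda^{-1}\mu(\cdot)$ for all $\lambda>0$) and with standardized margins ($\mu(\{x\in E:x_j\ge y\})=1/y$ for all $y>0$, $j=1,\dots,d$). Its angular measure is $\Phi_p(A)=\mu(\mathcal{C}_A)$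 for Borel $A\subseteq\mathbb{S}_p$, with $\mathcal{C}_A=\{x\in E:\|x\|_p\ge1,\ \theta_p(x)\in A\}$. (No asymptotic link between $P_V$ and $\mu$ is assumed in the theorem.) Empirical angular measure. Let $\widehat F_j(t)=\frac1n\sum_{i=1}^n\mathbf 1\{X_{ij}\le t\}$, and $\widehat V_i=(\widehat V_{i1},\ldots,\widehat V_{id})$ with $\widehat V_{ij}=1/\bigl(1-\frac{n}{n+1}\widehat F_j(X_{ij})\bigr)$. For $k\in\{1,\ldots,n\}$ and Borel $A\subseteq\mathbb{S}_p$, $$\widehat\Phi_p(A)=\frac1k\sum_{i=1}^n\mathbf 1\{\|\widehat V_i\|_p\ge n/k,\ \theta_p(\widehat V_i)\in A\}.$$ Assumption (A). $\mathcal{A}$ is a collection of non-empty Borel sets of $\mathbb{S}_p$ such that: (i) there is a countable $\mathcal{A}_0\subseteq\mathcal{A}$ such that for every $A\in\mathcal{A}$ there is a sequence $A_m\in\mathcal{A}_0$ with $\lim_{m\to\infty}\mathbf 1\{x\in A_m\}=\mathbf 1\{x\in A\}$ for every $x\in\mathbb{S}_p$; (ii) there is $\tau\in(0,1)$ such that every $A\in\mathcal{A}$ is contained in $\mathbb{S}_p^\tau=\{x\in\mathbb{S}_p:\min(x_1,\ldots,x_d)>\tau\}$; (iii) there is a constant $c>0$ such that for any $A\in\mathcal{A}$ and $\varepsilon>0$ there exist Borel subsets $A_+(\varepsilon),A_-(\varepsilon)$ of $\mathbb{S}_p$ with $\Phi_p(A_+(\varepsilon)\setminus A_-(\varepsilon))\le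 c\,\varepsilon$, $(A_-(\varepsilon)+\varepsilon\mathbb{B})\cap\mathbb{S}_p\subseteq A$ and $(A+\varepsilon\mathbb{B})\cap\mathbb{S}_p\subseteq A_+(\varepsilon)$. Framing sets. With the hulls $A_\pm(\varepsilon)$ fixed as in (iii), for $A\in\mathcal{A}$, $\sigma\in\{-,+\}$ and $r,h>0$, $$\Gamma_A^\sigma(r,h)=\{x\in[0,\infty)^d:\|x\|_p\ge 1/r,\ \theta_p(x)\in A_\sigma(h\|x\|_p)\}.$$ Assumption (B). For any $r,h>0$, the collections $\{\Gamma_A^-(r,h):A\in\mathcal{A}\}$ and $\{\Gamma_A^+(r,h):A\in\mathcal{A}\}$ of subsets of $E$ have finite VC-dimension. The VC-dimension of a collection $\mathcal{F}$ of subsets of a set $\mathcal{X}$ is the supremum of the positive integers $m$ for which there is a subset of $\mathcal{X}$ of cardinality $m$ all of whose $2^m$ subsets can be obtained by intersecting it with elements of $\mathcal{F}$. *)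

(* Defs.v *)
From HB Require Import structures.
From mathcomp Require Import all_boot all_order all_algebra.
From mathcomp Require Import all_classical all_reals all_analysis.
From mathcomp Require Import measurable_realfun.

Set Implicit Arguments.
Unset Strict Implicit.
Unset Printing Implicit Defensive.

Import Order.TTheory GRing.Theory Num.Theory.
Import numFieldNormedType.Exports.

Local Open Scope classical_set_scope.
Local Open Scope ring_scope.

(* R^d is d.-tuple R; its canonical sigma-algebra is the product of the Borel
   sigma-algebras of the coordinates, i.e. the Borel sigma-algebra of R^d. *)

Section VapnikChervonenkis.
Variables (R : realType) (T : Type).
Implicit Types (F : set (set T)) (S : set T).

Definition shatters F S :=
  forall B : set T, B `<=` S -> exists2 C, F C & S `&` C = B.

(* The value m = 0 is always admitted, so that the supremum is 0 when no
   non-empty set is shattered. The ambient set plays no role: a point lying in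
   no element of F belongs to no shattered set. *)
Definition vc_dim F : \bar R :=
  ereal_sup [set (m%:R)%:E | m in
    [set m : nat | m = 0%N \/ exists2 S, (S #= `I_m)%card & shatters F S]].

End VapnikChervonenkis.

Section Independence.
Context {d1 d2 : measure_display} {Omega : measurableType d1}
  {T : measurableType d2} {R : realType} (Pr : probability Omega R).

Definition mutually_independent (I : finType) (X : I -> {RV Pr >-> T}) :=
  forall (J : {set I}) (B : I -> set T), (forall i, measurable (B i)) ->
    Pr (\bigcap_(i in [set i | i \in J]) X i @^-1` B i) =
    (\prod_(i in J) Pr (X i @^-1` B i))%E.

End Independence.

Section Geometry.
Context {R : realType} {d : nat}.
Implicit Types (x : d.-tuple R) (A B : set (d.-tuple R)) (p : \bar R).

(* Only meaningful for 1 <= p <= +oo. *)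
Definition lp_norm p x : R :=
  match p with
  | q%:E => (\sum_(j < d) `|tnth x j| `^ q) `^ q^-1
  | _ => \big[Num.max/0]_(j < d) `|tnth x j|
  end.

Definition scale (l : R) x : d.-tuple R := [tuple l * tnth x j | j < d].

Definition orthant : set (d.-tuple R) := [set x | forall j, 0 <= tnth x j].

Definition punctured_orthant : set (d.-tuple R) :=
  orthant `\ [tuple (0 : R) | _ < d].

Definition sphere p : set (d.-tuple R) := orthant `&` [set x | lp_norm p x = 1].

Definition theta p x : d.-tuple R := scale (lp_norm p x)^-1 x.

(* A + e [-1,1]^d *)
Definition thicken A (e : R) : set (d.-tuple R) :=
  [set [tuple tnth a j + e * tnth b j | j < d] |
     a in A & b in [set b : d.-tuple R | forall j, -1 <= tnth b j <= 1]].

Definition cone p A : set (d.-tuple R) :=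
  [set x | punctured_orthant x /\ 1 <= lp_norm p x /\ A (theta p x)].

End Geometry.

Section ExponentMeasure.
Context {R : realType} {d : nat}.
Implicit Types (mu : {measure set (d.-tuple R) -> \bar R}).

(* A Borel measure on E is represented by a Borel measure on R^d that does not
   charge the complement of E. *)
Record exponent_measure mu : Prop := {
  exponent_carried : mu (~` punctured_orthant) = 0%E;
  exponent_neq0 : mu punctured_orthant <> 0%E;
  exponent_finite : forall B, measurable B -> B `<=` punctured_orthant ->
    (exists2 e : R, 0 < e & forall x, B x -> e <= lp_norm +oo%E x) ->
    (mu B < +oo)%E;
  exponent_homogeneous : forall (l : R) B, 0 < l ->
    measurable B -> B `<=` punctured_orthant ->
    mu (scale l @` B) = ((l^-1)%:E * mu B)%E;
  exponent_margins : forall (j : 'I_d) (y : R), 0 < y ->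
    mu [set x | punctured_orthant x /\ y <= tnth x j] = (y^-1)%:E }.

Definition angular_measure (p : \bar R) mu (A : set (d.-tuple R)) : \bar R :=
  mu (cone p A).

End ExponentMeasure.

Section Margins.
Context {R : realType} {d : nat}.

Definition coord (j : 'I_d) (x : d.-tuple R) : R := tnth x j.

HB.instance Definition _ (j : 'I_d) :=
  @isMeasurableFun.Build _ _ _ _ (coord j) (measurable_tnth j).

Variable P : probability (d.-tuple R) R.

Definition margin_cdf (j : 'I_d) : R -> \bar R :=
  cdf (coord j : {RV P >-> R}).

(* In \bar R, the inverse of 0 is +oo. *)
Definition standardize (x : d.-tuple R) : d.-tuple (\bar R) :=
  [tuple (1 - margin_cdf j (tnth x j))^-1%E | j < d].

(* The distribution of v(X), X ~ P; it lives on the tuples of extended reals. *)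
Definition law_std : set (d.-tuple (\bar R)) -> \bar R :=
  pushforward P standardize.

(* P_V (B) for a subset B of R^d *)
Definition law_std_real (B : set (d.-tuple R)) : \bar R :=
  law_std ((fun x => [tuple (tnth x j)%:E | j < d]) @` B).

End Margins.

Section Empirical.
Context {R : realType} {d n : nat}.
Variable x : 'I_n -> d.-tuple R.

Definition emp_cdf (j : 'I_d) (t : R) : R :=
  n%:R^-1 * \sum_(i < n) \1_[set w : d.-tuple R | tnth w j <= t] (x i).

Definition emp_std (i : 'I_n) : d.-tuple R :=
  [tuple (1 - n%:R / n.+1%:R * emp_cdf j (tnth (x i) j))^-1 | j < d].

Definition emp_angular_measure (p : \bar R) (k : nat)
    (A : set (d.-tuple R)) : R :=
  k%:R^-1 * \sum_(i < n)
    \1_[set w | n%:R / k%:R <= lp_norm p w /\ A (theta p w)] (emp_std i).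

End Empirical.

Section Assumptions.
Context {R : realType} {d : nat}.
Variables (p : \bar R) (mu : {measure set (d.-tuple R) -> \bar R}).
Variable (calA : set (set (d.-tuple R))).
(* hull true A e and hull false A e are the outer and inner hulls A_+(e) and
   A_-(e); likewise for the boolean argument of framing below. *)
Variable (hull : bool -> set (d.-tuple R) -> R -> set (d.-tuple R)).

Record assumption_A (tau c : R) : Prop := {
  A_borel : forall A, calA A ->
    [/\ measurable A, A `<=` sphere p & A !=set0];
  A_countable : exists calA0 : set (set (d.-tuple R)),
    [/\ countable calA0, calA0 `<=` calA &
      forall A, calA A -> exists2 A_ : nat -> set (d.-tuple R),
        (forall m, calA0 (A_ m)) &
        forall x, sphere p x ->
          (\1_(A_ m) x : R) @[m --> \oo] --> (\1_A x : R)];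
  A_tau : 0 < tau < 1;
  A_away : forall A, calA A ->
    A `<=` [set x | sphere p x /\ forall j, tau < tnth x j];
  A_c : 0 < c;
  A_hull_borel : forall s A e, calA A -> 0 < e ->
    measurable (hull s A e) /\ hull s A e `<=` sphere p;
  A_hull_small : forall A e, calA A -> 0 < e ->
    (angular_measure p mu (hull true A e `\` hull false A e) <= (c * e)%:E)%E;
  A_hull_inner : forall A e, calA A -> 0 < e ->
    thicken (hull false A e) e `&` sphere p `<=` A;
  A_hull_outer : forall A e, calA A -> 0 < e ->
    thicken A e `&` sphere p `<=` hull true A e }.

(* The hypotheses on the hulls say nothing about how hull s A e varies with e,
   so these sets need not be Borel even though each hull is. *)
Definition framing (s : bool) (A : set (d.-tuple R)) (r h : R) :
    set (d.-tuple R) :=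
  [set x | [/\ orthant x, r^-1 <= lp_norm p x &
               hull s A (h * lp_norm p x) (theta p x)]].

Definition assumption_B : Prop := forall r h : R, 0 < r -> 0 < h ->
  forall s : bool, (vc_dim R [set framing s A r h | A in calA] < +oo)%E.

End Assumptions.

(* Main.v *)
(* Outside an event of probability at most d delta / (d + 1), the empirical tail
   of each margin is k Delta1-close to the true one on its whole upper range
   (half-lines are totally ordered by inclusion, hence have VC-dimension 1).
   There the angles and radii of the rank-based points differ so little from
   those of the true standardized points that the number of empirical exceedances
   with angle in A is squeezed between the numbers of points of the sample V_i in
   the dilations by n/k of the framing sets of A.

   The latter counts deviate from their means by at most the VC bound outside an
   event of probability delta / (d + 1). That bound comes from symmetrization,
   chaining with Dudley's packing numbers and an exponential inequality for
   functions with bounded differences supported on the rare event that a point is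
   extreme; this event has probability of order k/n, whence the factor 1/sqrt k.
   Separability of the class (Assumption (A)(i)) leaves countably many sets.

   Finally mu(framing set) is compared with Phi(A): in polar coordinates mu is
   the product of a uniform inverse radius s and the angular measure, the
   discrepancy at inverse radius s has angular mass at most min(d, 3 c Delta1 / s),
   and integrating in s gives the logarithmic term; the change of radius costs
   d Delta2. *)
Require Import Defs.
From HB Require Import structures.
From mathcomp Require Import all_boot all_order all_algebra.
From mathcomp Require Import all_classical all_reals all_analysis.
From mathcomp Require Import measurable_realfun.
From mathcomp Require Import ring lra zify.

Set Implicit Arguments.
Unset Strict Implicit.
Unset Printing Implicit Defensive.

Import Order.TTheory GRing.Theory Num.Theory.
Import numFieldNormedType.Exports.

Local Open Scope classical_set_scope.
Local Open Scope ring_scope.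

(** All empirical-process arguments run on finite probability spaces. Finitely many sets see a
    sample point only through the atom of the algebra they generate, so the sample becomes a word
    with product weights over a finite alphabet: expectations are finite sums, suprema are maxima,
    and ghost samples, sign exchanges and conditioning are rearrangements of sums that raise no
    measurability question. Representatives of the atoms carry shattering back to the original sets.
    The resulting bound depends on the class only through its VC-dimension and the probability of
    its union, so it survives the passage to countably many sets.

    Closeness of rank-based and true points is measured on reciprocals, which are tail frequencies:
    |1/w - 1/v| <= eta in each coordinate. The error in the angle is then proportional to the norm,
    which is why framing sets use hulls at a scale proportional to the norm. The upper bound on
    [Delta1] has a second role besides Delta2 < 1: it forces L <= k, which keeps the exponential
    inequality in its Gaussian range. The chaining constant obtained is 48, which the stated 60
    dominates. *)

(** * Elementary exponential inequalities *)

Lemma expR_le_quadratic (R : realType) (u : R) : u <= 1 -> expR u <= 1 + u + u ^+ 2.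
Proof.
(* The derivative x (1 - x) e^(-x) is negative before 0 and nonnegative on [0, 1], so f 0 = 1 is the
   minimum of [f] on ]-oo, 1]. *)
pose f (x : R) : R := (1 + x + x ^+ 2) * expR (- x).
have df (x : R) : is_derive x 1 f (x * (1 - x) * expR (- x)).
  apply: is_derive_eq; rewrite /GRing.scale /= ; ring.
have f1 (x : R) : f^`()%classic x = x * (1 - x) * expR (- x).
  by rewrite derive1E; have /@derive_val := df x.
have fc (x : R) : {for x, continuous f}.
  by apply/differentiable_continuous/derivable1_diffP; case: (df x).
have f0 : f 0 = 1 by rewrite /f oppr0 expR0; ring.
move=> u1; have : 1 <= f u.
  have [u0|u0] := leP 0 u.
    rewrite -f0; apply: (@ger0_derive1_ndecr _ f 0 1) => // [x|].
    - by rewrite in_itv /= f1 => /andP[? ?]; rewrite !mulr_ge0 ?expR_ge0 //; lra.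
    - exact: continuous_subspaceT.
  rewrite -f0; apply: (@ler0_derive1_nincrNy _ f 0) => // [x||].
    - by rewrite in_itv /= f1 => ?; rewrite mulr_le0_ge0 ?expR_ge0 //; nra.
    - exact: continuous_subspaceT.
    - exact: ltW.
by rewrite /f expRN ler_pdivlMr ?expR_gt0 // mul1r.
Qed.

(** For |x| <= 1 the linear terms of the two quadratic bounds cancel; beyond 1 both exponentials are
    at most e^|x| <= e^(x^2). *)
Lemma cosh_le_expR_sqr (R : realType) (x : R) :
  2^-1 * (expR x + expR (- x)) <= expR (x ^+ 2).
Proof.
have aux (y : R) : 0 <= y -> 2^-1 * (expR y + expR (- y)) <= expR (y ^+ 2).
  move=> y0; have [y1|y1] := leP y 1.
    have h1 := expR_le_quadratic y1.
    have h2 : expR (- y) <= 1 + (- y) + (- y) ^+ 2 by apply: expR_le_quadratic; lra.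
    have h3 := expR_ge1Dx (y ^+ 2).
    by nra.
  have h1 : expR (- y) <= expR y by rewrite ler_expR; lra.
  have h2 : expR y <= expR (y ^+ 2) by rewrite ler_expR; nra.
  nra.
have [x0|x0] := leP 0 x; first exact: aux.
have := @aux (- x); rewrite opprK sqrrN [expR (- x) + _]addrC; apply; lra.
Qed.

(** * Separated families of bounded Vapnik-Chervonenkis dimension *)

(** Boolean counterpart of [shatters], so that the shattered sets can be counted. *)
Definition fshatters (I : finType) (G : {set {set I}}) (S : {set I}) : bool :=
  [forall B : {set I}, (B \subset S) ==> [exists C in G, S :&: C == B]]%SET.

Lemma fshattersP (I : finType) (G : {set {set I}}) (S : {set I}) :
  reflect (forall B : {set I}, B \subset S -> exists2 C, C \in G & (S :&: C)%SET = B)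
          (fshatters G S).
Proof.
apply: (iffP forallP) => [h B BS|h B].
  by have /implyP/(_ BS)/existsP[C /andP[CG /eqP]] := h B; exists C.
by apply/implyP => BS; have [C CG SC] := h B BS; apply/existsP; exists C; rewrite CG SC /=.
Qed.

Lemma fshattersS (I : finType) (G H : {set {set I}}) (S : {set I}) :
  G \subset H -> fshatters G S -> fshatters H S.
Proof.
move=> GH /fshattersP hG; apply/fshattersP => B BS.
by have [C CG SC] := hG B BS; exists C => //; apply: (fintype.subsetP GH).
Qed.

(* Pajor's form of the Sauer-Shelah lemma. *)
Lemma card_le_fshatters (I : finType) (G : {set {set I}}) :
  (#|G| <= #|[set S | fshatters G S]%SET|)%N.
Proof.
have [k] := ubnP #|G|; elim: k G => // k IH G; rewrite ltnS => Gk.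
have [G1|G2] := leqP #|G| 1.
  have [->|[C CG]] := set_0Vmem G; first by rewrite cards0.
  apply: (leq_trans G1); apply/card_gt0P; exists finset.set0; rewrite inE.
  apply/fshattersP => B; rewrite finset.subset0 => /eqP ->; exists C => //.
  by rewrite finset.set0I.
have [C [D [CG DG]]] : exists C D, [/\ C \in G, D \in G & exists x, (x \in C) && (x \notin D)].
  have /card_gt1P[C [D [CG DG CD]]] := G2.
  have [/fintype.subsetP CsD|/fintype.subsetPn[x xC xD]] := boolP (C \subset D); last first.
    by exists C, D; split => //; exists x; rewrite xC.
  exists D, C; split => //.
  have /fintype.subsetPn[x xD xC] : ~~ (D \subset C).
    by apply: contra CD => DC; rewrite finset.eqEsubset DC andbT; apply/fintype.subsetP.
  by exists x; rewrite xD.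
case=> x /andP[xC xD].
pose G1 := [set E in G | x \in E]%SET; pose G0 := [set E in G | x \notin E]%SET.
have GE : G = (G1 :|: G0)%SET.
  by apply/finset.setP => E; rewrite !inE; case: (x \in E); case: (E \in G).
have G10 : (G1 :&: G0)%SET = finset.set0.
  by apply/finset.setP => E; rewrite !inE; case: (x \in E); case: (E \in G).
have cG : (#|G| = #|G1| + #|G0|)%N by rewrite [in LHS]GE cardsU G10 cards0 subn0.
have C1 : C \in G1 by rewrite inE CG.
have D0 : D \in G0 by rewrite inE DG.
have g1 : (0 < #|G1|)%N by apply/card_gt0P; exists C.
have g0 : (0 < #|G0|)%N by apply/card_gt0P; exists D.
have {}IH1 : (#|G1| <= #|[set S | fshatters G1 S]%SET|)%N by apply: IH; lia.
have {}IH0 : (#|G0| <= #|[set S | fshatters G0 S]%SET|)%N by apply: IH; lia.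
set S1 := [set S | fshatters G1 S]%SET in IH1; set S0 := [set S | fshatters G0 S]%SET in IH0.
have xS1 S : S \in S1 -> x \notin S.
  rewrite inE => /fshattersP/(_ finset.set0 (finset.sub0set _))[E]; rewrite inE => /andP[_ xE] /finset.setP/(_ x).
  by rewrite !inE xE andbT => ->.
have xS0 S : S \in S0 -> x \notin S.
  rewrite inE => /fshattersP/(_ S (fintype.subxx _))[E]; rewrite inE => /andP[_ xE] /finset.setP/(_ x).
  by rewrite !inE (negPf xE) andbF => <-.
(* The induction counts a set shattered by both halves twice. Such a set also makes [x |: S]
   shattered by G, and this extra set contains [x], unlike all sets shattered by one half. *)
pose add (S : {set I}) := (x |: S)%SET.
have addinj : {in (S1 :&: S0)%SET &, injective add}.
  move=> S S' /setIP[sS _] /setIP[sS' _].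
  have xS : x \notin S := xS1 _ sS.
  have xS' : x \notin S' := xS1 _ sS'.
  move=> /(congr1 (fun E : {set I} => (E :\ x)%SET)); by rewrite /add !setU1K.
have dis : ((S1 :|: S0) :&: (add @: (S1 :&: S0)))%SET = finset.set0.
  apply/finset.setP => S; rewrite !inE; apply/negP => /andP[h /imsetP[S' _ SE]].
  have : x \in S by rewrite SE !inE eqxx.
  by apply/negP; case/orP: h => h; [apply: xS1|apply: xS0]; rewrite inE.
have sub : ((S1 :|: S0) :|: (add @: (S1 :&: S0)))%SET \subset [set S | fshatters G S]%SET.
  apply/fintype.subsetP => S; rewrite !inE => /orP[/orP[h|h]|/imsetP[S' ]].
  - by apply: fshattersS h; rewrite GE finset.subsetUl.
  - by apply: fshattersS h; rewrite GE finset.subsetUr.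
  - rewrite !inE => /andP[h1 h0] ->; apply/fshattersP => B BS.
    have xS' : x \notin S' by apply: xS1; rewrite inE.
    have BxS : (B :\ x)%SET \subset S' by rewrite subDset.
    have [xB|xB] := boolP (x \in B).
      have /fshattersP/(_ _ BxS)[E] := h1; rewrite !inE => /andP[EG xE] SE.
      exists E => //; rewrite /add finset.setIUl SE.
      apply/finset.setP => y; rewrite !inE; have [->|//] := eqVneq y x.
      by rewrite xE xB.
    have /fshattersP/(_ _ BxS)[E] := h0; rewrite !inE => /andP[EG xE] SE.
    exists E => //; rewrite /add finset.setIUl SE.
    apply/finset.setP => y; rewrite !inE; have [->|//] := eqVneq y x.
    by rewrite (negPf xE) (negPf xB).
have := subset_leq_card sub; rewrite cardsU dis cards0 subn0 card_in_imset // cG.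
rewrite cardsU; have : (#|S1 :&: S0| <= #|S1|)%SET%N by rewrite subset_leq_card // finset.subsetIl.
by lia.
Qed.

Lemma sum_expr_card (R : comNzRingType) (I : finType) (x : R) :
  \sum_(S : {set I}) x ^+ #|S| = (1 + x) ^+ #|I|.
Proof.
rewrite addrC -prodr_const bigA_distr; apply: eq_bigr => S _.
by rewrite -big_mkcond /= prodr_const.
Qed.

(** Each shattered set has weight x^|S| >= x^V because x <= 1, and the weights of all subsets add up
    to (1 + x)^|I|. The free parameter replaces the binomial sums of the usual Sauer bound by a form
    that combines directly with exponentials. *)
Lemma card_vc_le (R : realFieldType) (I : finType) (G : {set {set I}}) (V : nat) (x : R) :
  (forall S, fshatters G S -> (#|S| <= V)%N) -> 0 < x <= 1 ->
  #|G|%:R * x ^+ V <= (1 + x) ^+ #|I|.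
Proof.
move=> GV /andP[x0 x1]; rewrite -sum_expr_card.
apply: (@le_trans _ _ (\sum_(S in [set S | fshatters G S]%SET) x ^+ V)).
  by rewrite sumr_const -[leRHS]mulr_natl ler_wpM2r ?exprn_ge0 ?(ltW x0) // ler_nat card_le_fshatters.
rewrite [leRHS](bigID (mem [set S | fshatters G S]%SET)) /= -[leLHS]addr0 lerD //.
  apply: ler_sum => S; rewrite inE => /GV SV.
  by rewrite ler_wiXn2l // ltW.
by apply: sumr_ge0 => S _; rewrite exprn_ge0 // ltW.
Qed.

(** No preimage under [f] separates two points with the same image, so [f] is injective on a
    shattered set. Repeated sample points thus cannot raise the dimension. *)
Lemma fshatters_preimset (I I' : finType) (f : I' -> I) (G : {set {set I}}) (S : {set I'}) :
  fshatters ((fun B : {set I} => f @^-1: B) @: G)%SET S ->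
  fshatters G (f @: S)%SET /\ #|f @: S|%SET = #|S|.
Proof.
move=> /fshattersP h.
have finj : {in S &, injective f}.
  move=> x y xS yS fxy; have := h [set x]%SET; rewrite finset.sub1set => /(_ xS)[_ /imsetP[C CG ->]].
  move=> e; have := e; move/finset.setP/(_ x); rewrite !inE xS eqxx /= => fx.
  by move: e => /finset.setP/(_ y); rewrite !inE yS -fxy fx /= => /esym/eqP.
split; last exact: card_in_imset.
apply/fshattersP => B BS; have [] := h (S :&: f @^-1: B)%SET (finset.subsetIl _ _).
move=> _ /imsetP[C CG ->] /finset.setP SC; exists C => //; apply/finset.setP => y; rewrite inE.
apply/andP/idP => [[/imsetP[x xS ->] fxC]|yB].
  by have := SC x; rewrite !inE xS fxC /= => <-.
have /imsetP[x xS yx] := fintype.subsetP BS _ yB.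
by split; [apply/imsetP; exists x|have := SC x; rewrite !inE xS /= -yx yB => ->].
Qed.

(* Probabilistic method: m independent uniform points of J all miss the
   symmetric difference of a given pair with probability at most (1 - eta)^m. *)
Lemma exists_separating_sample (R : realFieldType) (I : finType) (J : {set I})
    (H : {set {set I}}) (eta : R) (m : nat) :
  (forall B, B \in H -> B \subset J) ->
  (forall B C, B \in H -> C \in H -> B != C ->
     eta * #|J|%:R <= #|(B :\: C) :|: (C :\: B)|%SET%:R) ->
  (0 < #|J|)%N -> 0 < eta <= 1 ->
  (#|H| ^ 2)%N%:R * (1 - eta) ^+ m < 1 ->
  exists s : 'I_m -> I, {in H &, injective (fun B : {set I} => s @^-1: B)%SET}.
Proof.
move=> HJ Hsep J0 /andP[eta0 eta1] small.
pose bad (BC : {set I} * {set I}) : {set {ffun 'I_m -> I}} :=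
  [set s | s \in ffun_on (mem (J :\: ((BC.1 :\: BC.2) :|: (BC.2 :\: BC.1))))]%SET.
have [s sJ sbad] : exists2 s : {ffun 'I_m -> I}, s \in ffun_on (mem J) &
    forall BC, BC \in finset.setX H H -> BC.1 != BC.2 -> s \notin bad BC.
  apply: contrapT => hn.
  have cov : [set s | s \in ffun_on (mem J)]%SET \subset
      (\bigcup_(BC in finset.setX H H | BC.1 != BC.2) bad BC)%SET.
    apply/fintype.subsetP => s; rewrite inE => sJ.
    apply: contrapT => sb; apply: hn; exists s => // BC BCH ne.
    apply/negP => sbad; apply: sb; apply/bigcupP; exists BC => //.
    by rewrite BCH.
  have : (#|J| ^ m)%N%:R <= \sum_(BC in finset.setX H H | BC.1 != BC.2) #|bad BC|%:R :> R.
    rewrite -natr_sum ler_nat -[m in leqLHS]card_ord -card_ffun_on.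
    rewrite -[leqLHS]cardsE; apply: (leq_trans (subset_leq_card cov)).
    apply: (big_ind2 (fun (A : {set {ffun 'I_m -> I}}) k => #|A| <= k)%N) => //.
      by rewrite cards0.
    move=> A a B b Aa Bb; apply: leq_trans (leq_add Aa Bb).
    by rewrite cardsU leq_subr.
  apply/negP; rewrite -ltNge.
  apply: (@le_lt_trans _ _ (\sum_(BC in finset.setX H H) ((1 - eta) ^+ m * #|J|%:R ^+ m))).
    rewrite [leRHS](bigID (fun BC => BC.1 != BC.2)) /= -[leLHS]addr0 lerD //; last first.
      by apply: sumr_ge0 => BC _; rewrite mulr_ge0 ?exprn_ge0 //; lra.
    apply: ler_sum => -[B C] /= /andP[]; rewrite inE /= => /andP[BH CH] BC.
    rewrite /bad cardsE card_ffun_on card_ord natrX -exprMn lerXn2r ?nnegrE //.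
      by rewrite mulr_ge0 //; lra.
    have sub : (B :\: C :|: C :\: B)%SET \subset J.
      rewrite finset.subUset !finset.subDset.
      by rewrite !(fintype.subset_trans (HJ _ _) (finset.subsetUr _ _)).
    rewrite cardsD (finset.setIidPr sub) natrB ?subset_leq_card //.
    by rewrite mulrBl mul1r lerB // Hsep.
  rewrite sumr_const cardsX mulnn -[ltLHS]mulr_natl mulrA [ltRHS]natrX.
  by rewrite gtr_pMl // exprn_gt0 // ltr0n.
exists s => B C BH CH /finset.setP e; apply/eqP; apply/negPn/negP => BC.
have := sbad (B, C); rewrite inE BH CH => /(_ isT BC); rewrite inE => /negP; apply.
apply/ffun_onP => i; rewrite !inE /=.
have /ffun_onP/(_ i) sJi := sJ; have := e i; rewrite !inE => ->.
by case: (s i \in C) => //=; rewrite sJi.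
Qed.

(* Dudley's packing bound: two members of a separated family differ on a random
   sample of 2 ln #|H| / eta points, where the Sauer-Shelah lemma applies. *)
Lemma ln_card_packing (R : realType) (I : finType) (J : {set I})
    (H : {set {set I}}) (eta : R) (V : nat) :
  (forall B, B \in H -> B \subset J) ->
  (forall B C, B \in H -> C \in H -> B != C ->
     eta * #|J|%:R <= #|(B :\: C) :|: (C :\: B)|%SET%:R) ->
  0 < eta <= 1 -> (forall S, fshatters H S -> (#|S| <= V)%N) ->
  ln #|H|%:R <= 2 * V%:R * ln (4 / eta) + eta / 2.
Proof.
move=> HJ Hsep eta01 HV; have /andP[eta0 eta1] := eta01.
have l4 : 0 <= ln (4 / eta) by rewrite ln_ge0 // ler_pdivlMr //; lra.
have x0 : 0 < eta / 4 by rewrite divr_gt0.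
have x01 : 0 < eta / 4 <= 1 by rewrite x0; lra.
have rhs0 : 0 <= 2 * V%:R * ln (4 / eta) + eta / 2.
  by rewrite addr_ge0 // ?mulr_ge0 ?divr_ge0 // ltW.
have [H1|H2] := leqP #|H| 1.
  by rewrite (le_trans _ rhs0) // ln_le0 // lern1.
have J0 : (0 < #|J|)%N.
  have /card_gt1P[B [C [/HJ BJ /HJ CJ]]] := H2; apply: contraNT.
  rewrite -eqn0Ngt cards_eq0 => /eqP J0.
  by move: BJ CJ; rewrite J0 !finset.subset0 => /eqP -> /eqP ->.
have M0 : 0 < #|H|%:R :> R by rewrite ltr0n; lia.
have lM : 0 <= ln #|H|%:R :> R by rewrite ln_ge0 // ler1n; lia.
(* With m > y points, |H|^2 (1 - eta)^m <= |H|^2 e^(- eta m) < 1, as the separating sample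
   requires. *)
pose y := 2 * ln #|H|%:R / eta : R.
have y0 : 0 <= y by rewrite /y divr_ge0 ?mulr_ge0 // ltW.
have [m my my1] : exists2 m : nat, y < m%:R & m%:R <= y + 1.
  by exists (Num.truncn y).+1; rewrite ?truncnS_gt // -natr1 lerD2r truncn_le.
have small : (#|H| ^ 2)%N%:R * (1 - eta) ^+ m < 1.
  apply: (@lt_le_trans _ _ (expR (2 * ln #|H|%:R + (- eta) * y))); last first.
    rewrite -[leRHS]expR0 ler_expR /y le_eqVlt; apply/orP; left; apply/eqP.
    by field; exact: lt0r_neq0.
  rewrite expRD expRM_natl lnK ?posrE // natrX ltr_pM2l ?exprn_gt0 //.
  apply: (@le_lt_trans _ _ (expR (- eta) ^+ m)).
    by rewrite lerXn2r ?nnegrE ?expR_ge0 //; [lra|apply: expR_ge1Dx].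
  by rewrite -expRM_natr ltr_expR ltr_nM2l ?oppr_lt0.
have [s sinj] := exists_separating_sample HJ Hsep J0 eta01 small.
pose G := ((fun B : {set I} => s @^-1: B) @: H)%SET.
have GV S : fshatters G S -> (#|S| <= V)%N.
  by move=> /fshatters_preimset[/HV + <-].
have cG : #|G| = #|H| by rewrite card_in_imset.
(* At x = eta / 4 this gives ln |H| <= V ln (4 / eta) + eta m / 4. Since eta m / 4 <= ln |H| / 2 +
   eta / 4, half of ln |H| is absorbed on the left, whence the factor 2 on V. *)
have := card_vc_le GV x01; rewrite cG card_ord => card.
have : ln (#|H|%:R * (eta / 4) ^+ V) <= eta / 4 * m%:R.
  rewrite -[leRHS]expRK ler_ln ?posrE ?expR_gt0 ?mulr_gt0 ?exprn_gt0 //.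
  apply: (le_trans card); rewrite expRM_natr // lerXn2r ?nnegrE ?expR_ge0 ?expR_ge1Dx //.
  by lra.
rewrite lnM ?posrE ?exprn_gt0 // lnXn // -[ln (eta / 4) *+ V]mulr_natl.
have -> : ln (eta / 4) = - ln (4 / eta) by rewrite -lnV ?posrE ?invf_div // divr_gt0.
have : eta / 4 * m%:R <= ln #|H|%:R / 2 + eta / 4.
  apply: (@le_trans _ _ (eta / 4 * (y + 1))); first by rewrite ler_wpM2l // ltW.
  rewrite /y le_eqVlt; apply/orP; left; apply/eqP; field; exact: lt0r_neq0.
lra.
Qed.

(** * Rademacher averages and chaining *)

Definition is_pmf (R : realType) (T : finType) (q : T -> R) :=
  (forall t, 0 <= q t) /\ \sum_t q t = 1.

Definition Ex (R : realType) (T : finType) (q : T -> R) (f : T -> R) : R :=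
  \sum_t q t * f t.

Definition prodw (R : realType) (I T : finType) (q : T -> R) (x : {ffun I -> T}) : R :=
  \prod_i q (x i).

Section FiniteExpectation.
Variables (R : realType) (T : finType) (q : T -> R).
Hypothesis qpmf : is_pmf q.
Implicit Types f g : T -> R.

Let q0 t : 0 <= q t. Proof. by case: qpmf. Qed.

Lemma Ex_cst c : Ex q (fun=> c) = c.
Proof. by rewrite /Ex -mulr_suml (proj2 qpmf) mul1r. Qed.

Lemma ExD f g : Ex q (fun t => f t + g t) = Ex q f + Ex q g.
Proof. by rewrite /Ex -big_split; apply: eq_bigr => t _; rewrite mulrDr. Qed.

Lemma ExB f g : Ex q (fun t => f t - g t) = Ex q f - Ex q g.
Proof. by rewrite /Ex -sumrB; apply: eq_bigr => t _; rewrite mulrBr. Qed.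

Lemma ExZ c f : Ex q (fun t => c * f t) = c * Ex q f.
Proof. by rewrite /Ex mulr_sumr; apply: eq_bigr => t _; rewrite mulrCA. Qed.

Lemma Ex_sum (K : Type) (r : seq K) (P : pred K) (f : K -> T -> R) :
  Ex q (fun t => \sum_(k <- r | P k) f k t) = \sum_(k <- r | P k) Ex q (f k).
Proof. by rewrite /Ex exchange_big; apply: eq_bigr => t _; rewrite mulr_sumr. Qed.

Lemma Ex_le f g : (forall t, f t <= g t) -> Ex q f <= Ex q g.
Proof. by move=> fg; apply: ler_sum => t _; rewrite ler_wpM2l. Qed.

Lemma Ex_ge0 f : (forall t, 0 <= f t) -> 0 <= Ex q f.
Proof. by move=> f0; apply: sumr_ge0 => t _; rewrite mulr_ge0. Qed.

(** Jensen's inequality, from the tangent of the exponential at the mean. *)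
Lemma expR_Ex_le f : expR (Ex q f) <= Ex q (fun t => expR (f t)).
Proof.
set a := Ex q f; apply: (@le_trans _ _ (Ex q (fun t => expR a * (1 + (f t - a))))).
  by rewrite ExZ ExD ExB !Ex_cst subrr addr0 mulr1.
apply: Ex_le => t; have {2}-> : f t = a + (f t - a) by ring.
by rewrite expRD ler_wpM2l ?expR_ge0 // expR_ge1Dx.
Qed.

Lemma Ex_sqrt_le f : (forall t, 0 <= f t) ->
  Ex q (fun t => Num.sqrt (f t)) <= Num.sqrt (Ex q f).
Proof.
move=> f0; set a := Ex q (fun t => Num.sqrt (f t)).
have a0 : 0 <= a by apply: Ex_ge0 => t; rewrite sqrtr_ge0.
rewrite -(ger0_norm a0) -sqrtr_sqr ler_wsqrtr //.
apply: (@le_trans _ _ (Ex q (fun t => 2 * a * Num.sqrt (f t) - a ^+ 2))).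
  by rewrite ExB ExZ Ex_cst -/a; lra.
apply: Ex_le => t; have := sqr_sqrtr (f0 t); set s := Num.sqrt _ => <-.
by have := sqr_ge0 (s - a); rewrite sqrrB; lra.
Qed.

End FiniteExpectation.

Section ProductWeights.
Variables (R : realType) (I T : finType) (q : T -> R).

Lemma Ex_prodw_prod (g : I -> T -> R) :
  Ex (prodw q) (fun x : {ffun I -> T} => \prod_i g i (x i)) = \prod_i Ex q (g i).
Proof.
rewrite /Ex bigA_distr_bigA; apply: eq_bigr => x _.
by rewrite /prodw -big_split.
Qed.

Lemma prodw_pmf : is_pmf q -> is_pmf (prodw q : {ffun I -> T} -> R).
Proof.
move=> qpmf; split=> [x|]; first by apply: prodr_ge0 => i _; case: qpmf.
have := Ex_prodw_prod (fun _ _ => 1); rewrite Ex_cst // /Ex big1_eq.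
by under eq_bigr do rewrite mulr1.
Qed.

Lemma Ex_prodw_coord (i0 : I) (g : T -> R) : is_pmf q ->
  Ex (prodw q) (fun x : {ffun I -> T} => g (x i0)) = Ex q g.
Proof.
move=> qpmf; have := Ex_prodw_prod (fun i t => if i == i0 then g t else 1).
rewrite [RHS](bigD1 i0) //= eqxx [X in _ * X]big1 ?mulr1 => [<-|i /negPf->]; last exact: Ex_cst.
apply: eq_bigr => x _; congr (_ * _).
by rewrite (bigD1 i0) //= eqxx big1 ?mulr1 // => i /negPf->.
Qed.

End ProductWeights.

Definition coin (R : realType) (b : bool) : R := 2^-1.
Arguments coin : clear implicits.

Lemma coin_pmf (R : realType) : is_pmf (coin R).
Proof. by split=> [t|]; rewrite /coin ?invr_ge0 // big_bool /=; field. Qed.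

Definition rad (R : realType) (I : finType) (e : {ffun I -> bool}) (v : I -> R) : R :=
  \sum_i (-1) ^+ e i * v i.

Lemma Ex_expR_rad (R : realType) (I : finType) (v : I -> R) :
  Ex (prodw (coin R)) (fun e : {ffun I -> bool} => expR (rad e v)) <=
  expR (\sum_i v i ^+ 2).
Proof.
rewrite expR_sum; under [Ex _ _]eq_bigr do rewrite expR_sum.
have := Ex_prodw_prod (coin R) (fun i b => expR ((-1) ^+ (b : bool) * v i)).
rewrite {1}/Ex => ->; apply: ler_prod => i _.
rewrite Ex_ge0 /=; [|exact: coin_pmf|by move=> ?; rewrite expR_ge0].
rewrite /Ex big_bool /coin /= expr0 expr1 mul1r mulN1r -mulrDr addrC.
exact: cosh_le_expR_sqr.
Qed.

(** The exponential of a maximum is at most the sum of the exponentials; the 2 inside the logarithm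
    counts the two signs hidden in the absolute value. *)
Lemma Ex_max_rad (R : realType) (I K : finType) (H : {set K}) (v : K -> I -> R) (r : R) :
  (0 < #|H|)%N -> (forall k, k \in H -> \sum_i v k i ^+ 2 <= r) ->
  Ex (prodw (coin R)) (fun e : {ffun I -> bool} => \big[Num.max/0]_(k in H) `|rad e (v k)|)
  <= 2 * Num.sqrt (r * ln (2 * #|H|%:R)).
Proof.
move=> H0 vr; set m := Ex _ _; set L := ln _.
have pc := prodw_pmf I (coin_pmf R).
have /card_gt0P[k0 k0H] := H0.
have maxE (e : {ffun I -> bool}) :
    exists2 k, k \in H & \big[Num.max/0]_(k in H) `|rad e (v k)| = `|rad e (v k)|.
  have [|k kH kE] := @eq_bigmax _ _ _ 0 k0 (mem H) (fun k => `|rad e (v k)|) k0H.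
    by move=> k _; rewrite normr_ge0.
  by exists k.
have r0 : 0 <= r by apply: le_trans (vr _ k0H); apply: sumr_ge0 => i _; rewrite sqr_ge0.
have L0 : 0 < L by rewrite ln_gt0 // -natrM ltr1n; lia.
have [r_gt0|r_le0] := ltP 0 r; last first.
  have {}r0 : r = 0 by apply/le_anti; rewrite r_le0 r0.
  rewrite r0 mul0r sqrtr0 mulr0; suff -> : m = 0 by [].
  rewrite /m -[RHS](Ex_cst pc); apply: eq_bigr => e _; congr (_ * _).
  have [k kH ->] := maxE e; rewrite /rad big1 ?normr0 // => i _.
  have : \sum_i v k i ^+ 2 == 0.
    by rewrite eq_le (le_trans (vr _ kH)) //= sumr_ge0 // => j _; rewrite sqr_ge0.
  rewrite psumr_eq0 => [/allP/(_ i)|j _]; last by rewrite sqr_ge0.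
  by rewrite mem_index_enum sqrf_eq0 => /(_ isT) /eqP ->; rewrite mulr0.
(* This choice balances l r against L / l: both equal sqrt (r L), whence the factor 2. It divides by
   r, so r = 0 was treated apart. *)
pose l := Num.sqrt (L / r).
have l0 : 0 < l by rewrite sqrtr_gt0 divr_gt0.
have l2 : l ^+ 2 * r = L by rewrite sqr_sqrtr ?divr_ge0 ?(ltW L0) // divfK // gt_eqF.
have rl : Num.sqrt (r * L) = L / l.
  rewrite -l2 mulrCA -expr2 sqrtrM ?sqr_ge0 // !sqrtr_sqr !ger0_norm ?(ltW l0) //.
  by field; exact: lt0r_neq0.
suff : expR (l * m) <= expR (2 * L).
  by rewrite ler_expR rl mulrA mulrC ler_pdivlMr // mulrC.
rewrite -ExZ; apply: (le_trans (expR_Ex_le pc _)).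
apply: (@le_trans _ _ (Ex (prodw (coin R)) (fun e : {ffun I -> bool} => \sum_(k in H)
   (expR (rad e (fun i => l * v k i)) + expR (rad e (fun i => - l * v k i)))))).
  apply: Ex_le => // e; 
  have sum0 : 0 <= \sum_(k in H) (expR (rad e (fun i => l * v k i)) + expR (rad e (fun i => - l * v k i))).
    by apply: sumr_ge0 => k _; rewrite addr_ge0 ?expR_ge0.
  have radl c k : rad e (fun i => c * v k i) = c * rad e (v k).
    by rewrite /rad mulr_sumr; apply: eq_bigr => i _; rewrite mulrCA.
  have [k kH ->] := maxE e.
  rewrite (bigD1 k) //= -[leLHS]addr0 lerD //; last first.
    by apply: sumr_ge0 => ? _; rewrite addr_ge0 ?expR_ge0.
  rewrite !radl; case: (ger0P (rad e (v k))) => _; first by rewrite lerDl expR_ge0.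
  by rewrite mulrN mulNr lerDr expR_ge0.
rewrite Ex_sum; apply: (@le_trans _ _ (\sum_(k in H) (2 * expR L))).
  apply: ler_sum => k kH; rewrite ExD mulr_natl mulr2n lerD //.
    apply: (le_trans (Ex_expR_rad _)); rewrite ler_expR -l2.
    by under eq_bigr do rewrite exprMn; rewrite -mulr_sumr ler_wpM2l ?sqr_ge0 ?vr.
  apply: (le_trans (Ex_expR_rad _)); rewrite ler_expR -l2.
  by under eq_bigr do rewrite exprMn sqrrN; rewrite -mulr_sumr ler_wpM2l ?sqr_ge0 ?vr.
rewrite sumr_const -[leLHS]mulr_natl mulrA [_%:R * 2]mulrC.
have -> : 2 * L = L + L by rewrite mulr_natl.
by rewrite expRD /L lnK // posrE mulr_gt0 // ltr0n.
Qed.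

Lemma ln2_le (R : realType) : ln 2 <= 3 / 4 :> R.
Proof.
rewrite -[leRHS]expRK ler_ln ?posrE ?expR_gt0 //.
have -> : 3 / 4 = 8%:R * (3 / 32) :> R by field.
rewrite expRM_natl; apply: (@le_trans _ _ ((1 + 3 / 32) ^+ 8)).
  by rewrite !exprS expr0; lra.
by rewrite lerXn2r ?nnegrE ?expR_ge0 ?expR_ge1Dx //; lra.
Qed.

Definition symdiff (I : finType) (B C : {set I}) : {set I} :=
  ((B :\: C) :|: (C :\: B))%SET.

Lemma symdiff_eq0 (I : finType) (B C : {set I}) : #|symdiff B C| = 0%N -> B = C.
Proof.
move=> /eqP; rewrite cards_eq0 finset.setU_eq0 !finset.setD_eq0 => h.
by apply/eqP; rewrite finset.eqEsubset.
Qed.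

Lemma symdiffC (I : finType) (B C : {set I}) : symdiff B C = symdiff C B.
Proof. by rewrite /symdiff finset.setUC. Qed.

Lemma symdiff_id (I : finType) (B : {set I}) : symdiff B B = finset.set0.
Proof. by rewrite /symdiff finset.setDv finset.setU0. Qed.

Lemma symdiff0 (I : finType) (B : {set I}) : symdiff B finset.set0 = B.
Proof. by rewrite /symdiff finset.setD0 finset.set0D finset.setU0. Qed.

Definition radmax (R : realType) (I : finType) (H : {set {set I}}) : R :=
  Ex (prodw (coin R)) (fun e : {ffun I -> bool} =>
    \big[Num.max/0]_(B in H) `|rad e (fun i => (i \in B)%:R)|).
Arguments radmax : clear implicits.

Lemma radmaxS (R : realType) (I : finType) (H K : {set {set I}}) :
  H \subset K -> radmax R I H <= radmax R I K.
Proof.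
move=> HK; apply: Ex_le => [|e]; first exact: (prodw_pmf I (coin_pmf R)).
by apply: sub_bigmax => B BH; exact: (fintype.subsetP HK).
Qed.

(** One link of the chain. Replacing B by a nearby C in K leaves a difference of indicators whose
    squared norm is |symdiff B C| <= r; the maximal inequality over H bounds all these corrections
    at once. *)
Lemma radmax_chain (R : realType) (I : finType) (H K : {set {set I}}) (r : R) :
  (0 < #|H|)%N ->
  (forall B, B \in H -> exists2 C, C \in K & #|symdiff B C|%:R <= r) ->
  radmax R I H <= radmax R I K + 2 * Num.sqrt (r * ln (2 * #|H|%:R)).
Proof.
move=> H0 HK.
have [f fP] : exists f : {set I} -> {set I}, forall B, B \in H -> f B \in K /\ #|symdiff B (f B)|%:R <= r.
  have /choice[f fP] : forall B, exists C, B \in H -> C \in K /\ #|symdiff B C|%:R <= r.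
    move=> B; have [BH|] := boolP (B \in H); last by exists B.
    by have [C ? ?] := HK B BH; exists C.
  by exists f.
pose v (B : {set I}) (i : I) : R := (i \in B)%:R - (i \in f B)%:R.
have vr B : B \in H -> \sum_i v B i ^+ 2 <= r.
  move=> /fP[_]; apply: le_trans; rewrite -sum1_card natr_sum [leRHS]big_mkcond /=.
  apply: ler_sum => i _; rewrite /v /symdiff !inE.
  by case: (i \in B); case: (i \in f B) => /=; rewrite ?subrr ?subr0 ?sub0r ?sqrrN ?expr1n ?expr0n.
have := Ex_max_rad H0 vr; rewrite -(lerD2l (radmax R I K)); apply: le_trans.
rewrite /radmax -ExD; apply: Ex_le => [|e]; first exact: (prodw_pmf I (coin_pmf R)).
apply: bigmax_le => [|B BH].
  by rewrite addr_ge0 // bigmax_ge_id.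
have [fK _] := fP B BH.
have -> : rad e (fun i => (i \in B)%:R) = rad e (fun i => (i \in f B)%:R) + rad e (v B).
  by rewrite /rad -big_split; apply: eq_bigr => i _ /=; rewrite -mulrDr /v addrC subrK.
apply: (le_trans (ler_normD _ _)); apply: lerD.
  by rewrite (bigmaxD1 (f B)) // le_max lexx.
by rewrite (bigmaxD1 B) // le_max lexx.
Qed.

(** A maximal r-separated subfamily is also an r-net, so the packing bound applies to it. *)
Lemma exists_net (R : realFieldType) (I : finType) (G : {set {set I}}) (r : R) :
  0 <= r -> (0 < #|G|)%N ->
  exists T : {set {set I}}, [/\ T \subset G, (0 < #|T|)%N,
    (forall B C, B \in T -> C \in T -> B != C -> r <= #|symdiff B C|%:R) &
    (forall B, B \in G -> exists2 C, C \in T & #|symdiff B C|%:R <= r)].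
Proof.
move=> r0 /card_gt0P[B0 B0G].
pose P (T : {set {set I}}) : bool := (T \subset G) &&
  [forall B in T, forall C in T, (B != C) ==> (r <= #|symdiff B C|%:R)].
have PB0 : P [set B0]%SET.
  rewrite /P finset.sub1set B0G /=; apply/forall_inP => B; rewrite inE => /eqP ->.
  by apply/forall_inP => C; rewrite inE => /eqP ->; rewrite eqxx.
have [T /maxsetP[/andP[TG /forall_inP sep] Tmax] B0T] := maxset_exists PB0.
have {}sep B C : B \in T -> C \in T -> B != C -> r <= #|symdiff B C|%:R.
  by move=> BT CT BC; have /forall_inP/(_ _ CT)/implyP := sep _ BT; apply.
exists T; split => //.
  by apply/card_gt0P; exists B0; rewrite -finset.sub1set.
move=> B BG; have [BT|BT] := boolP (B \in T).
  by exists B => //; rewrite symdiff_id cards0.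
apply: contrapT => h.
have far C : C \in T -> r <= #|symdiff B C|%:R.
  by move=> CT; rewrite leNgt; apply/negP => lt; apply: h; exists C => //; exact: ltW.
suff PBT : P (B |: T)%SET.
  have TB := Tmax _ PBT (finset.subsetUr _ _).
  by move: BT; rewrite -TB finset.setU11.
rewrite /P finset.subUset finset.sub1set BG TG /=; apply/forall_inP => C; rewrite !inE => /orP CT.
apply/forall_inP => D; rewrite !inE => /orP DT; apply/implyP => CD.
case: CT DT => [/eqP CB|CT] [/eqP DB|DT].
- by move: CD; rewrite CB DB eqxx.
- by rewrite CB far.
- by rewrite DB symdiffC far.
- exact: sep.
Qed.

(* Chaining along nets of Hamming radius 4^-j #|J|, whose cardinality is
   controlled by Dudley's packing bound. *)
Lemma radmax_vc (R : realType) (I : finType) (J : {set I}) (G : {set {set I}}) (V : nat) :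
  (forall B, B \in G -> B \subset J) -> (forall S, fshatters G S -> (#|S| <= V)%N) ->
  (0 < V)%N ->
  radmax R I G <= 24 * Num.sqrt (V%:R * #|J|%:R).
Proof.
move=> GJ GV V0; set N : R := #|J|%:R.
have N0 : 0 <= N by rewrite /N.
have V1 : 1 <= V%:R :> R by rewrite ler1n.
have pos j : 0 < (4^-1 : R) ^+ j by rewrite exprn_gt0 // invr_gt0.
have [G0|G0] := posnP #|G|.
  rewrite /radmax (_ : Ex _ _ = 0) ?mulr_ge0 // -[RHS](Ex_cst (prodw_pmf I (coin_pmf R))).
  apply: eq_bigr => e _; congr (_ * _); apply: big_pred0 => B; apply/negbTE.
  by rewrite (cards0_eq G0) inE.
(* The link from j to j + 1 costs 8 sqrt (V N) (j + 2) / 2^(j + 1), and these costs up to level j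
   sum to 3 - (j + 3) / 2^j times 8 sqrt (V N); the limit is 24 sqrt (V N). The chain starts from
   the empty set alone, within distance N of every member. *)
have chain j : exists T : {set {set I}},
    (forall B, B \in G -> exists2 C, C \in T & #|symdiff B C|%:R <= 4^-1 ^+ j * N) /\
    radmax R I T <= 8 * Num.sqrt (V%:R * N) * (3 - (j%:R + 3) * 2^-1 ^+ j).
  elim: j => [|j [K [GK Kbound]]].
    exists [set finset.set0]%SET; split.
      move=> B BG; exists finset.set0; first by rewrite inE.
      by rewrite symdiff0 expr0 mul1r ler_nat subset_leq_card // GJ.
    rewrite expr0 add0r mulr1 subrr mulr0 /radmax -[leRHS](Ex_cst (prodw_pmf I (coin_pmf R))).
    apply: Ex_le => [|e]; first exact: (prodw_pmf I (coin_pmf R)).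
    apply: bigmax_le => // B; rewrite inE => /eqP ->.
    by rewrite /rad big1 ?normr0 // => i _; rewrite inE mulr0.
  have [T [TG T0 sep cov]] := exists_net (mulr_ge0 (ltW (pos j.+1)) N0) G0.
  exists T; split => //.
  have TK B : B \in T -> exists2 C, C \in K & #|symdiff B C|%:R <= 4^-1 ^+ j * N.
    by move=> BT; apply: GK; apply: (fintype.subsetP TG).
  apply: (le_trans (radmax_chain T0 TK)).
  (* Packing at eta = 4^-(j + 1) contributes 4 V (j + 2) ln 2 <= 3 V (j + 2). The remainder ln 2 +
     eta / 2 is at most 3 / 4 + 1 / 8, hence at most V (j + 2) because V >= 1. *)
  have lnT : ln (2 * #|T|%:R) <= 4 * V%:R * (j%:R + 2) :> R.
    have eta01 : 0 < (4^-1 : R) ^+ j.+1 <= 1.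
      by rewrite pos exprn_ile1 //; lra.
    have := @ln_card_packing R I J T _ V _ sep eta01 _ => /=.
    move=> /(_ (fun B BT => GJ B (fintype.subsetP TG _ BT))).
    move=> /(_ (fun S ST => GV S (fshattersS TG ST))).
    rewrite exprVn invrK -exprS lnXn // -[ln 4 *+ _]mulr_natl => h.
    have l4 : ln 4 = 2 * ln 2 :> R.
      have -> : 4 = 2 ^+ 2 :> R by rewrite expr2; lra.
      by rewrite lnXn // mulr_natl.
    rewrite lnM ?posrE ?ltr0n //.
    have small : ((4 : R) ^+ j.+1)^-1 <= 4^-1.
      by rewrite exprSr invfM ler_piMl // invf_le1 ?exprn_gt0 // exprn_ege1 //; lra.
    have l2 := ln2_le R.
    have jV : V%:R * (2 * (j.+2%:R * ln 4)) <= V%:R * (3 * (j%:R + 2)) :> R.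
      rewrite ler_wpM2l // l4 -[j.+2]addn2 natrD.
      have : (j%:R + 2) * ln 2 <= (j%:R + 2) * (3 / 4) :> R by rewrite ler_wpM2l // addr_ge0.
      lra.
    have vj : 1 * 1 <= V%:R * (j%:R + 2) :> R by rewrite ler_pM //; have := ler0n R j; lra.
    clear -h small l2 jV vj; lra.
  have step : 2 * Num.sqrt (4^-1 ^+ j * N * ln (2 * #|T|%:R)) <=
      8 * Num.sqrt (V%:R * N) * (2^-1 ^+ j.+1 * (j%:R + 2)).
    have e0 : 0 <= 2^-1 ^+ j * (2 * (j%:R + 2)) :> R.
      by rewrite mulr_ge0 ?exprn_ge0 ?mulr_ge0 ?addr_ge0.
    apply: (@le_trans _ _ (2 * Num.sqrt ((2^-1 ^+ j * (2 * (j%:R + 2))) ^+ 2 * (V%:R * N)))).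
      rewrite ler_pM2l // ler_wsqrtr //.
      have -> : (4^-1 : R) ^+ j = (2^-1 ^+ j) ^+ 2 by rewrite exprAC; congr (_ ^+ _); field.
      rewrite exprMn -[leLHS]mulrA -[leRHS]mulrA ler_wpM2l ?exprn_ge0 ?invr_ge0 //.
      apply: (@le_trans _ _ (N * (4 * V%:R * (j%:R + 2)))); first by rewrite ler_wpM2l.
      have : 1 * ((j%:R + 2) * (V%:R * N)) <= (j%:R + 2) * ((j%:R + 2) * (V%:R * N)) :> R.
        by rewrite ler_wpM2r ?mulr_ge0 ?addr_ge0 //; have := ler0n R j; lra.
      clear; lra.
    rewrite sqrtrM ?sqr_ge0 // sqrtr_sqr (ger0_norm e0) exprS.
    by rewrite le_eqVlt; apply/orP; left; apply/eqP; field.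
  apply: (le_trans (lerD Kbound step)).
  rewrite -mulrDr ler_wpM2l ?mulr_ge0 // -natr1 exprS.
  by rewrite le_eqVlt; apply/orP; left; apply/eqP; field.
(* Hamming distances are integers: once the radius is below 1 the net contains G itself. *)
have [j jN] : exists j : nat, (4^-1 : R) ^+ j * N < 1.
  exists #|J|; rewrite exprVn mulrC ltr_pdivrMr ?exprn_gt0 // mul1r /N.
  by rewrite -natrX ltr_nat ltn_expl.
have [T [GT Tbound]] := chain j.
have : radmax R I G <= radmax R I T.
  apply: radmaxS; apply/fintype.subsetP => B /GT[C CT BC].
  suff -> : B = C by [].
  apply: symdiff_eq0; apply/eqP; rewrite -leqn0 -ltnS -(ltr_nat R).
  exact: le_lt_trans BC jN.
move=> /le_trans -> //; apply: (le_trans Tbound).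
rewrite -subr_ge0; set s := Num.sqrt _.
rewrite (_ : _ - _ = 8 * s * ((j%:R + 3) * 2^-1 ^+ j)); last by field.
by rewrite !mulr_ge0 ?addr_ge0 ?exprn_ge0 ?sqrtr_ge0.
Qed.

(** * Symmetrization and concentration on finite spaces *)

Section Symmetrization.
Variables (R : realType) (I T K : finType) (q : T -> R) (F : K -> {set T}).
Hypothesis qpmf : is_pmf q.

Let Qpmf : is_pmf (prodw q : {ffun I -> T} -> R) := prodw_pmf I qpmf.

Definition emp_dev (x : {ffun I -> T}) : R :=
  \big[Num.max/0]_k `|\sum_i ((x i \in F k)%:R - Ex q (fun t => (t \in F k)%:R))|.

Let swap (e : {ffun I -> bool}) (xy : {ffun I -> T} * {ffun I -> T}) :=
  ([ffun i => if e i then xy.2 i else xy.1 i], [ffun i => if e i then xy.1 i else xy.2 i]).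

Let swapK e : involutive (swap e).
Proof. by move=> [x y]; congr pair; apply/ffunP => i; rewrite !ffunE; case: (e i). Qed.

(** Exchanging x i and y i wherever [e i] holds is an involution that preserves the joint product
    weight, so the differences of the two samples may carry arbitrary signs. *)
Let Ex_swap e (f : {ffun I -> T} -> {ffun I -> T} -> R) :
  Ex (prodw q) (fun x => Ex (prodw q) (f x)) =
  Ex (prodw q) (fun x => Ex (prodw q) (fun y => f (swap e (x, y)).1 (swap e (x, y)).2)).
Proof.
rewrite /Ex; under eq_bigr do rewrite mulr_sumr.
under [RHS]eq_bigr do rewrite mulr_sumr.
rewrite !pair_bigA /= [LHS](reindex_inj (inv_inj (swapK e))) /=.
apply: eq_bigr => -[x y] _ /=; rewrite !mulrA; congr (_ * _).
rewrite /prodw -!big_split /=; apply: eq_bigr => i _; rewrite !ffunE.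
by case: (e i) => //; rewrite mulrC.
Qed.

Let symm (e : {ffun I -> bool}) (x y : {ffun I -> T}) : R :=
  \big[Num.max/0]_k `|rad e (fun i => (x i \in F k)%:R - (y i \in F k)%:R)|.

Let half (e : {ffun I -> bool}) (x : {ffun I -> T}) : R :=
  \big[Num.max/0]_k `|rad e (fun i => (x i \in F k)%:R)|.

(** Each mean is an expectation over an independent copy [y]; the absolute value and the maximum
    then move inside that expectation. The constant sign vector puts the result in the form
    [symm]. *)
Let ghost x : emp_dev x <= Ex (prodw q) (fun y => symm [ffun=> false] x y).
Proof.
have symm0 k (y : {ffun I -> T}) : rad [ffun=> false] (fun i => (x i \in F k)%:R - (y i \in F k)%:R : R)
    = \sum_i ((x i \in F k)%:R - (y i \in F k)%:R).
  by apply: eq_bigr => i _; rewrite ffunE expr0 mul1r.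
apply: bigmax_le => [|k _].
  by apply: Ex_ge0 => // y; rewrite bigmax_ge_id.
have -> : \sum_i ((x i \in F k)%:R - Ex q (fun t => (t \in F k)%:R)) =
    Ex (prodw q) (fun y : {ffun I -> T} => \sum_i ((x i \in F k)%:R - (y i \in F k)%:R)).
  rewrite Ex_sum; apply: eq_bigr => i _.
  by rewrite ExB Ex_cst // (Ex_prodw_coord i (fun t => (t \in F k)%:R)).
rewrite ler_norml -[- Ex _ _]mulN1r -ExZ; apply/andP; split; last first.
  apply: Ex_le => // y; apply: (le_trans (ler_norm _)).
  by rewrite /symm (bigmaxD1 k) // le_max symm0 lexx.
apply: Ex_le => // y; rewrite mulN1r lerNl; apply: (le_trans (ler_norm _)); rewrite normrN.
by rewrite /symm (bigmaxD1 k) // le_max symm0 lexx.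
Qed.

Lemma Ex_emp_dev_le_radmax :
  Ex (prodw q) emp_dev <= 2 * Ex (prodw q) (fun x : {ffun I -> T} =>
     radmax R I ((fun k => x @^-1: F k) @: [set: K]))%SET.
Proof.
have Cpmf := prodw_pmf I (coin_pmf R).
apply: (@le_trans _ _ (Ex (prodw (coin R)) (fun e : {ffun I -> bool} =>
   Ex (prodw q) (fun x => Ex (prodw q) (symm e x))))).
  rewrite -[leLHS](Ex_cst Cpmf); apply: Ex_le => // e.
  apply: (le_trans (Ex_le Qpmf ghost)); rewrite (Ex_swap e).
  apply: Ex_le => // x; apply: Ex_le => // y.
  apply: le_bigmax2 => k _; rewrite le_eqVlt; apply/orP; left; apply/eqP; congr `|_|.
  apply: eq_bigr => i _ /=; rewrite !ffunE expr0 mul1r.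
  by case: (e i); rewrite ?expr0 ?expr1 ?mul1r // mulN1r opprB.
apply: (@le_trans _ _ (Ex (prodw (coin R)) (fun e : {ffun I -> bool} =>
   2 * Ex (prodw q) (half e)))).
  apply: Ex_le => // e; have -> : 2 * Ex (prodw q) (half e) =
     Ex (prodw q) (fun x => Ex (prodw q) (fun y => half e x + half e y)).
    transitivity (Ex (prodw q) (fun x => half e x + Ex (prodw q) (half e))).
      by rewrite ExD Ex_cst // mulr_natl mulr2n.
    by apply: eq_bigr => x _; rewrite ExD Ex_cst.
  apply: Ex_le => // x; apply: Ex_le => // y; apply: bigmax_le => [|k _].
    by rewrite addr_ge0 // bigmax_ge_id.
  have -> : rad e (fun i => (x i \in F k)%:R - (y i \in F k)%:R : R) =
      rad e (fun i => (x i \in F k)%:R) - rad e (fun i => (y i \in F k)%:R).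
    by rewrite /rad -sumrB; apply: eq_bigr => i _; rewrite mulrBr.
  apply: (le_trans (ler_normB _ _)); apply: lerD.
    by rewrite /half (bigmaxD1 k) // le_max lexx.
  by rewrite /half (bigmaxD1 k) // le_max lexx.
rewrite ExZ ler_wpM2l // le_eqVlt; apply/orP; left; apply/eqP.
rewrite /Ex; under eq_bigr do rewrite mulr_sumr.
rewrite exchange_big /=; apply: eq_bigr => x _.
rewrite /radmax /Ex mulr_sumr; apply: eq_bigr => e _; rewrite mulrCA; congr (_ * (_ * _)).
rewrite /half; apply/le_anti/andP; split.
  apply: bigmax_le => [|k _]; first exact: bigmax_ge_id.
  rewrite (bigmaxD1 (x @^-1: F k)%SET) ?imset_f //= le_max; apply/orP; left.
  by rewrite le_eqVlt; apply/orP; left; apply/eqP; congr `|_|; apply: eq_bigr => i _; rewrite inE.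
apply: bigmax_le => [|B /imsetP[k _ ->]]; first exact: bigmax_ge_id.
rewrite (bigmaxD1 k) //= le_max; apply/orP; left.
by rewrite le_eqVlt; apply/orP; left; apply/eqP; congr `|_|; apply: eq_bigr => i _; rewrite inE.
Qed.

(** Given the sample, all traces lie among the points that fall in U, so chaining pays only for
    their number. Jensen's inequality for the square root then replaces this number by its mean. *)
Lemma Ex_emp_dev_vc (U : {set T}) (V : nat) :
  (forall k, F k \subset U) ->
  (forall S, fshatters (F @: [set: K])%SET S -> (#|S| <= V)%N) -> (0 < V)%N ->
  Ex (prodw q) emp_dev <=
  48 * Num.sqrt (V%:R * (#|I|%:R * Ex q (fun t => (t \in U)%:R))).
Proof.
move=> FU FV V0; apply: (le_trans Ex_emp_dev_le_radmax).
have -> : 48 = 2 * 24 :> R by ring.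
rewrite -mulrA ler_wpM2l //.
apply: (@le_trans _ _ (Ex (prodw q) (fun x : {ffun I -> T} => 24 * Num.sqrt (V%:R * #|x @^-1: U|%SET%:R)))).
  apply: Ex_le => // x; apply: radmax_vc => //.
    by move=> B /imsetP[k _ ->]; apply: preimsetS.
  move=> S; have -> : ((fun k => x @^-1: F k) @: [set: K] =
      (fun B : {set T} => x @^-1: B) @: (F @: [set: K]))%SET by rewrite -imset_comp.
  by move=> /fshatters_preimset[/FV + <-].
rewrite ExZ ler_wpM2l //; apply: le_trans (Ex_sqrt_le Qpmf _) _ => [x|].
  by rewrite mulr_ge0.
rewrite ExZ ler_wsqrtr // ler_wpM2l //.
have -> : Ex (prodw q) (fun x : {ffun I -> T} => #|x @^-1: U|%SET%:R) =
    Ex (prodw q) (fun x : {ffun I -> T} => \sum_i (x i \in U)%:R).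
  apply: eq_bigr => x _; congr (_ * _); rewrite -sum1_card natr_sum big_mkcond.
  by apply: eq_bigr => i _; rewrite inE; case: (_ \in _).
rewrite Ex_sum; under eq_bigr do rewrite (Ex_prodw_coord _ (fun t => (t \in U)%:R)) //.
by rewrite sumr_const -[leLHS]mulr_natl.
Qed.

(** Changing one point alters one summand of each deviation, and only if the old or the new point is
    in U. An indicator in place of the constant 1 is what later yields a variance of order n P(U)
    instead of n. *)
Lemma emp_dev_bounded_diff (U : {set T}) (i : I) (x y : {ffun I -> T}) :
  (forall k, F k \subset U) -> (forall j, j != i -> x j = y j) ->
  `|emp_dev x - emp_dev y| <= ((x i \in U) || (y i \in U))%:R.
Proof.
move=> FU; wlog suff gen : x y / (forall j, j != i -> x j = y j) ->
    emp_dev x <= emp_dev y + ((x i \in U) || (y i \in U))%:R.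
  move=> xy; rewrite ler_norml lerBlDl gen // andbT lerNl opprB lerBlDl orbC gen //.
  by move=> j /xy.
move=> xy; apply: bigmax_le => [|k _]; first by rewrite addr_ge0 // bigmax_ge_id.
apply: (@le_trans _ _ (`|\sum_i ((y i \in F k)%:R - Ex q (fun t => (t \in F k)%:R))| +
   `|(x i \in F k)%:R - (y i \in F k)%:R|)).
  rewrite (le_trans _ (ler_normD _ _)) // le_eqVlt; apply/orP; left; apply/eqP; congr `|_|.
  rewrite (bigD1 i) //= [in RHS](bigD1 i) //=.
  under eq_bigr => j /xy -> do over.
  by ring.
apply: lerD; first by rewrite /emp_dev (bigmaxD1 k) // le_max lexx.
have /fintype.subsetP FUk := FU k.
have [xF|xF] := boolP (x i \in F k); have [yF|yF] := boolP (y i \in F k);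
  rewrite ?subrr ?normr0 ?subr0 ?sub0r ?normrN ?normr1 //.
- by rewrite (FUk _ xF).
- by rewrite (FUk _ yF) orbT.
Qed.

End Symmetrization.

(** * Concentration under bounded differences *)

Definition fcons (T : Type) (n : nat) (t : T) (y : {ffun 'I_n -> T}) : {ffun 'I_n.+1 -> T} :=
  [ffun i => if unlift ord0 i is Some j then y j else t].

Lemma fcons0 (T : Type) (n : nat) (t : T) (y : {ffun 'I_n -> T}) : fcons t y ord0 = t.
Proof. by rewrite ffunE unlift_none. Qed.

Lemma fconsS (T : Type) (n : nat) (t : T) (y : {ffun 'I_n -> T}) (j : 'I_n) :
  fcons t y (lift ord0 j) = y j.
Proof. by rewrite ffunE liftK. Qed.

Lemma Ex_prodw_fcons (R : realType) (T : finType) (q : T -> R) (n : nat)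
    (f : {ffun 'I_n.+1 -> T} -> R) :
  Ex (prodw q) f = Ex q (fun t => Ex (prodw q) (fun y => f (fcons t y))).
Proof.
rewrite /Ex; under [RHS]eq_bigr do rewrite mulr_sumr.
rewrite pair_bigA /= (reindex (fun ty : T * {ffun 'I_n -> T} => fcons ty.1 ty.2)) /=.
  apply: eq_bigr => -[t y] _ /=; rewrite mulrA; congr (_ * _).
  rewrite /prodw big_ord_recl fcons0; congr (_ * _).
  by apply: eq_bigr => j _; rewrite fconsS.
exists (fun x : {ffun 'I_n.+1 -> T} => (x ord0, [ffun j => x (lift ord0 j)])) => [[t y] _|x _] /=.
  by rewrite fcons0; congr pair; apply/ffunP => j; rewrite ffunE fconsS.
apply/ffunP => i; rewrite ffunE.
by case: unliftP => [j ->|->//]; rewrite ffunE.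
Qed.

Lemma Ex_sqr_dev_le (R : realType) (T : finType) (q : T -> R) (g : T -> R) (c : R) :
  is_pmf q -> Ex q (fun t => (g t - Ex q g) ^+ 2) <= Ex q (fun t => (g t - c) ^+ 2).
Proof.
move=> qpmf; set a := Ex q g.
have -> : Ex q (fun t => (g t - c) ^+ 2) =
    Ex q (fun t => (g t - a) ^+ 2 + (2 * (a - c) * (g t - a) + (a - c) ^+ 2)).
  by apply: eq_bigr => t _; congr (_ * _); ring.
by rewrite !ExD ExZ ExB !Ex_cst // subrr mulr0 add0r lerDl sqr_ge0.
Qed.

(* Tensorisation: e^u <= 1 + u + u^2 bounds the contribution of one coordinate. *)
Lemma Ex_expR_bounded_diff (R : realType) (T : finType) (q : T -> R) (U : {set T})
    (l : R) (n : nat) (f : {ffun 'I_n -> T} -> R) :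
  is_pmf q -> 0 <= l <= 1 ->
  (forall i (x y : {ffun 'I_n -> T}), (forall j, j != i -> x j = y j) ->
     `|f x - f y| <= ((x i \in U) || (y i \in U))%:R) ->
  Ex (prodw q) (fun x => expR (l * (f x - Ex (prodw q) f))) <=
  expR (l ^+ 2 * (n%:R * Ex q (fun t => (t \in U)%:R))).
Proof.
move=> qpmf /andP[l0 l1]; set u := Ex q _.
elim: n f => [|n IH] f fU.
  have Qpmf := prodw_pmf 'I_0 qpmf.
  have fc x : f x = Ex (prodw q) f.
    rewrite -[LHS](Ex_cst Qpmf); apply: eq_bigr => y _; congr (_ * f _).
    by apply/ffunP => -[].
  rewrite mul0r mulr0 -[leRHS](Ex_cst Qpmf) Ex_le // => x.
  by rewrite fc subrr mulr0.
have Qpmf := prodw_pmf 'I_n qpmf.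
pose g t := Ex (prodw q) (fun y => f (fcons t y)).
have Ef : Ex (prodw q) f = Ex q g by rewrite Ex_prodw_fcons.
have gU t t' : `|g t - g t'| <= ((t \in U) || (t' \in U))%:R.
  rewrite /g -ExB.
  have bnd y : `|f (fcons t y) - f (fcons t' y)| <= ((t \in U) || (t' \in U))%:R.
    have := @fU ord0 (fcons t y) (fcons t' y); rewrite !fcons0; apply => j.
    by case: (unliftP ord0 j) => [j' ->|-> /eqP//]; rewrite !fconsS.
  rewrite ler_norml; apply/andP; split;
    [rewrite -[leLHS](Ex_cst Qpmf)|rewrite -[leRHS](Ex_cst Qpmf)];
  by apply: Ex_le => // y; move: (bnd y); rewrite ler_norml => /andP[].
have IHt t : Ex (prodw q) (fun y => expR (l * (f (fcons t y) - g t))) <= expR (l ^+ 2 * (n%:R * u)).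
  apply: IH => i x y xy; have := @fU (lift ord0 i) (fcons t x) (fcons t y).
  rewrite !fconsS; apply => j; case: (unliftP ord0 j) => [j' ->|->]; last by rewrite !fcons0.
  by rewrite !fconsS => ji; apply: xy; apply: contraNneq ji => ->.
rewrite Ex_prodw_fcons Ef -natr1 mulrDl mul1r mulrDr addrC expRD.
apply: (@le_trans _ _ (Ex q (fun t => expR (l ^+ 2 * (n%:R * u)) * expR (l * (g t - Ex q g))))).
  apply: Ex_le => // t; apply: (@le_trans _ _ (expR (l * (g t - Ex q g)) *
     Ex (prodw q) (fun y => expR (l * (f (fcons t y) - g t))))); last first.
    by rewrite mulrC ler_wpM2r ?expR_ge0.
  rewrite -ExZ le_eqVlt; apply/orP; left; apply/eqP.
  apply: eq_bigr => y _; congr (_ * _); rewrite -expRD; congr expR; ring.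
rewrite ExZ mulrC ler_wpM2r ?expR_ge0 //.
(* A reference point outside U, if there is one: then g t differs from g t0 by at most the indicator
   of U at t, which bounds the variance by P(U). If U is everything, any point serves. *)
have [t0 t0U] : exists t0, forall t, (t0 \in U) -> t \in U.
  have [/existsP[t tU]|/existsPn h] := boolP [exists t, t \notin U].
    by exists t => t'; rewrite (negPf tU).
  have [t _|T0] := pickP (@predT T).
    by exists t => t' _; apply/negPn/h.
  have := proj2 qpmf; rewrite big_pred0 // => /esym/eqP; rewrite oner_eq0 //.
have var : Ex q (fun t => (g t - Ex q g) ^+ 2) <= u.
  apply: (le_trans (Ex_sqr_dev_le _ (g t0) qpmf)); apply: Ex_le => // t.
  have gt1 : `|g t - g t0| <= (t \in U)%:R.
    apply: (le_trans (gU _ _)); rewrite ler_nat; case: (boolP (t0 \in U)) => [/t0U ->//|_].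
    by rewrite orbF.
  rewrite -(ger0_norm (sqr_ge0 _)) normrX expr2.
  apply: (@le_trans _ _ (1 * (t \in U)%:R)); last by rewrite mul1r.
  apply: ler_pM => //; apply: (le_trans gt1); by case: (_ \in _).
apply: (@le_trans _ _ (1 + l ^+ 2 * u)); last exact: expR_ge1Dx.
apply: (@le_trans _ _ (Ex q (fun t => 1 + l * (g t - Ex q g) + l ^+ 2 * (g t - Ex q g) ^+ 2))).
  apply: Ex_le => // t; rewrite -exprMn; apply: expR_le_quadratic.
  have : g t - Ex q g <= 1.
    rewrite -{1}(Ex_cst qpmf (g t)) -ExB -[leRHS](Ex_cst qpmf); apply: Ex_le => // t'.
    apply: (le_trans (ler_norm _)); apply: (le_trans (gU _ _)); by case: (_ || _).
  move=> h; apply: (@le_trans _ _ (1 * 1)); last by rewrite mulr1.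
  apply: (@le_trans _ _ (l * 1)); first by rewrite ler_wpM2l.
  by rewrite ler_wpM2r.
by rewrite !ExD !ExZ ExB !Ex_cst // subrr mulr0 addr0 lerD2l ler_wpM2l ?sqr_ge0.
Qed.

(** Exponential Markov inequality at l = sqrt (L / S): the deviation contributes l (2 sqrt (S L)) =
    2 L and the moment bound l^2 S = L, so e^(-L) remains. The assumption L <= S ensures l <= 1. *)
Lemma emp_dev_tail (R : realType) (n : nat) (T K : finType) (q : T -> R)
    (F : K -> {set T}) (U : {set T}) (V : nat) (S L : R) :
  is_pmf q -> (forall k, F k \subset U) ->
  (forall B, fshatters (F @: [set: K])%SET B -> (#|B| <= V)%N) -> (0 < V)%N ->
  n%:R * Ex q (fun t => (t \in U)%:R) <= S -> 0 < S -> 0 <= L <= S ->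
  Ex (prodw q) (fun x : {ffun 'I_n -> T} =>
     (48 * Num.sqrt (V%:R * S) + 2 * Num.sqrt (S * L) < emp_dev q F x)%R%:R) <= expR (- L).
Proof.
move=> qpmf FU FV V0 US S0 /andP[L0 LS].
have Qpmf := prodw_pmf 'I_n qpmf.
pose Z := emp_dev q F : {ffun 'I_n -> T} -> R; rewrite -/Z.
have EZ : Ex (prodw q) Z <= 48 * Num.sqrt (V%:R * S).
  apply: (le_trans (Ex_emp_dev_vc _ qpmf FU FV V0)); rewrite card_ord.
  by rewrite ler_wpM2l // ler_wsqrtr // ler_wpM2l.
pose l : R := Num.sqrt (L / S).
have l0 : 0 <= l by rewrite sqrtr_ge0.
have LS0 : 0 <= L / S by rewrite divr_ge0 // ltW.
have l1 : l <= 1 by rewrite -sqrtr1 ler_wsqrtr // ler_pdivrMr // mul1r.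
have l2 : l ^+ 2 * S = L by rewrite sqr_sqrtr // divfK // gt_eqF.
clearbody l.
have sSL : Num.sqrt (S * L) = l * S.
  have -> : S * L = (l * S) ^+ 2 by rewrite -l2; ring.
  by rewrite sqrtr_sqr ger0_norm // mulr_ge0 // ltW.
apply: (@le_trans _ _ (Ex (prodw q) (fun x => expR (- (2 * L)) * expR (l * (Z x - Ex (prodw q) Z))))).
  apply: Ex_le => // x; rewrite -expRD; case: ltP => [h|_]; last exact: expR_ge0.
  rewrite -[leLHS]expR0 ler_expR addrC subr_ge0.
  have : l * (2 * (l * S)) <= l * (Z x - Ex (prodw q) Z).
    by rewrite ler_wpM2l // -sSL; lra.
  have -> : l * (2 * (l * S)) = 2 * (l ^+ 2 * S) by ring.
  by rewrite l2.
rewrite ExZ; have l01 : 0 <= l <= 1 by rewrite l0.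
apply: (@le_trans _ _ (expR (- (2 * L)) * expR (l ^+ 2 * (n%:R * Ex q (fun t => (t \in U)%:R))))).
  rewrite ler_wpM2l ?expR_ge0 //; apply: Ex_expR_bounded_diff => // i x y xy.
  exact: emp_dev_bounded_diff.
rewrite -expRD ler_expR.
have : l ^+ 2 * (n%:R * Ex q (fun t => (t \in U)%:R)) <= l ^+ 2 * S by rewrite ler_wpM2l ?sqr_ge0.
by rewrite l2; lra.
Qed.

(** * Uniform deviations over a countable class *)

Lemma fsum_fin (R : Type) (idx : R) (op : Monoid.com_law idx) (T : finType) (f : T -> R) :
  \big[op/idx]_(i \in [set: T]) f i = \big[op/idx]_i f i.
Proof.
rewrite (fsbigE (index_enum T)) ?index_enum_uniq //; first by apply: eq_bigl => i; rewrite in_setT.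
by move=> i _; rewrite mem_index_enum.
Qed.

Lemma measure_fibers d (S : measurableType d) (R : realType) (T : finType)
    (mu : {measure set S -> \bar R}) (l : S -> T) (B : set S) :
  (forall t, measurable (l @^-1` [set t])) -> measurable B ->
  mu B = (\sum_t mu (B `&` l @^-1` [set t]))%E.
Proof.
move=> ml mB; rewrite -fsum_fin -measure_fin_bigcup //.
- congr (mu _); rewrite eqEsubset; split => x; last by move=> [t _ []].
  by move=> Bx; exists (l x).
- exact: finite_finset.
- apply/classical_sets.trivIsetP => s t _ _ st; rewrite -subset0 => x [[_ xs] [_ xt]].
  by move: st; rewrite -xs -xt eqxx.
- by move=> t _; apply: measurableI.
Qed.

Definition vc_le (T : Type) (F : set (set T)) (V : nat) :=
  forall v (S : set T), (S #= `I_v)%card -> shatters F S -> (v <= V)%N.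

Lemma card_setI (T : finType) (B : {set T}) : ([set` B] #= `I_#|B|)%card.
Proof.
have [->|[x0 x0B]] := set_0Vmem B.
  rewrite cards0 II0; suff -> : [set` (finset.set0 : {set T})] = set0 by exact: card_eq00.
  by apply/seteqP; split => // x /=; rewrite inE.
suff -> : [set` B] = (nth x0 (enum B)) @` `I_#|B|.
  apply: inj_card_eq => i j; rewrite !inE /= => iB jB /eqP.
  by rewrite nth_uniq ?enum_uniq -?cardE // => /eqP.
apply/seteqP; split => x /=.
  rewrite -mem_enum => xB; exists (index x (enum B)); last exact: nth_index.
  by rewrite cardE index_mem.
by move=> [i iB <-]; rewrite -mem_enum mem_nth // -cardE.
Qed.

(** Two atoms with the same representative cannot be separated, so [rep] is injective on a shattered
    set of atoms and its image is shattered by the original sets. *)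
Lemma fshatters_rep (T : finType) (S : Type) (K : finType) (rep : T -> S) (C : K -> set S)
    (F : K -> {set T}) (B : {set T}) (V : nat) :
  (forall k t, reflect (C k (rep t)) (t \in F k)) ->
  vc_le (range C) V -> fshatters (F @: [set: K])%SET B -> (#|B| <= V)%N.
Proof.
move=> FC CV /fshattersP sh.
have repinj : {in [set` B] &, injective rep}.
  move=> s t; rewrite !inE /= => sB tB st.
  have := sh [set s]%SET; rewrite finset.sub1set => /(_ sB)[_ /imsetP[k _ ->]] /finset.setP e.
  have := e s; rewrite !inE sB eqxx /= => /FC; rewrite st => /FC tF.
  by have := e t; rewrite !inE tB tF => /esym/eqP.
apply: (CV _ (rep @` [set` B])).
  apply: card_eq_trans (card_setI B); exact: inj_card_eq.
move=> D DB; have := sh [set t in B | `[< D (rep t) >]]%SET.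
move=> []; first by apply/fintype.subsetP => t; rewrite inE => /andP[].
move=> _ /imsetP[k _ ->] /finset.setP e; exists (C k) => //.
apply/seteqP; split => [_ [[t /= tB <-] /FC tF]|y Dy].
  by have := e t; rewrite !inE tB tF => /esym/asboolP.
have [t /= tB ty] := DB _ Dy; rewrite -ty; split; first by exists t.
by apply/FC; have := e t; rewrite !inE tB /= ty asboolT.
Qed.

(* The constant 48 is the 24 of radmax_vc, doubled by symmetrization. *)
Definition vc_threshold (R : realType) (V : nat) (s L : R) : R :=
  48 * Num.sqrt (V%:R * s) + 2 * Num.sqrt (s * L).

Section FiniteTransfer.
Context {R : realType} {d1 d2 : measure_display} {Omega : measurableType d1}
  {S : measurableType d2} (Pr : probability Omega R) (P : probability S R) {n : nat}.
Variable X : 'I_n -> {RV Pr >-> S}.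
Hypothesis Xind : mutually_independent X.
Hypothesis Xlaw : forall i B, measurable B -> distribution Pr (X i) B = P B.

Definition emp_gap (C : set S) (omega : Omega) : R :=
  `|\sum_(i < n) \1_C (X i omega) - n%:R * fine (P C)|.

Lemma measurable_emp_gap C : measurable C -> measurable_fun setT (emp_gap C).
Proof.
move=> mC; apply: measurableT_comp => //; apply: measurable_funB => //.
apply: measurable_sum => i; apply: measurableT_comp => //.
Qed.

Lemma measurable_emp_gap_gt C b : measurable C ->
  measurable [set omega | b < emp_gap C omega].
Proof.
move=> mC; have := measurable_emp_gap mC measurableT (measurable_itv `]b, +oo[).
rewrite setTI; congr measurable.
by apply/seteqP; split => omega /=; rewrite in_itv /= andbT.
Qed.

(* Each X i enters only through the indicators of the sets C j, that is through
   a point of a finite space, whose law under independence is a product. *)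
Lemma emp_gap_tail_fin (m : nat) (C : 'I_m -> set S) (V : nat) (s L : R) :
  (forall k, measurable (C k)) -> vc_le (range C) V -> (0 < V)%N ->
  n%:R * fine (P (\bigcup_k C k)) <= s -> 0 < s -> 0 <= L <= s ->
  (Pr [set omega | exists k, (vc_threshold V s L < emp_gap (C k) omega)%R]
    <= (expR (- L))%:E)%E.
Proof.
move=> mC CV V0 Us s0 L0.
set b := vc_threshold V s L.
pose T : finType := {set 'I_m}.
pose label (x : S) : T := [set k | `[< C k x >]]%SET.
have mlabel t : measurable (label @^-1` [set t]).
  rewrite (_ : _ @^-1` _ = \bigcap_(k in [set: 'I_m]) (if k \in t then C k else ~` C k)).
    by apply: fin_bigcap_measurable => // k _; case: ifP => // _; apply: measurableC.
  apply/seteqP; split => x /=.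
    move=> <- k _; rewrite inE; case: (asboolP (C k x)) => //.
  move=> h; apply/finset.setP => k; rewrite inE; have := h k I.
  by case: ifP => _ => [/asboolT ->//|/asboolF ->].
have [x0 _] : [set: S] !=set0.
  by apply/set0P/eqP => S0; have := probability_setT P; rewrite S0 measure0 => /eqP; rewrite eq_sym onee_eq0.
(* Not every label is attained. [rep] picks a point in each nonempty atom; the other labels get the
   arbitrary point [x0] and carry weight 0 under [q]. *)
have [rep repP] : exists rep : T -> S, forall x, label (rep (label x)) = label x.
  have /choice[rep repP] : forall t, exists y, (exists x, label x = t) -> label y = t.
    move=> t; have [[x xt]|] := pselect (exists x, label x = t); first by exists x.
    by exists x0.
  by exists rep => x; apply: repP; exists x.
pose F (k : 'I_m) : {set T} := [set t | `[< C k (rep t) >]]%SET.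
have FC k t : reflect (C k (rep t)) (t \in F k) by rewrite inE; exact: asboolP.
have labelF k x : reflect (C k x) (label x \in F k).
  have e : `[< C k (rep (label x)) >] = `[< C k x >].
    by have /finset.setP/(_ k) := repP x; rewrite !inE.
  by rewrite inE e; exact: asboolP.
pose q (t : T) : R := fine (P (label @^-1` [set t])).
have qE t : (q t)%:E = P (label @^-1` [set t]) by rewrite fineK // fin_num_measure.
have PE (W : {set T}) (B : set S) : (forall x, reflect (B x) (label x \in W)) -> measurable B ->
    fine (P B) = Ex q (fun t => (t \in W)%:R).
  move=> WB mB; rewrite (measure_fibers P mlabel mB) /Ex -[RHS]/(fine (_%:E)) -sumEFin; congr fine.
  apply: eq_bigr => t _; rewrite EFinM qE; case: (boolP (t \in W)) => tW.
    rewrite mule1; congr (P _); apply/seteqP; split => x; first by case.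
    by move=> /= xt; split => //; apply/WB; rewrite xt.
  rewrite mule0 (_ : _ `&` _ = set0) ?measure0 // -subset0 => x [/WB + xt].
  by rewrite /= in xt; rewrite xt (negPf tW).
have qpmf : is_pmf q.
  split=> [t|]; first by rewrite fine_ge0.
  have := PE finset.setT setT; rewrite probability_setT /= => ->.
  - by apply: eq_bigr => t _; rewrite inE mulr1.
  - by move=> x; rewrite inE; constructor.
  - exact: measurableT.
pose lab (omega : Omega) : {ffun 'I_n -> T} := [ffun i => label (X i omega)].
have lab_pre x : lab @^-1` [set x] = \bigcap_(i in [set i | i \in [set: 'I_n]%SET]) X i @^-1` (label @^-1` [set x i]).
  apply/seteqP; split => omega /=; first by move=> <- i _ /=; rewrite ffunE.
  by move=> h; apply/ffunP => i; rewrite ffunE; apply: (h i); rewrite /= inE.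
have mlab x : measurable (lab @^-1` [set x]).
  rewrite lab_pre; apply: fin_bigcap_measurable => // i _.
  by rewrite -[_ @^-1` _]setTI; apply: (measurable_funPT (X i)).
have Plab x : Pr (lab @^-1` [set x]) = (prodw q x)%:E.
  rewrite lab_pre Xind; last by move=> i; exact: mlabel.
  rewrite /prodw (big_morph _ (@EFinM R) (erefl 1%E)); apply: eq_big => [i|i _]; first by rewrite inE.
  by rewrite qE -(Xlaw i).
have gapE k omega : emp_gap (C k) omega =
    `|\sum_i ((lab omega i \in F k)%:R - Ex q (fun t => (t \in F k)%:R))|.
  rewrite /emp_gap sumrB sumr_const card_ord -[X in _ = `|_ - X|]mulr_natl (PE (F k)) //.
  congr `|_ - _|; apply: eq_bigr => i _; rewrite ffunE indicE.
  suff -> : (X i omega \in C k) = (label (X i omega) \in F k) by [].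
  by apply/idP/idP => [/set_mem/labelF|/labelF/mem_set].
set E := [set omega | _].
have EE : E = [set omega | b < emp_dev q F (lab omega)].
  apply/seteqP; split => omega /=.
    move=> [k]; rewrite gapE => /lt_le_trans; apply.
    by rewrite /emp_dev (bigmaxD1 k) // le_max lexx.
  move=> /bigmax_gtP[|[k _]].
    by rewrite ltNge /b /vc_threshold addr_ge0 // ?mulr_ge0 // sqrtr_ge0.
  by exists k; rewrite gapE.
have mE : measurable E.
  rewrite (_ : E = \bigcup_k [set omega | b < emp_gap (C k) omega]).
    apply: fin_bigcup_measurable => // k _.
    exact: measurable_emp_gap_gt.
  by apply/seteqP; split => omega [k]; [exists k|move=> _; exists k].
rewrite (measure_fibers Pr mlab mE).
have -> : (\sum_x Pr (E `&` lab @^-1` [set x]))%E =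
   (Ex (prodw q) (fun x : {ffun 'I_n -> T} => (b < emp_dev q F x)%R%:R))%:E.
  rewrite /Ex -sumEFin; apply: eq_bigr => x _.
  have [bx|bx] := boolP (b < emp_dev q F x).
    rewrite mulr1 -Plab; congr (Pr _); rewrite EE; apply/seteqP; split => omega /=; first by case.
    by move=> xo; rewrite xo.
  rewrite mulr0 (_ : _ `&` _ = set0) ?measure0 // EE -subset0 => omega [/= + xo].
  by rewrite xo (negPf bx).
rewrite lee_fin; apply: (@emp_dev_tail R n T _ q F (\bigcup_k F k)%SET V s L) => //.
- by move=> k; apply: finset.bigcup_sup.
- by move=> B; apply: (fshatters_rep FC).
- rewrite -(PE _ (\bigcup_k C k)) //; last first.
    by apply: fin_bigcup_measurable.
  move=> x; apply: (iffP idP) => [/finset.bigcupP[k _ /labelF]|[k _ /labelF kx]]; first by exists k.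
  by apply/finset.bigcupP; exists k.
Qed.

(** The events for the first m sets increase with m, and the bound for them does not depend on m;
    continuity from below concludes. *)
Lemma emp_gap_tail (C : nat -> set S) (V : nat) (s L : R) :
  (forall k, measurable (C k)) -> vc_le (range C) V -> (0 < V)%N ->
  (forall m, n%:R * fine (P (\bigcup_(k < m) C k)) <= s) -> 0 < s -> 0 <= L <= s ->
  (Pr [set omega | exists k, (vc_threshold V s L < emp_gap (C k) omega)%R]
    <= (expR (- L))%:E)%E.
Proof.
move=> mC CV V0 Us s0 L0; set b := vc_threshold _ _ _.
pose E m := \bigcup_(k < m) [set omega | b < emp_gap (C k) omega].
have mE m : measurable (E m).
  by apply: bigcup_measurable => k _; exact: measurable_emp_gap_gt.
have -> : [set omega | exists k, b < emp_gap (C k) omega] = \bigcup_m E m.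
  apply/seteqP; split => omega /= [k]; last by move=> _ [l _ h]; exists l.
  by move=> h; exists k.+1 => //; exists k => /=.
have mU : measurable (\bigcup_m E m) by apply: bigcup_measurable => k _.
have Ehomo : nondecreasing_seq E.
  move=> l m lm; apply/subsetPset => omega [k /= kl h]; exists k => //=.
  exact: leq_trans lm.
have cE := @nondecreasing_cvg_mu _ _ _ Pr E mE mU Ehomo.
rewrite -(cvg_lim _ cE) //; apply: lime_le; first by apply/cvg_ex; exists (Pr (\bigcup_m E m)).
apply: nearW => m /=.
have -> : E m = [set omega | exists k : 'I_m, b < emp_gap (C k) omega].
  apply/seteqP; split => omega /= [k]; last by move=> h; exists k => /=.
  by move=> /= km h; exists (Ordinal km).
apply: (@emp_gap_tail_fin m (fun k => C k)) => //.
- move=> v T Tv Tsh; apply: (CV v T Tv) => B BT; have [_ [k _ <-] <-] := Tsh B BT.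
  by exists (C k).
- apply: le_trans (Us m); rewrite ler_wpM2l // le_eqVlt; apply/orP; left; apply/eqP; congr (fine (P _)).
  apply/seteqP; split => x /= [k km Ckx]; first by exists k => /=.
  by exists (Ordinal km).
Qed.
End FiniteTransfer.

(** * The p-norm on the orthant *)

Section LpNorm.
Context {R : realType} {d : nat}.
Implicit Types (x y : d.-tuple R) (p : \bar R).

Lemma lp_exponentP p : (1 <= p)%E -> p = +oo%E \/ exists2 q : R, 1 <= q & p = q%:E.
Proof.
case: p => [q q1|_|]; [right|left|] => //; first by exists q; rewrite -?lee_fin.
Qed.

Lemma lp_normE q x : lp_norm q%:E x = (\sum_(j < d) `|tnth x j| `^ q) `^ q^-1.
Proof. by []. Qed.

Lemma lp_normyE x : lp_norm +oo%E x = \big[Num.max/0]_(j < d) `|tnth x j|.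
Proof. by []. Qed.

Lemma lp_norm_ge0 p x : 0 <= lp_norm p x.
Proof.
by case: p => [q||]; [exact: powR_ge0|exact: bigmax_ge_id|exact: bigmax_ge_id].
Qed.

Lemma le_lp_norm p x y : (1 <= p)%E ->
  (forall j, `|tnth x j| <= `|tnth y j|) -> lp_norm p x <= lp_norm p y.
Proof.
move=> /lp_exponentP[->|[q q1 ->]] xy; rewrite ?lp_normE ?lp_normyE.
  by apply: le_bigmax2 => j _; exact: xy.
have q0 : 0 <= q by lra.
apply: ge0_ler_powR; rewrite ?invr_ge0 ?nnegrE //.
- by apply: sumr_ge0 => j _; exact: powR_ge0.
- by apply: sumr_ge0 => j _; exact: powR_ge0.
by apply: ler_sum => j _; apply: ge0_ler_powR; rewrite ?nnegrE.
Qed.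

Lemma tnth_scale l x j : tnth (scale l x) j = l * tnth x j.
Proof. by rewrite tnth_mktuple. Qed.

Lemma lp_norm_scale p l x : (1 <= p)%E -> 0 <= l ->
  lp_norm p (scale l x) = l * lp_norm p x.
Proof.
move=> /lp_exponentP[->|[q q1 ->]] l0; rewrite ?lp_normE ?lp_normyE; last first.
  have q0 : 0 < q by lra.
  under eq_bigr do rewrite tnth_scale normrM powRM //.
  rewrite -mulr_sumr powRM ?powR_ge0 //; last by apply: sumr_ge0 => j _; exact: powR_ge0.
  by rewrite -powRrM divff ?gt_eqF // powRr1 ?normr_ge0 // ger0_norm.
rewrite (big_endo (fun z => l * z)) /=.
- by apply: eq_bigr => j _; rewrite tnth_scale normrM ger0_norm.
- by move=> a b; rewrite maxr_pMr.
- by rewrite mulr0.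
Qed.

Lemma tnth_le_lp_norm p x j : (1 <= p)%E -> `|tnth x j| <= lp_norm p x.
Proof.
move=> /lp_exponentP[->|[q q1 ->]]; rewrite ?lp_normE ?lp_normyE.
  by rewrite (bigmaxD1 j) // le_max lexx.
have q0 : 0 < q by lra.
have qq : q * q^-1 = 1 by rewrite divff // gt_eqF.
rewrite -[leLHS]powRr1 // -qq powRrM.
apply: ge0_ler_powR; rewrite ?invr_ge0 ?nnegrE ?powR_ge0 ?(ltW q0) //.
  by apply: sumr_ge0 => i _; exact: powR_ge0.
by rewrite (bigD1 j) //= lerDl sumr_ge0 // => i _; rewrite powR_ge0.
Qed.

(** The factor is d^(1/p); at p = +oo the inverse of [p] is 0 and the factor is 1. *)
Lemma lp_norm_le_max p x (M : R) : (1 <= p)%E -> 0 <= M ->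
  (forall j, `|tnth x j| <= M) -> lp_norm p x <= d%:R `^ fine p^-1%E * M.
Proof.
move=> /lp_exponentP[->|[q q1 ->]] M0 xM; rewrite ?lp_normE ?lp_normyE.
  by rewrite invey /= powRr0 mul1r; apply: bigmax_le => // j _.
have q0 : 0 < q by lra.
have qq : q * q^-1 = 1 by rewrite divff // gt_eqF.
rewrite inver gt_eqF //=.
apply: (@le_trans _ _ ((d%:R * M `^ q) `^ q^-1)).
  apply: ge0_ler_powR; rewrite ?invr_ge0 ?(ltW q0) ?nnegrE ?mulr_ge0 ?powR_ge0 //.
    by apply: sumr_ge0 => i _; exact: powR_ge0.
  rewrite -[d in leRHS]card_ord mulr_natl -sumr_const.
  by apply: ler_sum => j _; apply: ge0_ler_powR; rewrite ?nnegrE ?(ltW q0).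
by rewrite powRM ?powR_ge0 // -powRrM qq powRr1.
Qed.

Lemma sphere_le1 p x j : (1 <= p)%E -> sphere p x -> 0 <= tnth x j <= 1.
Proof. by move=> p1 [/(_ j) x0 /= <-]; rewrite x0 -[leLHS]ger0_norm // tnth_le_lp_norm. Qed.

(** Coordinates lie in [0, 1], so each is at least its q-th power, and these powers sum to 1. For p
    = +oo some coordinate equals 1. *)
Lemma sphere_sum_ge1 p x : (1 <= p)%E -> sphere p x -> 1 <= \sum_(j < d) tnth x j.
Proof.
move=> p1 xS; have x01 j := sphere_le1 j p1 xS; case: xS => _ /= x1.
have ge0 j : 0 <= tnth x j by case/andP: (x01 j).
case: (lp_exponentP p1) => [pE|[q q1 pE]]; move: x1; rewrite pE ?lp_normE ?lp_normyE => x1.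
  have : 1 <= \big[Num.max/0]_(j < d) `|tnth x j| by rewrite x1.
  move=> /bigmax_geP[|[j _]]; first by rewrite leNgt ltr01.
  rewrite ger0_norm // => /le_trans; apply.
  by rewrite (bigD1 j) //= lerDl sumr_ge0.
have q0 : 0 < q by lra.
have qq : q^-1 * q = 1 by rewrite mulVf // gt_eqF.
have s0 : 0 <= \sum_(j < d) `|tnth x j| `^ q.
  by apply: sumr_ge0 => j _; exact: powR_ge0.
have <- : \sum_(j < d) `|tnth x j| `^ q = 1.
  by rewrite -[LHS]powRr1 // -qq powRrM x1 powR1.
apply: ler_sum => j _; rewrite ger0_norm //; have /andP[_ xj1] := x01 j.
have [->|xj0] := eqVneq (tnth x j) 0; first by rewrite powR0 // gt_eqF.
rewrite -[leRHS]powRr1 //; apply: ger_powR => //.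
by rewrite xj1 lt_neqAle eq_sym xj0 ge0.
Qed.

Lemma lp_norm_gt0 p x : (1 <= p)%E -> punctured_orthant x -> 0 < lp_norm p x.
Proof.
move=> p1 [x0 xn0]; rewrite lt_neqAle lp_norm_ge0 andbT eq_sym; apply/eqP => n0.
apply: xn0; apply: eq_from_tnth => j; rewrite tnth_mktuple; apply/eqP.
by rewrite -normr_le0 -n0 tnth_le_lp_norm.
Qed.

Lemma punctured_orthantP p x : (1 <= p)%E -> orthant x -> 0 < lp_norm p x -> punctured_orthant x.
Proof.
move=> p1 x0 n0; split => // xE; move: n0; rewrite ltNge => /negP; apply.
rewrite (le_trans (lp_norm_le_max p1 (lexx 0) _)) ?mulr0 // => j.
by rewrite xE tnth_mktuple normr0.
Qed.

Lemma scaleA a b x : scale a (scale b x) = scale (a * b) x.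
Proof. by apply: eq_from_tnth => j; rewrite !tnth_scale mulrA. Qed.

Lemma scale1 x : scale 1 x = x.
Proof. by apply: eq_from_tnth => j; rewrite tnth_scale mul1r. Qed.

Lemma orthant_scale l x : 0 <= l -> orthant x -> orthant (scale l x).
Proof. by move=> l0 x0 j; rewrite tnth_scale mulr_ge0. Qed.

Lemma theta_sphere p x : (1 <= p)%E -> punctured_orthant x -> sphere p (theta p x).
Proof.
move=> p1 x0; have n0 := lp_norm_gt0 p1 x0; split.
  by apply: orthant_scale; [rewrite invr_ge0 ltW|case: x0].
by rewrite /= lp_norm_scale ?invr_ge0 ?(ltW n0) // mulVf ?gt_eqF.
Qed.

Lemma scale_theta p x : 0 < lp_norm p x -> scale (lp_norm p x) (theta p x) = x.
Proof. by move=> n0; rewrite scaleA divff ?gt_eqF // scale1. Qed.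

Lemma theta_scale p l x : (1 <= p)%E -> 0 < l -> theta p (scale l x) = theta p x.
Proof.
move=> p1 l0; rewrite /theta lp_norm_scale ?(ltW l0) // scaleA invfM mulrAC.
by rewrite mulVf ?mul1r // gt_eqF.
Qed.

Lemma theta_sphere_id p x : sphere p x -> theta p x = x.
Proof. by case=> _ /= x1; rewrite /theta x1 invr1 scale1. Qed.

Lemma punctured_scale l x : 0 < l -> punctured_orthant x -> punctured_orthant (scale l x).
Proof.
move=> l0 [x0 xn0]; split; first by apply: orthant_scale; [exact: ltW|].
move=> e; apply: xn0; apply: eq_from_tnth => j; rewrite tnth_mktuple.
have : tnth (scale l x) j = 0 by rewrite e tnth_mktuple.
by rewrite tnth_scale => /eqP; rewrite mulf_eq0 gt_eqF //= => /eqP.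
Qed.

Lemma measurable_lp_norm p : (1 <= p)%E -> measurable_fun setT (lp_norm p : d.-tuple R -> R).
Proof.
move=> /lp_exponentP[->|[q q1 ->]].
  rewrite (_ : lp_norm _ = fun x => \big[Num.max/0]_(j <- index_enum 'I_d) `|tnth x j|) //.
  elim: (index_enum _) => [|j s IH].
    by rewrite (_ : (fun _ => _) = cst 0) //; apply/funext => x; rewrite big_nil.
  rewrite (_ : (fun _ => _) = (fun x => `|tnth x j|) \max (fun x => \big[Num.max/0]_(i <- s) `|tnth x i|)).
    apply: measurable_maxr => //; apply: measurableT_comp => //; exact: measurable_tnth.
  by apply/funext => x; rewrite big_cons.
rewrite (_ : lp_norm _ = (fun y : R => y `^ q^-1) \o (fun x => \sum_(j < d) `|tnth x j| `^ q)) //.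
apply: measurableT_comp; first exact: measurable_powR.
apply: measurable_sum => j.
apply: (measurableT_comp (measurable_powR q)); apply: measurableT_comp => //.
exact: measurable_tnth.
Qed.

Lemma measurable_invr_ge0 d' (T : measurableType d') (f : T -> R) :
  (forall t, 0 <= f t) -> measurable_fun setT f -> measurable_fun setT (fun t => (f t)^-1).
Proof.
move=> f0 mf; rewrite (_ : (fun _ => _) = (fun y : R => y `^ (-1)) \o f).
  by apply: measurableT_comp => //; exact: measurable_powR.
by apply/funext => t /=; rewrite powR_inv1.
Qed.

Lemma measurable_scale d' (T : measurableType d') (f : T -> R) (g : T -> d.-tuple R) :
  measurable_fun setT f -> measurable_fun setT g ->
  measurable_fun setT (fun t => scale (f t) (g t)).
Proof.
move=> mf mg; apply/measurable_fun_tnthP => j.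
rewrite (_ : _ \o _ = (fun t => f t * tnth (g t) j)).
  apply: measurable_funM => //; apply: (measurableT_comp (measurable_tnth j) mg).
by apply/funext => t /=; rewrite tnth_scale.
Qed.

Lemma measurable_theta p : (1 <= p)%E -> measurable_fun setT (theta p : d.-tuple R -> d.-tuple R).
Proof.
move=> p1; apply: (measurable_scale (f := fun x => (lp_norm p x)^-1) (g := id)) => //.
by apply: measurable_invr_ge0; [exact: lp_norm_ge0|exact: measurable_lp_norm].
Qed.

Lemma measurable_orthant : measurable (orthant : set (d.-tuple R)).
Proof.
rewrite (_ : orthant = \bigcap_(j in [set: 'I_d]) [set x | 0 <= tnth x j]); last first.
  by apply/seteqP; split => x h j; [move=> _|]; exact: h.
apply: fin_bigcap_measurable; first exact: finite_finset.
move=> j _; rewrite -[X in measurable X]setTI.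
rewrite (_ : [set x | _] = (fun x : d.-tuple R => tnth x j) @^-1` `[0, +oo[).
  by apply: measurable_tnth.
by apply/seteqP; split => x /=; rewrite in_itv /= andbT.
Qed.

Lemma measurable_lp_norm_ge p r : (1 <= p)%E -> measurable [set x : d.-tuple R | r <= lp_norm p x].
Proof.
move=> p1; rewrite -[X in measurable X]setTI.
rewrite (_ : [set x | _] = lp_norm p @^-1` `[r, +oo[); first exact: measurable_lp_norm.
by apply/seteqP; split => x /=; rewrite in_itv /= andbT.
Qed.

Lemma measurable_punctured_orthant : measurable (punctured_orthant : set (d.-tuple R)).
Proof.
rewrite (_ : punctured_orthant = orthant `&` ~` [set x : d.-tuple R | forall j : 'I_d, tnth x j = 0]).
  apply: measurableI; first exact: measurable_orthant.
  apply: measurableC; rewrite (_ : [set x | _] = \bigcap_(j in [set: 'I_d]) [set x | tnth x j = 0]).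
    apply: fin_bigcap_measurable; first exact: finite_finset.
    move=> j _; rewrite -[X in measurable X]setTI.
    exact: (measurable_tnth j measurableT (measurable_set1 0)).
  by apply/seteqP; split => x h j; [move=> _|]; exact: h.
apply/seteqP; split => x [x0 xn0]; split => // h; apply: xn0.
  by apply: eq_from_tnth => j; rewrite tnth_mktuple h.
by move=> j; rewrite h tnth_mktuple.
Qed.

End LpNorm.

(** * Polar decomposition of the exponent measure *)

(** Push-forward of the restriction of [mu] to D. The proofs are arguments so that the
    finite-measure structure can be attached to the constant itself. *)
Definition rpush d1 d2 (T1 : measurableType d1) (T2 : measurableType d2) (R : realType)
    (mu : {measure set T1 -> \bar R}) (D : set T1) (f : T1 -> T2)
    (mD : measurable D) (mf : measurable_fun setT f) (Dfin : (mu D < +oo)%E)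
    (A : set T2) : \bar R := mu (D `&` f @^-1` A).

Section RestrictedPushforward.
Context d1 d2 (T1 : measurableType d1) (T2 : measurableType d2) (R : realType).
Variables (mu : {measure set T1 -> \bar R}) (D : set T1) (f : T1 -> T2).
Hypotheses (mD : measurable D) (mf : measurable_fun setT f) (Dfin : (mu D < +oo)%E).

Let nu := rpush mD mf Dfin.

Let mDf A : measurable A -> measurable (D `&` f @^-1` A).
Proof. by move=> mA; apply: measurableI => //; rewrite -[X in measurable X]setTI; exact: mf. Qed.

Let nu0 : nu set0 = 0%E.
Proof. by rewrite /nu /rpush preimage_set0 setI0 measure0. Qed.

Let nu_ge0 A : (0 <= nu A)%E.
Proof. exact: measure_ge0. Qed.

Let nu_sigma_additive : semi_sigma_additive nu.
Proof.
move=> F mF tF mUF; rewrite /nu /rpush preimage_bigcup setI_bigcupr.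
apply: measure_semi_sigma_additive => [i||]; first exact: mDf.
  apply/classical_sets.trivIsetP => i j _ _ ij; rewrite -subset0 => x [[_ xi] [_ xj]].
  move/classical_sets.trivIsetP : tF => /(_ _ _ I I ij) FF.
  by have : (F i `&` F j) (f x) by []; rewrite FF.
by rewrite -setI_bigcupr -preimage_bigcup; exact: mDf.
Qed.

HB.instance Definition _ := isMeasure.Build _ _ _ nu nu0 nu_ge0 nu_sigma_additive.

Let nu_fin : fin_num_fun nu.
Proof.
move=> A mA; rewrite ge0_fin_numE ?measure_ge0 //; apply: le_lt_trans Dfin.
by apply: le_measure; rewrite ?inE //; exact: mDf.
Qed.

HB.instance Definition _ := Measure_isFinite.Build _ _ _ nu nu_fin.

End RestrictedPushforward.

Lemma finite_measure_cdf_unique (R : realType)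
    (m1 m2 : {finite_measure set (measurableTypeR R) -> \bar R}) :
  (forall x : R, m1 `]-oo, x]%classic = m2 `]-oo, x]%classic) -> m1 setT = m2 setT ->
  forall A, measurable A -> m1 A = m2 A.
Proof.
move=> cdfE totE.
have rayE (m : {finite_measure set (measurableTypeR R) -> \bar R}) (x : R) :
    m `]x, +oo[%classic = (m setT - m `]-oo, x]%classic)%E.
  rewrite -setCitvl -[~` _]setTD measureD ?setTI //.
  by rewrite -ge0_fin_numE ?measure_ge0 // fin_num_measure.
apply: (@measure_unique _ R (measurableTypeR R) (@RGenOInfty.G R) (fun n => `]- n%:R, +oo[%classic)).
- exact: RGenOInfty.measurableE.
- move=> A B [x ->] [y ->]; exists (Num.max x y); apply/seteqP; split => z /=.
    by rewrite !in_itv /= !andbT gt_max => -[-> ->].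
  by rewrite !in_itv /= !andbT gt_max => /andP[].
- by move=> i; exists (- i%:R).
- rewrite -subTset => x _; exists (Num.truncn `|x|).+1 => //=.
  rewrite in_itv /= andbT ltrNl; apply: le_lt_trans (truncnS_gt _).
  by rewrite -normrN ler_norm.
- move=> A [x ->]; have h1 := rayE m1 x; have h2 := rayE m2 x.
  by rewrite -cdfE -totE -h1 in h2; exact: esym h2.
- move=> k; by rewrite -ge0_fin_numE ?measure_ge0 // fin_num_measure.
Qed.

Lemma uniform01_cdf (R : realType) (x : R) : 0 <= x <= 1 ->
  uniform_prob (@ltr01 R) `]-oo, x]%classic = x%:E.
Proof.
move=> /andP[x0 x1].
have := integral_uniform (@ltr01 R) (f := fun y => (\1_(`]-oo, x]%classic : set R) y)%:E).
rewrite integral_indic // setIT => ->.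
- rewrite subr0 invr1 mul1e integral_indic //.
  rewrite (_ : _ `&` _ = `[0, x]%classic); last first.
    apply/seteqP; split => y /=; rewrite !in_itv /=; first by move=> [-> /andP[-> _]].
    by move=> /andP[-> yx]; rewrite yx (le_trans yx).
  apply: etrans (lebesgue_measure_itv `[0, x]) _; rewrite /= lte_fin.
  by case: ltgtP x0 => // [_ _|<- _]; rewrite ?oppr0 ?adde0.
- by apply/measurable_EFinP; exact: measurable_indic.
- by move=> y; rewrite lee_fin.
Qed.

Section Polar.
Context {R : realType} {d : nat}.
Variables (p : \bar R) (mu : {measure set (d.-tuple R) -> \bar R}).
Hypotheses (p1 : (1 <= p)%E) (muE : exponent_measure mu).

Implicit Type A : set (d.-tuple R).

Definition shell : set (d.-tuple R) :=
  punctured_orthant `&` [set x | 1 <= lp_norm p x].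

Definition tail_cone (t : R) (A : set (d.-tuple R)) : set (d.-tuple R) :=
  [set x | punctured_orthant x /\ t <= lp_norm p x /\ A (theta p x)].

Lemma measurable_shell : measurable shell.
Proof.
by apply: measurableI; [exact: measurable_punctured_orthant|exact: measurable_lp_norm_ge].
Qed.

Lemma cone_shell A : cone p A = shell `&` theta p @^-1` A.
Proof. by apply/seteqP; split => x [] => [? [? ?]|[? ?]]. Qed.

Lemma measurable_cone A : measurable A -> measurable (cone p A).
Proof.
move=> mA; rewrite cone_shell; apply: measurableI; first exact: measurable_shell.
by rewrite -[X in measurable X]setTI; exact: measurable_theta.
Qed.

Lemma tail_cone_scale t A : 0 < t -> tail_cone t A = scale t @` cone p A.
Proof.
move=> t0; apply/seteqP; split => [x [x0 [tx Ax]]|_ [x [x0 [tx Ax]] <-]]; last first.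
  split; first exact: punctured_scale.
  by rewrite lp_norm_scale ?(ltW t0) // theta_scale // ler_peMr // ltW.
have ti : 0 < t^-1 by rewrite invr_gt0.
exists (scale t^-1 x); last by rewrite scaleA divff ?gt_eqF // scale1.
split; first exact: punctured_scale.
rewrite lp_norm_scale ?(ltW ti) // theta_scale //; split => //.
by rewrite mulrC ler_pdivlMr // mul1r.
Qed.

Lemma mu_tail_cone t A : 0 < t -> measurable A ->
  mu (tail_cone t A) = ((t^-1)%:E * mu (cone p A))%E.
Proof.
move=> t0 mA; rewrite tail_cone_scale //; apply: (exponent_homogeneous muE) => //.
  exact: measurable_cone.
by move=> x [].
Qed.

Lemma mu_shell_fin : (mu shell < +oo)%E.
Proof.
apply: (exponent_finite muE); [exact: measurable_shell|by move=> x []|].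
have [d0|d0] := posnP d.
  exists 1 => // x [xp _]; have := lp_norm_gt0 p1 xp.
  have : lp_norm p x <= 0.
    rewrite (le_trans (lp_norm_le_max p1 (lexx 0) _)) ?mulr0 // => j.
    by have := ltn_ord j; rewrite {2}d0.
  by move=> /le_lt_trans h /h; rewrite ltxx.
have dp : 0 < d%:R `^ fine p^-1%E :> R by rewrite powR_gt0 // ltr0n.
exists (d%:R `^ fine p^-1%E)^-1; first by rewrite invr_gt0.
move=> x [_ /= x1]; rewrite -[leLHS]mul1r ler_pdivrMr //; apply: (le_trans x1).
rewrite mulrC; apply: lp_norm_le_max => //; first exact: (lp_norm_ge0 +oo%E).
by move=> j; apply: (@tnth_le_lp_norm _ _ +oo%E); rewrite leey.
Qed.

Let polar (x : d.-tuple R) : measurableTypeR R * d.-tuple R := ((lp_norm p x)^-1, theta p x).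

Let measurable_inv_norm : measurable_fun setT (fun x : d.-tuple R => (lp_norm p x)^-1 : measurableTypeR R).
Proof. by apply: measurable_invr_ge0; [exact: lp_norm_ge0|exact: measurable_lp_norm]. Qed.

Let measurable_polar : measurable_fun setT polar.
Proof. by apply: measurable_fun_pair => //; exact: measurable_theta. Qed.

(** The angular measure as a finite measure on all Borel sets of R^d, the form in which products and
    integrals can be taken; [angular_sphere] says that the sphere carries all its mass. *)
Definition angular : set (d.-tuple R) -> \bar R :=
  rpush measurable_shell (measurable_theta p1) mu_shell_fin.

HB.instance Definition _ := FiniteMeasure.copy angular
  (rpush measurable_shell (measurable_theta p1) mu_shell_fin).

Lemma angularE A : angular A = mu (cone p A).
Proof. by rewrite cone_shell. Qed.

(* Homogeneity makes the inverse radius uniform on (0, 1] and independent of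
   the angle. *)
Lemma polar_decomposition (X : set (measurableTypeR R * d.-tuple R)) : measurable X ->
  (uniform_prob (@ltr01 R) \x angular)%E X = mu (shell `&` polar @^-1` X).
Proof.
move=> mX.
rewrite (@product_measure_unique _ _ _ _ _ (uniform_prob (@ltr01 R)) angular
  (rpush measurable_shell measurable_polar mu_shell_fin)) // => B A mB mA.
have mD : measurable (shell `&` theta p @^-1` A) by rewrite -cone_shell; exact: measurable_cone.
have Dfin : (mu (shell `&` theta p @^-1` A) < +oo)%E.
  apply: le_lt_trans mu_shell_fin; apply: le_measure; rewrite ?inE //; exact: measurable_shell.
have afin : angular A \is a fin_num by rewrite fin_num_measure.
have a0 : 0 <= fine (angular A) by rewrite fine_ge0 // measure_ge0.
(* For fixed A both sides are finite measures in B and are compared through their distribution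
   functions. At x in ]0, 1] homogeneity gives the cone beyond radius 1/x the mass x Phi(A). *)
transitivity (rpush mD measurable_inv_norm Dfin B).
  rewrite /rpush; congr (mu _); apply/seteqP; split => x /=.
    by move=> [? [? ?]].
  by move=> [[? ?] ?].
rewrite muleC -[X in (X * _)%E]fineK //.
apply: (finite_measure_cdf_unique (m1 := rpush mD measurable_inv_norm Dfin)
  (m2 := mscale (NngNum a0) (uniform_prob (@ltr01 R)))) => // [x|]; last first.
  rewrite /= /mscale /= probability_setT mule1 fineK // /rpush preimage_setT setIT.
  by rewrite angularE cone_shell.
rewrite /= /mscale /= /rpush.
have [x0|x0] := leP x 0.
  rewrite (_ : _ `&` _ = set0) ?measure0; last first.
    rewrite -subset0 => y [[[yp _] _]] /=; rewrite in_itv /= => yx.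
    have := lp_norm_gt0 p1 yp; rewrite -invr_gt0.
    by rewrite ltNge (le_trans yx x0).
  have u0 : uniform_prob (@ltr01 R) `]-oo, 0]%classic = 0%E by rewrite uniform01_cdf // lexx ler01.
  suff -> : uniform_prob (@ltr01 R) `]-oo, x]%classic = 0%E by rewrite mule0.
  apply/eqP; rewrite eq_le measure_ge0 andbT -u0; apply: le_measure; rewrite ?inE //.
  by move=> y /=; rewrite !in_itv /= => /le_trans; apply.
have preE : (shell `&` theta p @^-1` A) `&` (fun x0 => (lp_norm p x0)^-1) @^-1` `]-oo, x]%classic =
    cone p A `&` tail_cone x^-1 A.
  rewrite cone_shell; apply/seteqP; split => y /=; rewrite in_itv /=.
    move=> [[[yp y1] yA] yx]; split => //; split => //; split => //.
    by rewrite -[leRHS]invrK lef_pV2 // posrE invr_gt0 // lp_norm_gt0.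
  move=> [yc [yp [yx yA]]]; split => //.
  by rewrite -[leRHS]invrK lef_pV2 // posrE ?invr_gt0 // lp_norm_gt0.
rewrite preE; have [x1|x1] := leP x 1.
  rewrite (uniform01_cdf (x := x)) ?x1 ?ltW // fineK // angularE.
  have xi : 1 <= x^-1 by rewrite invf_ge1.
  rewrite setIidr; last by move=> y [yp [yx yA]]; split => //; split => //; exact: le_trans yx.
  by rewrite mu_tail_cone ?invr_gt0 // invrK muleC.
rewrite setIidl; last first.
  by move=> y [yp [yx yA]]; split => //; split => //; apply: le_trans yx; rewrite invf_le1 // ltW.
suff -> : uniform_prob (@ltr01 R) `]-oo, x]%classic = 1%E by rewrite mule1 fineK // angularE.
apply/eqP; rewrite eq_le probability_le1 //=.
have <- : uniform_prob (@ltr01 R) `]-oo, 1]%classic = 1%E by rewrite uniform01_cdf // lexx ler01.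
apply: le_measure; rewrite ?inE //.
by move=> y /=; rewrite !in_itv /= => /le_trans; apply; exact: ltW.
Qed.

End Polar.

Lemma integral_inv_le (R : realType) (a K : R) : 0 < a < 1 -> 0 <= K ->
  (\int[lebesgue_measure]_(s in `[a, 1%R]) (K * s^-1)%:E = (- K * ln a)%:E)%E.
Proof.
move=> /andP[a0 a1] K0.
have pos (x : R) : a <= x -> 0 < x by exact: lt_le_trans.
have dF (x : R) : 0 < x -> is_derive x 1 (fun x : R => K * ln x) (K * x^-1).
  move=> x0; have h := is_derive1_ln x0; exact: is_deriveZ.
have cF (x : R) : 0 < x -> {for x, continuous (fun x : R => K * ln x)}.
  by move=> /dF ?; apply/differentiable_continuous/derivable1_diffP.
rewrite (continuous_FTC2 (F := fun x => K * ln x)) //.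
- by rewrite ln1 mulr0 sub0e -EFinN mulNr.
- apply: continuous_in_subspaceT => x; rewrite inE /= in_itv /= => /andP[ax _].
  apply: cvgM; first exact: cvg_cst.
  by apply: cvgV; [rewrite gt_eqF // pos|exact: cvg_id].
- split.
  + by move=> x; rewrite in_itv /= => /andP[ax _]; case: (dF x (pos _ (ltW ax))).
  + by apply: cvg_at_right_filter; apply: cF.
  + by apply: cvg_at_left_filter; apply: cF.
- move=> x; rewrite in_itv /= => /andP[ax _].
  by rewrite derive1E; have h := dF x (pos _ (ltW ax)); rewrite derive_val.
Qed.

Section PolarBounds.
Context {R : realType} {d : nat}.
Variables (p : \bar R) (mu : {measure set (d.-tuple R) -> \bar R}).
Hypotheses (p1 : (1 <= p)%E) (muE : exponent_measure mu).

Local Notation Phi := (angular p1 muE).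
Local Notation unif := (uniform_prob (@ltr01 R)).

Lemma measurable_sphere : measurable (sphere p : set (d.-tuple R)).
Proof.
apply: measurableI; first exact: measurable_orthant.
rewrite -[X in measurable X]setTI.
exact: (measurable_lp_norm p1 measurableT (measurable_set1 1)).
Qed.

Lemma angular_sphere : Phi (sphere p) = Phi setT.
Proof.
rewrite !angularE; congr (mu _); apply/seteqP; split => x [xp [x1 _]]; split => //; split => //.
exact: theta_sphere.
Qed.

(* The marginal constraints say that every coordinate of the angle has
   integral 1, while the coordinates of a point of the sphere sum to at least 1. *)
Lemma angular_total : (Phi setT <= d%:R%:E)%E.
Proof.
(* In polar coordinates X j is the set where the j-th coordinate is at least 1, of mass 1 by
   standardization. Integrating the inverse radius first, its section at an angle t of the sphere
   has length t_j. *)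
pose X (j : 'I_d) : set (measurableTypeR R * d.-tuple R) := [set z | z.1 <= tnth z.2 j].
have mX j : measurable (X j).
  rewrite -[X in measurable X]setTI.
  rewrite (_ : X j = (fun z : measurableTypeR R * d.-tuple R => tnth z.2 j - z.1) @^-1` `[0, +oo[); last first.
    by apply/seteqP; split => z /=; rewrite in_itv /= andbT subr_ge0.
  apply: (_ : measurable_fun setT _) => //; apply: measurable_funB.
    exact: (measurableT_comp (measurable_tnth j) measurable_snd).
  exact: measurable_fst.
have X1 j : (unif \x Phi)%E (X j) = 1%E.
  have marg := exponent_margins muE j ltr01; rewrite invr1 in marg.
  rewrite polar_decomposition // -marg; congr (mu _); apply/seteqP; split => x /=.
    move=> [[xp x1]]; rewrite /X /= tnth_scale => h; split => //.
    by move: h; rewrite ler_pMr ?invr_gt0 ?lp_norm_gt0.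
  move=> [xp xj]; have x1 : 1 <= lp_norm p x.
    apply: (le_trans xj); apply: (le_trans (ler_norm _)); exact: tnth_le_lp_norm.
  split; first by split.
  by rewrite /X /= tnth_scale ler_pMr ?invr_gt0 ?lp_norm_gt0.
have XE j : (unif \x Phi)%E (X j) = (\int[Phi]_t unif (ysection (X j) t))%E.
  apply: (product_measure_unique (m' := (unif \x^ Phi)%E)) => // B A mB mA.
  exact: product_measure2E.
have mXs j : measurable_fun setT (fun t => unif (ysection (X j) t)).
  exact: (measurable_fun_ysection unif (mX j)).
have -> : (d%:R%:E = \sum_(j < d) (unif \x Phi)%E (X j))%E.
  by under eq_bigr do rewrite X1; rewrite sumEFin sumr_const card_ord.
under eq_bigr do rewrite XE.
rewrite -ge0_integral_sum //.
rewrite -angular_sphere -[leLHS]mul1e -integral_cst; last exact: measurable_sphere.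
apply: (@le_trans _ _ (\int[Phi]_(t in sphere p) \sum_(j < d) unif (ysection (X j) t))%E); last first.
  apply: ge0_subset_integral => //; first exact: measurable_sphere.
    by apply: emeasurable_sum => j; exact: mXs.
  by move=> t _; apply: sume_ge0 => j _; exact: measure_ge0.
apply: ge0_le_integral => //; first exact: measurable_sphere.
  by apply: emeasurable_sum => j; apply: measurable_funTS; exact: mXs.
move=> t tS; have tE j : unif (ysection (X j) t) = (tnth t j)%:E.
  rewrite -uniform01_cdf ?(sphere_le1 j p1 tS) //; congr (unif _).
  by apply/seteqP; split => s; rewrite /ysection /= inE /X /= in_itv /=.
by under eq_bigr do rewrite tE; rewrite sumEFin lee_fin /cst; exact: sphere_sum_ge1 tS.
Qed.

(** The section at inverse radius s has mass at most D and at most K / s. The bounds cross at a = K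
    / D; the trivial one contributes D a = K below a, the other K ln (D / K) above. *)
Lemma radial_bound (G : set (d.-tuple R)) (K D : R) : measurable G ->
  0 < K < D -> (Phi setT <= D%:E)%E ->
  (forall s, 0 < s <= 1 -> (Phi [set t | G (scale s^-1 t)] <= (K / s)%:E)%E) ->
  (mu (shell p `&` G) <= (K * (1 + ln (D / K)))%:E)%E.
Proof.
move=> mG /andP[K0 KD] PhiD PhiK; have D0 : 0 < D by exact: lt_trans KD.
(* The absolute value makes the function being inverted nonnegative everywhere, so that its inverse
   is measurable; it changes nothing for positive radii. *)
pose X : set (measurableTypeR R * d.-tuple R) := [set z | G (scale `|z.1|^-1 z.2)].
have mX : measurable X.
  rewrite -[X in measurable X]setTI.
  apply: (measurable_scale (f := fun z : measurableTypeR R * d.-tuple R => `|z.1|^-1)) => //.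
  apply: measurable_invr_ge0 => //; apply: measurableT_comp => //; exact: measurable_fst.
have -> : mu (shell p `&` G) = (unif \x Phi)%E X.
  rewrite polar_decomposition //; congr (mu _); apply/seteqP; split => x /= [[xp x1] xG];
    split => //; move: xG; have n0 := lp_norm_gt0 p1 xp;
    by rewrite /X /= ger0_norm ?invr_ge0 ?(ltW n0) // invrK scale_theta.
rewrite /product_measure1; set phi := (Phi \o xsection X).
have mphi : measurable_fun setT phi by exact: measurable_fun_xsection.
have phi0 s : (0 <= phi s)%E by exact: measure_ge0.
have phiE (s : R) : 0 < s -> phi s = Phi [set t | G (scale s^-1 t)].
  move=> s0; rewrite /phi /=; congr (Phi _); apply/seteqP; split => t.
    by rewrite /xsection /= inE /X /= gtr0_norm.
  by rewrite /xsection /= inE /X /= gtr0_norm.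
rewrite integral_uniform // subr0 invr1 mul1e.
pose a := K / D.
have a0 : 0 < a by rewrite divr_gt0.
have a1 : a < 1 by rewrite ltr_pdivrMr // mul1r.
have -> : `[0%R, 1%R]%classic = `[0%R, a]%classic `|` `]a, 1%R]%classic :> set (measurableTypeR R).
  by rewrite -itv_bndbnd_setU // bnd_simp ltW.
rewrite ge0_integral_setU //=.
- rewrite mulrDr mulr1 EFinD; apply: leeD.
    apply: (@le_trans _ _ (\int[lebesgue_measure]_(s in `[0%R, a]) (cst D%:E s))%E).
      apply: ge0_le_integral => //; first exact: measurable_funTS.
      move=> s _; rewrite /phi /=; apply: le_trans PhiD; apply: le_measure; rewrite ?inE //.
      exact: measurable_xsection.
    have -> : K%:E = (D%:E * a%:E)%E by rewrite -EFinM /a mulrC divfK // gt_eqF.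
    rewrite integral_cst // le_eqVlt; apply/orP; left; apply/eqP; congr (_ * _)%E.
    apply: etrans (lebesgue_measure_itv `[0, a]) _.
    by rewrite /= lte_fin a0 oppr0 adde0.
  apply: (@le_trans _ _ (\int[lebesgue_measure]_(s in `[a, 1%R]) (K * s^-1)%:E)%E); last first.
    rewrite integral_inv_le ?a0 ?(ltW K0) // lee_fin /a mulNr -mulrN -lnV ?posrE //.
    by rewrite invf_div.
  have mK : measurable_fun `[a, 1%R]%classic (fun s : measurableTypeR R => (K * s^-1)%:E).
    apply: (@eq_measurable_fun _ _ _ _ _ (fun s : measurableTypeR R => (K * `|s|^-1)%:E)).
      move=> s; rewrite inE /= in_itv /= => /andP[as1 _].
      by rewrite gtr0_norm // (lt_le_trans a0).
    apply: measurable_funTS; apply/measurable_EFinP; apply: measurable_funM => //.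
    by apply: measurable_invr_ge0 => //; exact: measurableT_comp.
  apply: (@le_trans _ _ (\int[lebesgue_measure]_(s in `]a, 1%R]) (K * s^-1)%:E)%E).
    apply: ge0_le_integral => //.
    - exact: measurable_funTS.
    - by apply: measurable_funS mK => // s /=; rewrite !in_itv /= => /andP[/ltW -> ->].
    - move=> s /=; rewrite in_itv /= => /andP[as1 s1].
      have s0 : 0 < s by exact: lt_trans as1.
      by rewrite phiE // PhiK // s0.
  apply: ge0_subset_integral => //.
  - move=> s /=; rewrite in_itv /= => /andP[as1 s1].
    by rewrite lee_fin divr_ge0 ?(ltW K0) // (le_trans _ as1) // ltW.
  - by move=> s /=; rewrite !in_itv /= => /andP[/ltW -> ->].
- exact: measurable_funTS.
- apply/disj_setPS => s [/=]; rewrite !in_itv /= => /andP[_ sa] /andP[as1 _].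
  by move: (lt_le_trans as1 sa); rewrite ltxx.
Qed.

End PolarBounds.

(** * Framing sets *)

Section FramingBounds.
Context {R : realType} {d : nat}.
Variables (p : \bar R) (mu : {measure set (d.-tuple R) -> \bar R}).
Variables (calA : set (set (d.-tuple R))) (hull : bool -> set (d.-tuple R) -> R -> set (d.-tuple R)).
Variables (tau c : R).
Hypotheses (p1 : (1 <= p)%E) (muE : exponent_measure mu)
  (asA : assumption_A p mu calA hull tau c).

Local Notation Phi := (angular p1 muE).

Lemma measurable_tail_cone t (A : set (d.-tuple R)) : measurable A ->
  measurable (tail_cone p t A).
Proof.
move=> mA; rewrite (_ : tail_cone p t A = punctured_orthant `&`
    ([set x | t <= lp_norm p x] `&` theta p @^-1` A)) //.
apply: measurableI; first exact: measurable_punctured_orthant.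
apply: measurableI; first exact: measurable_lp_norm_ge.
by rewrite -[X in measurable X]setTI; exact: measurable_theta.
Qed.

Lemma mu_annulus (s t : R) : 0 < s <= t ->
  (mu (tail_cone p s [set: d.-tuple R] `\` tail_cone p t [set: d.-tuple R]) <= ((s^-1 - t^-1) * d%:R)%:E)%E.
Proof.
move=> /andP[s0 st]; have t0 : 0 < t by exact: lt_le_trans st.
have fin : Phi setT \is a fin_num by rewrite fin_num_measure.
have tE (r : R) : 0 < r -> mu (tail_cone p r [set: d.-tuple R]) = ((r^-1)%:E * Phi setT)%E.
  by move=> r0; rewrite (mu_tail_cone p1 muE r0 measurableT) angularE.
have sub : tail_cone p t [set: d.-tuple R] `<=` tail_cone p s [set: d.-tuple R].
  by move=> x [xp [xt _]]; split => //; split => //; exact: le_trans xt.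
have sfin : (mu (tail_cone p s [set: d.-tuple R]) < +oo)%E.
  by rewrite tE // -ge0_fin_numE ?fin_numM // mule_ge0 // lee_fin invr_ge0 ltW.
rewrite measureD ?setIidr //; try exact: measurable_tail_cone.
apply: (@le_trans _ _ ((s^-1)%:E * Phi setT - (t^-1)%:E * Phi setT)%E).
  by rewrite le_eqVlt; apply/orP; left; apply/eqP; congr (_ - _)%E; exact: tE.
rewrite -(fineK fin) -!EFinM -EFinB -mulrBl lee_fin ler_wpM2l //.
  by rewrite subr_ge0 lef_pV2.
by rewrite -lee_fin fineK // angular_total.
Qed.

Lemma tuple_shift0 (a : d.-tuple R) (e : R) :
  [tuple tnth a j + e * tnth [tuple (0 : R) | _ < d] j | j < d] = a.
Proof. by apply: eq_from_tnth => j; rewrite !tnth_mktuple mulr0 addr0. Qed.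

Lemma thicken_id (A : set (d.-tuple R)) (e : R) : A `<=` thicken A e.
Proof.
move=> a Aa; exists a => //; exists [tuple (0 : R) | _ < d].
  by move=> j; rewrite tnth_mktuple lerN10 ler01.
exact: tuple_shift0.
Qed.

Lemma hull_inner_sub (A : set (d.-tuple R)) e : calA A -> 0 < e -> hull false A e `<=` A.
Proof.
move=> cA e0 x xh; apply: (A_hull_inner asA cA e0); split; first exact: thicken_id.
by have [_] := A_hull_borel asA false cA e0; apply.
Qed.

Lemma sub_hull_outer (A : set (d.-tuple R)) e : calA A -> 0 < e -> A `<=` hull true A e.
Proof.
move=> cA e0 x xA; apply: (A_hull_outer asA cA e0); split; first exact: thicken_id.
by have [_ + _] := A_borel asA cA; apply.
Qed.

Lemma measurable_hull s (A : set (d.-tuple R)) e : calA A -> 0 < e -> measurable (hull s A e).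
Proof. by move=> cA e0; case: (A_hull_borel asA s cA e0). Qed.

(* The section at inverse radius s of the discrepancy between a framing set
   and the cone over A lies in A_+(h / s) \ A_-(h / s). *)
Lemma mu_shell_discrepancy (A G : set (d.-tuple R)) (h : R) : calA A -> 0 < h -> c * h < d%:R ->
  measurable G ->
  (forall x, shell p x -> G x -> (hull true A (h * lp_norm p x) `\` hull false A (h * lp_norm p x)) (theta p x)) ->
  (mu (shell p `&` G) <= (c * h * (1 + ln (d%:R / (c * h))))%:E)%E.
Proof.
move=> cA h0 chd mG GA; have c0 := A_c asA.
apply: (radial_bound (p1 := p1) (muE := muE)) => //; [by rewrite mulr_gt0|exact: angular_total|].
move=> s /andP[s0 s1]; have hs : 0 < h / s by rewrite divr_gt0.
rewrite -mulrA; apply: le_trans (A_hull_small asA cA hs); rewrite angularE.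
apply: le_measure; rewrite ?inE.
- apply: (measurable_cone p1); rewrite -[X in measurable X]setTI.
  exact: (measurable_scale (f := fun=> s^-1) (g := id)).
- by apply: (measurable_cone p1); apply: measurableD; exact: measurable_hull.
move=> x [xp [x1 xG]]; split => //; split => //.
have tS := theta_sphere p1 xp; have tid := theta_sphere_id tS.
have si : 0 < s^-1 by rewrite invr_gt0.
have nE : lp_norm p (scale s^-1 (theta p x)) = s^-1.
  by rewrite lp_norm_scale ?(ltW si) //; case: tS => _ /= ->; rewrite mulr1.
have := GA (scale s^-1 (theta p x)); rewrite theta_scale // tid nE; apply => //.
split; last by rewrite /= nE invf_ge1.
by apply: (punctured_orthantP p1); rewrite ?nE //; apply: orthant_scale (proj1 tS); exact: ltW.
Qed.

(** The framing set exceeds the cone over A only in two places: the annulus of inverse radii between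
    1 and 1 + D, of mass at most d D, and the part of the shell whose angle lies in the outer hull
    but not in A. *)
Lemma mu_framing_outer (A : set (d.-tuple R)) (D h : R) : calA A -> 0 <= D -> 0 < h -> c * h < d%:R ->
  measurable (framing p hull true A (1 + D) h) ->
  (mu (framing p hull true A (1 + D) h) <=
   angular_measure p mu A + (d%:R * D + c * h * (1 + ln (d%:R / (c * h))))%:E)%E.
Proof.
move=> cA D0 h0 chd mG; set G := framing _ _ _ _ _ _ in mG *.
have mA : measurable A by have [] := A_borel asA cA.
have D1 : 0 < 1 + D by lra.
have mC := measurable_cone p1 mA.
have mT t : measurable (tail_cone p t [set: d.-tuple R]) by exact: measurable_tail_cone.
have mS := @measurable_shell R d p p1.
pose ann := tail_cone p (1 + D)^-1 [set: d.-tuple R] `\` tail_cone p 1 [set: d.-tuple R].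
apply: (@le_trans _ _ (mu (cone p A `|` (ann `|` (shell p `&` (G `\` cone p A)))))).
  apply: le_measure; rewrite ?inE //.
    apply: measurableU => //; apply: measurableU; first exact: measurableD.
    by apply: measurableI => //; exact: measurableD.
  move=> x [x0 xr xh].
  have xp : punctured_orthant x.
    by apply: (punctured_orthantP p1) => //; apply: lt_le_trans xr; rewrite invr_gt0.
  have [x1|x1] := leP 1 (lp_norm p x); last first.
    by right; left; split => //; move=> [_ [+ _]]; rewrite leNgt x1.
  have [xA|xA] := pselect (A (theta p x)); first by left.
  by right; right; split => //; split => // -[_ [_]].
apply: (le_trans (measureU2 _ _ _)) => //.
  apply: measurableU; first exact: measurableD.
  by apply: measurableI => //; exact: measurableD.
rewrite /angular_measure EFinD; apply: leeD => //.
apply: (le_trans (measureU2 _ _ _)); first exact: measurableD.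
  by apply: measurableI => //; exact: measurableD.
apply: leeD.
  have -> : d%:R * D = ((1 + D)^-1^-1 - 1^-1) * d%:R by rewrite invrK invr1; ring.
  by apply: mu_annulus; rewrite invr_gt0 D1 invf_le1 //; lra.
apply: (mu_shell_discrepancy cA) => //; first exact: measurableD.
move=> x [xp x1] [[x0 xr xh] xnC]; split => // xm; apply: xnC; split => //; split => //.
by apply: (hull_inner_sub cA _ xm); rewrite mulr_gt0 // lp_norm_gt0.
Qed.

(** Mirror image of the outer bound. The inner radius (1 - D)^-1 is chosen so that the annulus again
    has width D in inverse radius. *)
Lemma mu_framing_inner (A : set (d.-tuple R)) (D h : R) : calA A -> 0 <= D < 1 -> 0 < h -> c * h < d%:R ->
  measurable (framing p hull false A (1 - D) h) ->
  (angular_measure p mu A <= mu (framing p hull false A (1 - D) h) +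
     (d%:R * D + c * h * (1 + ln (d%:R / (c * h))))%:E)%E.
Proof.
move=> cA /andP[D0 D1] h0 chd mG; set G := framing _ _ _ _ _ _ in mG *.
have mA : measurable A by have [] := A_borel asA cA.
have D2 : 0 < 1 - D by lra.
have mC := measurable_cone p1 mA.
have mT t (B : set (d.-tuple R)) : measurable B -> measurable (tail_cone p t B).
  exact: measurable_tail_cone.
have mS := @measurable_shell R d p p1.
pose ann := tail_cone p 1 [set: d.-tuple R] `\` tail_cone p (1 - D)^-1 [set: d.-tuple R].
pose H := tail_cone p (1 - D)^-1 A `\` G.
have mH : measurable H by apply: measurableD => //; exact: mT.
have mann : measurable ann by apply: measurableD; exact: mT.
apply: (@le_trans _ _ (mu (G `|` (ann `|` (shell p `&` H))))).
  apply: le_measure; rewrite ?inE //.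
    by apply: measurableU => //; apply: measurableU => //; exact: measurableI.
  move=> x [xp [x1 xA]].
  have [xr|xr] := leP (1 - D)^-1 (lp_norm p x); last first.
    by right; left; split => // -[_ [+ _]]; rewrite leNgt xr.
  have [xG|xG] := pselect (G x); first by left.
  by right; right.
apply: (le_trans (measureU2 _ _ _)) => //.
  by apply: measurableU => //; exact: measurableI.
rewrite EFinD; apply: leeD => //.
apply: (le_trans (measureU2 _ _ _)) => //; first exact: measurableI.
apply: leeD.
  have -> : d%:R * D = (1^-1 - (1 - D)^-1^-1) * d%:R by rewrite invrK invr1; ring.
  by apply: mu_annulus; rewrite ltr01 invf_ge1 //; lra.
apply: (mu_shell_discrepancy cA) => //.
move=> x [xp x1] [[_ [xr xA]] xnG].
have e0 : 0 < h * lp_norm p x by rewrite mulr_gt0 // lp_norm_gt0.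
split; first exact: (sub_hull_outer cA e0).
by move=> xm; apply: xnG; split => //; case: xp.
Qed.

End FramingBounds.

(** * Comparison of angles and radii of nearby points *)

Section AngleComparison.
Context {R : realType} {d : nat}.
Variable (p : \bar R).
Hypothesis p1 : (1 <= p)%E.
Implicit Types (v w : d.-tuple R).

(** The hypothesis says that reciprocals of coordinates differ by at most eta, and it passes to the
    norms. The difference of angles splits into ((w_j - v_j) N + w_j (M - N)) / (N M), where either
    term contributes at most eta N. *)
Lemma theta_close v w (eta : R) : punctured_orthant w -> punctured_orthant v -> 0 <= eta ->
  (forall j, `|tnth w j - tnth v j| <= eta * (tnth w j * tnth v j)) ->
  forall j, `|tnth (theta p w) j - tnth (theta p v) j| <= 2 * eta * lp_norm p w.
Proof.
move=> wp vp eta0 wv j.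
have N0 := lp_norm_gt0 p1 wp; have M0 := lp_norm_gt0 p1 vp.
have w0 i : 0 <= tnth w i by case: wp.
have v0 i : 0 <= tnth v i by case: vp.
have wN i : tnth w i <= lp_norm p w by rewrite -[leLHS]ger0_norm // tnth_le_lp_norm.
have vM i : tnth v i <= lp_norm p v by rewrite -[leLHS]ger0_norm // tnth_le_lp_norm.
set N := lp_norm p w in N0 wN *; set M := lp_norm p v in M0 vM.
have NM : N <= (1 + eta * N) * M.
  rewrite -lp_norm_scale ?addr_ge0 ?mulr_ge0 ?(ltW N0) //; apply: le_lp_norm => // i.
  rewrite tnth_scale !ger0_norm ?mulr_ge0 ?addr_ge0 ?mulr_ge0 ?(ltW N0) //.
  have := wv i; rewrite ler_norml => /andP[_ h].
  have : eta * (tnth w i * tnth v i) <= eta * (N * tnth v i) by rewrite ler_wpM2l // ler_wpM2r.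
  lra.
have MN : M <= (1 + eta * M) * N.
  rewrite -lp_norm_scale ?addr_ge0 ?mulr_ge0 ?(ltW M0) //; apply: le_lp_norm => // i.
  rewrite tnth_scale !ger0_norm ?mulr_ge0 ?addr_ge0 ?mulr_ge0 ?(ltW M0) //.
  have := wv i; rewrite ler_norml => /andP[h _].
  have : eta * (tnth w i * tnth v i) <= eta * (tnth w i * M) by rewrite ler_wpM2l // ler_wpM2l.
  lra.
have abs : `|M - N| <= eta * (N * M) by rewrite ler_norml; apply/andP; split; lra.
rewrite !tnth_scale -/N -/M.
have -> : N^-1 * tnth w j - M^-1 * tnth v j = ((tnth w j - tnth v j) * N + tnth w j * (M - N)) / (N * M).
  by field; rewrite ?gt_eqF //= gt_eqF.
rewrite normrM normfV [X in _ / X]ger0_norm ?mulr_ge0 ?(ltW N0) ?(ltW M0) //.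
rewrite ler_pdivrMr ?mulr_gt0 //; apply: (le_trans (ler_normD _ _)).
rewrite !normrM (ger0_norm (ltW N0)) (ger0_norm (w0 j)).
have h1 : `|tnth w j - tnth v j| * N <= eta * (N * M) * N.
  rewrite ler_wpM2r ?(ltW N0) //; apply: (le_trans (wv j)).
  by rewrite ler_wpM2l // ler_pM.
have h2 : tnth w j * `|M - N| <= N * (eta * (N * M)) by rewrite ler_pM.
by apply: (le_trans (lerD h1 h2)); rewrite le_eqVlt; apply/orP; left; apply/eqP; ring.
Qed.

(** The factor 1 + eta v_j is not bounded when v is large. Scaling v down to norm exactly t
    preserves the coordinatewise inequality and bounds every factor by 1 + eta t. *)
Lemma lp_norm_shrink v w (eta t : R) : 0 < t -> 0 <= eta -> t <= lp_norm p v ->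
  (forall j, 0 <= tnth v j) -> (forall j, 0 <= tnth w j) ->
  (forall j, tnth v j <= tnth w j * (1 + eta * tnth v j)) ->
  t / (1 + eta * t) <= lp_norm p w.
Proof.
move=> t0 eta0 tv v0 w0 vw; have M0 : 0 < lp_norm p v by exact: lt_le_trans tv.
have et : 0 < 1 + eta * t by rewrite ltr_pwDl // mulr_ge0 // ltW.
pose s := t / lp_norm p v; have s0 : 0 < s by rewrite divr_gt0.
have s1 : s <= 1 by rewrite ler_pdivrMr // mul1r.
have tE : t = lp_norm p (scale s v) by rewrite lp_norm_scale ?(ltW s0) // divfK // gt_eqF.
have ie : 0 <= (1 + eta * t)^-1 by rewrite invr_ge0 ltW.
rewrite mulrC [X in _ * X]tE -lp_norm_scale //.
apply: le_lp_norm => // j.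
have sv0 : 0 <= tnth (scale s v) j by rewrite tnth_scale mulr_ge0 // ltW.
rewrite tnth_scale !ger0_norm ?mulr_ge0 // mulrC ler_pdivrMr //.
have svt : tnth (scale s v) j <= t by rewrite tE -[leLHS]ger0_norm // tnth_le_lp_norm.
apply: (@le_trans _ _ (tnth w j * (1 + eta * tnth (scale s v) j))); last first.
  by rewrite ler_wpM2l // lerD2l ler_wpM2l.
rewrite tnth_scale.
have : s * tnth v j <= s * (tnth w j * (1 + eta * tnth v j)) by rewrite ler_wpM2l // ltW.
have : s * tnth w j <= tnth w j by rewrite ler_piMl.
lra.
Qed.

Variables (mu : {measure set (d.-tuple R) -> \bar R}) (calA : set (set (d.-tuple R))).
Variables (hull : bool -> set (d.-tuple R) -> R -> set (d.-tuple R)) (tau c : R).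
Hypothesis asA : assumption_A p mu calA hull tau c.
Variables (rho eta D h : R).
Hypotheses (eta0 : 0 < eta) (h2 : 2 * eta <= h) (etaD : eta <= D) (rhotau : rho < tau).
Variables (w v : d.-tuple R).
Hypotheses (w0 : forall j, 0 < tnth w j) (v0 : forall j, 0 < tnth v j)
  (dge1 : (0 < d)%N)
  (wv : forall j, rho <= tnth w j -> `|tnth w j - tnth v j| <= eta * (tnth w j * tnth v j))
  (wv_small : forall j, tnth w j < rho -> tnth v j <= tau).

Let pos_punctured (x : d.-tuple R) : (forall j, 0 < tnth x j) -> punctured_orthant x.
Proof.
move=> x0; split; first by move=> j; apply: ltW.
move=> xE; have := x0 (Ordinal dge1); rewrite xE tnth_mktuple ltxx //.
Qed.

Let thicken_close (B : set (d.-tuple R)) (a b : d.-tuple R) e : 0 < e -> B a ->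
  (forall j, `|tnth b j - tnth a j| <= e) -> thicken B e b.
Proof.
move=> e0 Ba ab; exists a => //; exists [tuple (tnth b j - tnth a j) / e | j < d].
  move=> j; rewrite tnth_mktuple -ler_norml normrM normfV (gtr0_norm e0).
  by rewrite ler_pdivrMr // mul1r.
apply: eq_from_tnth => j; rewrite !tnth_mktuple mulrC divfK ?gt_eqF //.
by rewrite addrC subrK.
Qed.

Lemma framing_outer_incl A : calA A -> 1 <= lp_norm p v -> A (theta p v) ->
  framing p hull true A (1 + D) h w.
Proof.
move=> cA v1 Av; move: eta0 etaD => eta0' etaD'.
have wp := pos_punctured w0; have vp := pos_punctured v0.
(* Every coordinate of v exceeds tau ||v|| >= tau because its angle is in A, whereas a coordinate of
   w below rho would force that of v to be at most tau. The comparison thus holds in all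
   coordinates. *)
have wbig j : rho <= tnth w j.
  rewrite leNgt; apply/negP => /wv_small; apply/negP; rewrite -ltNge.
  have [_ /(_ j)] := A_away asA cA Av; rewrite tnth_scale mulrC.
  rewrite ltr_pdivlMr ?lp_norm_gt0 //; apply: le_lt_trans.
  by rewrite ler_peMr //; have /andP[/ltW] := A_tau asA.
have close j := wv (wbig j).
have N0 := lp_norm_gt0 p1 wp.
have norm : 1 / (1 + eta * 1) <= lp_norm p w.
  apply: (@lp_norm_shrink v) => //; rewrite ?(ltW eta0) // => j; [exact: ltW|exact: ltW|].
  have := close j; rewrite ler_norml => /andP[+ _]; lra.
have eps0 : 0 < h * lp_norm p w by rewrite mulr_gt0 // (lt_le_trans _ h2) // mulr_gt0.
split.
- by case: wp.
- apply: le_trans norm; rewrite mulr1 div1r.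
  have e1 : 0 < 1 + eta by lra.
  have D1 : 0 < 1 + D by lra.
  by rewrite lef_pV2 ?posrE // lerD2l.
apply: (A_hull_outer asA cA eps0); split; last exact: theta_sphere.
apply: thicken_close Av _ => // j; apply: le_trans (theta_close wp vp (ltW eta0) close j) _.
by rewrite ler_wpM2r // ltW.
Qed.

Lemma framing_inner_incl A : calA A -> D < 1 -> framing p hull false A (1 - D) h w ->
  1 <= lp_norm p v /\ A (theta p v).
Proof.
move=> cA D1 [_ wr wh]; move: eta0 etaD => eta0' etaD'.
have wp := pos_punctured w0; have vp := pos_punctured v0.
have N0 := lp_norm_gt0 p1 wp.
have h0 : 0 < h by rewrite (lt_le_trans _ h2) // mulr_gt0.
have eps0 : 0 < h * lp_norm p w by rewrite mulr_gt0.
have D0 : 0 < 1 - D by lra.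
have w1 : 1 <= lp_norm p w.
  by apply: le_trans wr; rewrite invf_ge1 //; lra.
have Aw := hull_inner_sub asA cA eps0 wh.
(* Here the angle of w itself lies in A, since the inner hull does, so its coordinates exceed tau >
   rho directly. *)
have wbig j : rho <= tnth w j.
  have [_ /(_ j)] := A_away asA cA Aw; rewrite tnth_scale mulrC.
  rewrite ltr_pdivlMr // => twj; apply: ltW; apply: lt_trans twj.
  apply: (lt_le_trans rhotau); rewrite ler_peMr //; have /andP[/ltW] := A_tau asA; done.
have close j := wv (wbig j).
split.
  have : (1 - D)^-1 / (1 + eta * (1 - D)^-1) <= lp_norm p v.
    apply: (@lp_norm_shrink w) => //; rewrite ?invr_gt0 ?(ltW eta0) // => j; [exact: ltW|exact: ltW|].
    have := close j; rewrite ler_norml => /andP[_]; lra.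
  apply: le_trans.
  have -> : (1 - D)^-1 / (1 + eta * (1 - D)^-1) = (1 - D + eta)^-1.
    by field; rewrite !gt_eqF //; lra.
  by rewrite invf_ge1; lra.
apply: (A_hull_inner asA cA eps0); split; last exact: theta_sphere.
apply: thicken_close wh _ => // j; rewrite distrC.
apply: le_trans (theta_close wp vp (ltW eta0) close j) _.
by rewrite ler_wpM2r // ltW.
Qed.

End AngleComparison.

(** * Standardized sample and marginal deviations *)

Section SampleComparison.
Context {R : realType} {d n : nat}.
Variables (P : probability (d.-tuple R) R) (x : 'I_n -> d.-tuple R) (k : nat).

Definition tail_prob (j : 'I_d) (t : R) : R := 1 - fine (margin_cdf P j t).

(** Real-valued version of [standardize]. Where a tail probability vanishes this inverse is 0
    instead of +oo; such points form a null set, treated separately. *)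
Definition std_val (y : d.-tuple R) : d.-tuple R :=
  [tuple (tail_prob j (tnth y j))^-1 | j < d].

Definition exceed (j : 'I_d) (t : R) : R :=
  \sum_(l < n) \1_[set y : d.-tuple R | t < tnth y j] (x l).

Lemma emp_stdE i j : (0 < n)%N ->
  tnth (emp_std x i) j = n.+1%:R / (1 + exceed j (tnth (x i) j)).
Proof.
move=> n0; have nR : 0 < n%:R :> R by rewrite ltr0n.
rewrite tnth_mktuple -[RHS]invf_div; congr (_^-1).
set t := tnth (x i) j; rewrite /emp_cdf.
have -> : \sum_(l < n) \1_[set w : d.-tuple R | tnth w j <= t] (x l) = n%:R - exceed j t.
  rewrite -[n in n%:R]card_ord -sumr_const /exceed -sumrB; apply: eq_bigr => l _.
  rewrite !indicE.
  have -> : (x l \in [set w : d.-tuple R | tnth w j <= t]) = (tnth (x l) j <= t).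
    by apply/idP/idP; rewrite inE.
  have -> : (x l \in [set w : d.-tuple R | t < tnth w j]) = (t < tnth (x l) j).
    by apply/idP/idP; rewrite inE.
  by case: leP => _; rewrite ?subr0 ?subrr.
rewrite -natr1; field; rewrite gt_eqF //= gt_eqF // ltr_pwDr //.
Qed.

Lemma exceed_ge0 j t : 0 <= exceed j t.
Proof. by apply: sumr_ge0 => l _. Qed.

Lemma exceed_anti j s t : s <= t -> exceed j t <= exceed j s.
Proof.
move=> st; apply: ler_sum => l _; rewrite !indicE ler_nat.
have [h|//] := boolP (x l \in [set w : d.-tuple R | t < tnth w j]).
suff -> : x l \in [set w : d.-tuple R | s < tnth w j] by [].
by move: h; rewrite !inE /=; exact: le_lt_trans.
Qed.

Lemma margin_cdf_fin j t : margin_cdf P j t \is a fin_num.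
Proof. by rewrite /margin_cdf /cdf fin_num_measure. Qed.

Lemma tail_prob01 j t : 0 <= tail_prob j t <= 1.
Proof.
have h : fine (margin_cdf P j t) <= 1.
  by rewrite -lee_fin fineK ?margin_cdf_fin // cdf_le1.
rewrite /tail_prob subr_ge0 h /= lerBlDr lerDl fine_ge0 //; exact: cdf_ge0.
Qed.

Variables (rho Delta1 tau : R) (i : 'I_n) (j : 'I_d).
Hypotheses (n0 : (0 < n)%N) (k0 : (0 < k)%N) (krho : k%:R / n%:R < rho)
  (D0 : 0 <= Delta1) (D1rho : Delta1 * rho < 1) (rhotau : rho / (1 - Delta1 * rho) <= tau)
  (Hdev : forall t, tail_prob j t <= k%:R / n%:R / rho ->
     `|exceed j t - n%:R * tail_prob j t| <= k%:R * Delta1)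
  (Hivt : forall t, k%:R / n%:R / rho < tail_prob j t ->
     exists2 t0, t <= t0 & tail_prob j t0 = k%:R / n%:R / rho)
  (Hpos : 0 < tail_prob j (tnth (x i) j)).

Let w := tnth (scale (k%:R / n%:R) (std_val (x i))) j.
Let v := tnth (scale (k%:R / n%:R) (emp_std x i)) j.
Let a := tail_prob j (tnth (x i) j).
Let e := exceed j (tnth (x i) j).

Let nR : 0 < n%:R :> R. Proof. by rewrite ltr0n. Qed.
Let kR : 0 < k%:R :> R. Proof. by rewrite ltr0n. Qed.
Let e0 : 0 <= e. Proof. exact: exceed_ge0. Qed.
Let rho0 : 0 < rho. Proof. by apply: lt_trans krho; rewrite divr_gt0. Qed.

Let wE : w = k%:R / n%:R / a.
Proof. by rewrite /w tnth_scale tnth_mktuple. Qed.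

Let vE : v = k%:R / n%:R * (n.+1%:R / (1 + e)).
Proof. by rewrite /v tnth_scale emp_stdE. Qed.

Lemma std_val_gt0 : 0 < w.
Proof. by rewrite wE !divr_gt0. Qed.

Lemma emp_std_gt0 : 0 < v.
Proof. by rewrite vE mulr_gt0 ?divr_gt0 // ltr_pwDl. Qed.

(** The difference 1/v - 1/w equals n / (k (n + 1)) times (1 - a) + (e - n a). The first part comes
    from the rank correction and costs 1/k; the second is the marginal deviation and costs
    Delta1. *)
Lemma std_emp_close : rho <= w -> `|w - v| <= (Delta1 + k%:R^-1) * (w * v).
Proof.
move=> rw; have a0 : 0 < a by [].
have ap : a <= k%:R / n%:R / rho.
  by move: rw; rewrite wE ler_pdivlMr // mulrC -ler_pdivlMr.
have e1 : 0 < 1 + e by rewrite ltr_pwDl.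
have n1 : 0 < n.+1%:R :> R by [].
have wv : 0 < w * v by rewrite mulr_gt0 ?std_val_gt0 ?emp_std_gt0.
have -> : w - v = ((1 - a) + (e - n%:R * a)) * (n%:R / (k%:R * n.+1%:R)) * (w * v).
  by rewrite wE vE -natr1; field; rewrite !gt_eqF ?natr1.
rewrite normrM [X in _ * X]ger0_norm ?(ltW wv) // ler_wpM2r ?(ltW wv) //.
have f0 : 0 <= n%:R / (k%:R * n.+1%:R) :> R by rewrite divr_ge0 // mulr_ge0.
rewrite normrM [X in _ * X]ger0_norm //.
have num : `|(1 - a) + (e - n%:R * a)| <= 1 + k%:R * Delta1.
  apply: (le_trans (ler_normD _ _)); apply: lerD; last exact: Hdev.
  have /andP[_ a1] : 0 <= a <= 1 by exact: tail_prob01.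
  by rewrite ger0_norm; lra.
have fk : n%:R / (k%:R * n.+1%:R) <= k%:R^-1 :> R.
  by rewrite invfM mulrCA ler_piMr ?invr_ge0 ?(ltW kR) // ler_pdivrMr // mul1r ler_nat.
apply: (@le_trans _ _ ((1 + k%:R * Delta1) * k%:R^-1)).
  by apply: ler_pM => //.
by rewrite le_eqVlt; apply/orP; left; apply/eqP; field; rewrite gt_eqF.
Qed.

(** No deviation bound holds at this point, but continuity gives a threshold t0 above it with tail
    exactly k / (n rho). At least k / rho - k Delta1 sample points exceed t0, hence also this point,
    so its rank-based value is at most rho / (1 - Delta1 rho). *)
Lemma emp_std_small : w < rho -> v <= tau.
Proof.
move=> wr; have a0 : 0 < a by [].
have ap : k%:R / n%:R / rho < a.
  by rewrite ltr_pdivrMr // [a * _]mulrC -ltr_pdivrMr // -wE.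
have [t0 tt0 t0E] := Hivt ap.
have e1 : 0 < 1 + e by rewrite ltr_pwDl.
have n1 : 0 < n.+1%:R :> R by [].
have ee : exceed j t0 <= e by exact: exceed_anti.
have : `|exceed j t0 - n%:R * tail_prob j t0| <= k%:R * Delta1 by apply: Hdev; rewrite t0E.
rewrite t0E ler_norml => /andP[lo _].
have nk : n%:R * (k%:R / n%:R / rho) = k%:R / rho by field; rewrite !gt_eqF.
rewrite nk in lo.
have y0 : 0 < 1 - Delta1 * rho by rewrite subr_gt0.
apply: le_trans rhotau; rewrite ler_pdivlMr // vE mulrA mulrAC ler_pdivrMr //.
have krn : k%:R < rho * n%:R by rewrite -ltr_pdivrMr.
have h1 : k%:R * (1 - Delta1 * rho) <= rho * e.
  have -> : k%:R * (1 - Delta1 * rho) = rho * (k%:R / rho - k%:R * Delta1).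
    by field; rewrite gt_eqF.
  by rewrite ler_wpM2l ?(ltW rho0) //; move: lo ee; lra.
have h2 : k%:R * (1 - Delta1 * rho) <= rho * n%:R.
  apply: (@le_trans _ _ (k%:R * 1)); last by rewrite mulr1 ltW.
  by rewrite ler_wpM2l ?(ltW kR) // gerBl mulr_ge0 // ltW.
(* The surplus of n + 1 over n is paid by the 1 in 1 + e, because k / n < rho. *)
have -> : k%:R / n%:R * n.+1%:R * (1 - Delta1 * rho) =
   k%:R * (1 - Delta1 * rho) + k%:R * (1 - Delta1 * rho) / n%:R.
  by rewrite -natr1; field; rewrite gt_eqF.
have h3 : k%:R * (1 - Delta1 * rho) / n%:R <= rho by rewrite ler_pdivrMr.
by move: h1 h3; rewrite mulrDr mulr1; lra.
Qed.

End SampleComparison.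

Lemma vc_le_chain (T : Type) (F : set (set T)) :
  (forall C D, F C -> F D -> C `<=` D \/ D `<=` C) -> vc_le F 1.
Proof.
move=> chain v S Sv sh; rewrite leqNgt; apply/negP => v2.
have [x [y [Sx Sy xy]]] : exists x y, [/\ S x, S y & x <> y].
  apply: contrapT => h.
  suff : (`I_v #<= `I_1)%card by rewrite card_le_II leqNgt v2.
  rewrite -(card_le_eql Sv).
  have [->|/set0P[x0 Sx0]] := eqVneq S set0; first exact: card_ge0.
  rewrite -(card_le_eqr (card_set1 (x := x0))); apply: subset_card_le => y Sy.
  by apply: contrapT => yx; apply: h; exists y, x0.
have [C FC SC] := sh [set x] (fun z zx => eq_ind_r S Sx zx).
have [D FD SD] := sh [set y] (fun z zy => eq_ind_r S Sy zy).
have [_ Cx] : (S `&` C) x by rewrite SC.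
have [_ Dy] : (S `&` D) y by rewrite SD.
case: (chain C D FC FD) => sub.
  have : (S `&` D) x by split => //; exact: sub.
  by rewrite SD.
have : (S `&` C) y by split => //; exact: sub.
by rewrite SC => /= /esym.
Qed.

Section Margins.
Context {R : realType} {d : nat}.
Variable P : probability (d.-tuple R) R.
Variable j : 'I_d.

Local Notation tailp := (tail_prob P j).

Definition halfspace (t : R) : set (d.-tuple R) := [set y | t < tnth y j].

Lemma measurable_halfspace t : measurable (halfspace t).
Proof.
rewrite -[X in measurable X]setTI.
rewrite (_ : halfspace t = (fun y : d.-tuple R => tnth y j) @^-1` `]t, +oo[); last first.
  by apply/seteqP; split => y /=; rewrite in_itv /= andbT.
exact: measurable_tnth.
Qed.

Lemma prob_halfspace t : P (halfspace t) = (tailp t)%:E.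
Proof.
have -> : halfspace t = ~` (Defs.coord j @^-1` `]-oo, t]%classic).
  apply/seteqP; split => y /=; rewrite in_itv /= /Defs.coord.
    by move=> h /le_lt_trans/(_ h); rewrite ltxx.
  by move=> /negP; rewrite -ltNge.
rewrite probability_setC ?EFinB ?fineK ?margin_cdf_fin //.
rewrite -[X in measurable X]setTI; exact: measurable_tnth.
Qed.

Lemma tail_prob_anti s t : s <= t -> tailp t <= tailp s.
Proof.
move=> st; rewrite -lee_fin -!prob_halfspace; apply: le_measure; rewrite ?inE.
- exact: measurable_halfspace.
- exact: measurable_halfspace.
by move=> y /=; exact: le_lt_trans.
Qed.

Lemma measurable_tail_prob : measurable_fun setT tailp.
Proof.
apply: measurable_funB => //; apply: (measurableT_comp (f := fine)); first exact: fine_measurable.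
exact: cdf_measurable.
Qed.

Lemma measurable_tail_prob_le u : measurable [set y : d.-tuple R | tailp (tnth y j) <= u].
Proof.
rewrite -[X in measurable X]setTI.
rewrite (_ : [set y | _] = (fun y : d.-tuple R => tailp (tnth y j)) @^-1` `]-oo, u]); last first.
  by apply/seteqP; split => y /=; rewrite in_itv.
exact: (measurableT_comp measurable_tail_prob (measurable_tnth j)).
Qed.

Hypothesis cdf_cont : continuous (margin_cdf P j).

Lemma tail_prob_continuous : continuous (tailp : R -> R).
Proof.
move=> t; apply: cvgB; first exact: cvg_cst.
apply: fine_cvg; rewrite fineK ?margin_cdf_fin //; exact: cdf_cont.
Qed.

Lemma tail_prob_small (u : R) : 0 < u -> exists t, tailp t < u.
Proof.
move=> u0.
have h : fine (margin_cdf P j t) @[t --> +oo] --> (1 : R) by apply: fine_cvg; exact: cvg_cdfy1.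
have : \forall t \near +oo, 1 - u < fine (margin_cdf P j t).
  by apply: (cvgr_gt 1) => //; lra.
by move=> /filter_ex[t ht]; exists t; rewrite /tail_prob; lra.
Qed.

Lemma tail_prob_large (u : R) : u < 1 -> exists t, u < tailp t.
Proof.
move=> u0.
have h : fine (margin_cdf P j t) @[t --> -oo] --> (0 : R) by apply: fine_cvg; exact: cvg_cdfNy0.
have : \forall t \near -oo, fine (margin_cdf P j t) < 1 - u.
  by apply: (cvgr_lt 0) => //; lra.
by move=> /filter_ex[t ht]; exists t; rewrite /tail_prob; lra.
Qed.

Lemma tail_prob_ivt (u t : R) : 0 < u -> u < tailp t -> exists2 t0, t <= t0 & tailp t0 = u.
Proof.
move=> u0 ut; have [s su] := tail_prob_small u0.
have ts : t <= s.
  by rewrite leNgt; apply/negP => /ltW /tail_prob_anti h; move: (lt_trans su ut); rewrite ltNge h.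
have [] := @IVT R tailp t s u ts.
- by apply: continuous_subspaceT => x; exact: tail_prob_continuous.
- by rewrite ge_min le_max (ltW su) (ltW ut) orbT.
by move=> c; rewrite in_itv /= => /andP[tc _] cE; exists c.
Qed.

(** The set lies strictly beyond a point where the tail equals u + e, which exists by continuity
    when u + e < 1; then e tends to 0. The detour covers u = 0, where no such point need exist. *)
Lemma prob_tail_le (u : R) : 0 <= u -> (P [set y | (tailp (tnth y j) <= u)%R] <= u%:E)%E.
Proof.
move=> u0; apply/lee_addgt0Pr => e e0; rewrite -EFinD.
have [u1|u1] := leP 1 (u + e); 
  first by apply: le_trans (probability_le1 P (measurable_tail_prob_le u)) _; rewrite lee_fin.
have [t tu] := tail_prob_large u1.
have [|t0 _ t0E] := tail_prob_ivt _ tu; first by rewrite ltr_wpDl.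
rewrite -t0E -prob_halfspace; apply: le_measure; rewrite ?inE.
- exact: measurable_tail_prob_le.
- exact: measurable_halfspace.
move=> y /= yu; rewrite /halfspace /= ltNge; apply/negP => /tail_prob_anti.
by rewrite t0E => /le_trans/(_ yu); rewrite gerDl leNgt e0.
Qed.

End Margins.

(** * Uniform deviations of the empirical margins *)

Section MarginalDeviation.
Context {R : realType} {d n : nat} {dO : measure_display} {Omega : measurableType dO}.
Variables (Pr : probability Omega R) (P : probability (d.-tuple R) R).
Variable X : 'I_n -> {RV Pr >-> d.-tuple R}.
Hypothesis Xind : mutually_independent X.
Hypothesis Xlaw : forall i B, measurable B -> distribution Pr (X i) B = P B.
Variable j : 'I_d.
Hypothesis cdf_cont : continuous (margin_cdf P j).

Local Notation tailp := (tail_prob P j).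

(** The half-lines with rational threshold and tail at most u, enumerated through a coding of the
    rationals; all other codes give the empty set. *)
Let ray (u : R) (m : nat) : set (d.-tuple R) :=
  if unpickle m is Some q then
    if tailp (ratr (q : rat)) <= u then halfspace j (ratr q) else set0
  else set0.

Let rayP u m : ray u m = set0 \/ exists2 t, tailp t <= u & ray u m = halfspace j t.
Proof.
rewrite /ray; case: unpickle => [q|]; last by left.
by case: ifP => h; [right; exists (ratr q)|left].
Qed.

Let measurable_ray u m : measurable (ray u m).
Proof. by case: (rayP u m) => [->|[t _ ->]]; [|exact: measurable_halfspace]. Qed.

(** Half-lines of one coordinate are nested, so a finite union is the largest of them and its
    probability stays below u however many are taken. *)
Let ray_union u m : \bigcup_(i < m) ray u i = set0 \/
  exists2 t, tailp t <= u & \bigcup_(i < m) ray u i = halfspace j t.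
Proof.
elim: m => [|m IH].
  by left; apply/seteqP; split => x [].
have -> : \bigcup_(i < m.+1) ray u i = \bigcup_(i < m) ray u i `|` ray u m.
  apply/seteqP; split => x /=.
    move=> [i /= im xi]; have [iE|im'] := eqVneq i m; first by right; rewrite -iE.
    by left; exists i => //=; rewrite ltn_neqAle im' -ltnS.
  by move=> [[i /= im xi]|xm]; [exists i => //=; exact: ltnW|exists m => /=].
case: IH => [->|[s su ->]]; case: (rayP u m) => [->|[t tu ->]]; rewrite ?set0U ?setU0.
- by left.
- by right; exists t.
- by right; exists s.
right; have [st|ts] := leP s t; [exists s|exists t] => //.
  by apply/setUidPl => x /=; exact: le_lt_trans.
by apply/setUidPr => x /=; apply: le_lt_trans; exact: ltW.
Qed.

(** Rational thresholds suffice. Just right of t the count is constant and the tail continuous, so a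
    violation at t persists on some ]t, t + e[, and by monotonicity a rational there still has tail
    at most u. *)
Lemma marginal_deviation (u s L : R) : (0 < n)%N -> 0 <= u -> n%:R * u <= s -> 0 < s -> 0 <= L <= s ->
  exists2 E : set Omega, measurable E /\ (Pr E <= (expR (- L))%:E)%E &
    forall omega, ~ E omega -> forall t, tailp t <= u ->
      `|exceed (fun i => X i omega) j t - n%:R * tailp t| <= vc_threshold 1 s L.
Proof.
move=> n0 u0 nus s0 Ls.
exists [set omega | exists m, vc_threshold 1 s L < emp_gap P X (ray u m) omega].
  split.
    rewrite (_ : [set omega | _] = \bigcup_m [set omega | vc_threshold 1 s L < emp_gap P X (ray u m) omega]).
      by apply: bigcup_measurable => m _; exact: measurable_emp_gap_gt.
    by apply/seteqP; split => omega /= [m]; [exists m|move=> _; exists m].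
  apply: emp_gap_tail => //.
    apply: vc_le_chain => _ _ [l _ <-] [m _ <-].
    case: (rayP u l) => [->|[t _ ->]]; first by left.
    case: (rayP u m) => [->|[t' _ ->]]; first by right.
    have [tt'|tt'] := leP t t'; [right|left] => x /=; apply: le_lt_trans => //.
    exact: ltW.
  move=> m; apply: le_trans nus; rewrite ler_wpM2l //.
  case: (ray_union u m) => [->|[t tu ->]]; first by rewrite measure0.
  by rewrite prob_halfspace.
move=> omega nE t tu; rewrite leNgt; apply/negP => bad.
set x := fun i => X i omega in bad.
pose g (r : R) := exceed x j r - n%:R * tailp r.
have gapE r : emp_gap P X (halfspace j r) omega = `|g r|.
  by rewrite /emp_gap prob_halfspace.
have exc : \forall r \near t^'+, exceed x j r = exceed x j t.
  have : \forall r \near t^'+, forall i : 'I_n, (r < tnth (x i) j) = (t < tnth (x i) j).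
    apply: filter_forall => i; have [h|h] := ltP t (tnth (x i) j).
      by near=> r; near: r; exact: nbhs_right_lt.
    by near=> r; apply/negbTE; rewrite -leNgt (le_trans h).
  apply: filterS => r h; apply: eq_bigr => i _; rewrite !indicE.
  suff -> : (x i \in [set y : d.-tuple R | r < tnth y j]) = (x i \in [set y : d.-tuple R | t < tnth y j]) by [].
  by apply/idP/idP; rewrite !inE /= h.
have cvg : `|exceed x j t - n%:R * tailp r| @[r --> t^'+] --> `|g t|.
  apply: cvg_norm; apply: cvgB; first exact: cvg_cst.
  apply: cvgM; first exact: cvg_cst.
  by apply: cvg_at_right_filter; exact: tail_prob_continuous.
have near_bad : \forall r \near t^'+, vc_threshold 1 s L < `|g r|.
  near=> r; rewrite /g (_ : exceed x j r = exceed x j t); last by near: r.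
  by near: r; exact: (cvgr_gt _ cvg).
have [e /= e0 he] : exists2 e : R, 0 < e & forall r, t < r < t + e -> vc_threshold 1 s L < `|g r|.
  apply: contrapT => hn; move: near_bad; apply/not_near_at_rightP => e.
  apply: contrapT => he; apply: hn; exists e%:num => // r tr.
  by apply: contrapT => /negP hr; apply: he; exists r => //; exact/negP.
have te : t < t + e by rewrite ltrDl.
have [q tq] := rat_in_itvoo te.
rewrite in_itv /= in tq.
apply: nE; exists (pickle q); rewrite /ray pickleK.
have tq' : t <= ratr q by case/andP: tq => /ltW.
by rewrite (le_trans (tail_prob_anti P j tq')) // gapE; exact: he.
Unshelve. all: by end_near. Qed.

End MarginalDeviation.

(** * Deviations over the framing sets *)

Lemma vc_le_preimage (S T : Type) (f : S -> T) (I : Type) (D : I -> set T) (V : nat) :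
  vc_le (range D) V -> vc_le (range (fun i => f @^-1` D i)) V.
Proof.
move=> DV v B Bv sh.
have finj : {in B &, injective f}.
  move=> x y; rewrite !inE => xB yB fxy.
  have [_ [i _ <-] e] := sh [set x] (fun z zx => eq_ind_r B xB zx).
  have [_ fx] : (B `&` f @^-1` D i) x by rewrite e.
  have : (B `&` f @^-1` D i) y by split => //=; rewrite -fxy.
  by rewrite e.
apply: (DV v (f @` B)); first by apply: card_eq_trans Bv; exact: inj_card_eq.
move=> C CB; have [] := sh (B `&` f @^-1` C); first by move=> x [].
move=> _ [i _ <-] e; exists (D i) => //; apply/seteqP; split => [_ [[x xB <-] Dx]|y Cy].
  have : (B `&` f @^-1` D i) x by [].
  by rewrite e => -[].
have [x xB xy] := CB _ Cy; rewrite -xy; split; first by exists x.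
have : (B `&` f @^-1` C) x by split => //=; rewrite xy.
by rewrite -e => -[].
Qed.

Lemma prob_bigcup_ord_le d (T : measurableType d) (R : realType) (P : probability T R)
    (m : nat) (A : 'I_m -> set T) (u : R) :
  (forall j, measurable (A j)) -> (forall j, (P (A j) <= u%:E)%E) ->
  (P (\bigcup_(j in [set: 'I_m]) A j) <= (m%:R * u)%:E)%E.
Proof.
move=> mA Au.
apply: (@le_trans _ _ (\sum_(j \in [set: 'I_m]) P (A j))%E).
  apply: content_sub_fsum => //; first exact: finite_finset.
  by apply: fin_bigcup_measurable => //; exact: finite_finset.
rewrite fsum_fin; apply: (@le_trans _ _ (\sum_(j < m) u%:E)%E).
  by apply: lee_sum => j _; exact: Au.
by rewrite sumEFin sumr_const card_ord lee_fin mulr_natl.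
Qed.

Section ClassDeviation.
Context {R : realType} {d n : nat} {dO : measure_display} {Omega : measurableType dO}.
Variables (Pr : probability Omega R) (P : probability (d.-tuple R) R).
Variable X : 'I_n -> {RV Pr >-> d.-tuple R}.
Hypothesis Xind : mutually_independent X.
Hypothesis Xlaw : forall i B, measurable B -> distribution Pr (X i) B = P B.
Hypothesis cdf_cont : forall j, continuous (margin_cdf P j).
Variables (p : \bar R) (k : nat).
Hypotheses (p1 : (1 <= p)%E) (n0 : (0 < n)%N) (k0 : (0 < k)%N).

Let nR : 0 < n%:R :> R. Proof. by rewrite ltr0n. Qed.
Let kR : 0 < k%:R :> R. Proof. by rewrite ltr0n. Qed.

(** Standardized points in units of n/k: being in the dilated framing set becomes being in the
    framing set. *)
Definition unit_std (y : d.-tuple R) : d.-tuple R := scale (k%:R / n%:R) (std_val P y).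

Lemma measurable_unit_std : measurable_fun setT unit_std.
Proof.
apply: (measurable_scale (f := fun=> k%:R / n%:R)) => //.
apply/measurable_fun_tnthP => j.
rewrite (_ : _ \o _ = fun y : d.-tuple R => (tail_prob P j (tnth y j))^-1); last first.
  by apply/funext => y /=; rewrite tnth_mktuple.
apply: measurable_invr_ge0 => [y|]; first by have /andP[] := tail_prob01 P j (tnth y j).
exact: (measurableT_comp (measurable_tail_prob P j) (measurable_tnth j)).
Qed.

Lemma measurable_unit_std_pre (D : set (d.-tuple R)) : measurable D -> measurable (unit_std @^-1` D).
Proof. by move=> mD; rewrite -[X in measurable X]setTI; exact: measurable_unit_std. Qed.

Definition degenerate : set (d.-tuple R) :=
  \bigcup_(j in [set: 'I_d]) [set y : d.-tuple R | tail_prob P j (tnth y j) <= 0].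

Lemma measurable_degenerate : measurable degenerate.
Proof.
apply: fin_bigcup_measurable; first exact: finite_finset.
by move=> j _; exact: measurable_tail_prob_le.
Qed.

Lemma prob_degenerate : P degenerate = 0%E.
Proof.
have := @prob_bigcup_ord_le _ _ _ P d (fun j => [set y | tail_prob P j (tnth y j) <= 0]) 0.
rewrite mulr0 => h; apply/eqP; rewrite eq_le measure_ge0 andbT h // => j.
  exact: measurable_tail_prob_le.
exact: prob_tail_le.
Qed.

(** The left side sees only points whose standardized coordinates are all finite; on these [std_val]
    agrees with [standardize], and the remaining points have probability 0. *)
Lemma law_std_realE (D : set (d.-tuple R)) : measurable D ->
  law_std_real P (scale (n%:R / k%:R) @` D) = P (unit_std @^-1` D).
Proof.
move=> mD; have mC := measurable_unit_std_pre mD.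
have -> : law_std_real P (scale (n%:R / k%:R) @` D) = P (unit_std @^-1` D `\` degenerate).
  rewrite /law_std_real /law_std /pushforward; congr (P _).
  have kn : k%:R / n%:R * (n%:R / k%:R) = 1 :> R by field; rewrite !gt_eqF.
  have nk : n%:R / k%:R * (k%:R / n%:R) = 1 :> R by field; rewrite !gt_eqF.
  apply/seteqP; split => y /=.
    move=> [_ [z Dz <-] e].
    have tE j : tail_prob P j (tnth y j) != 0 /\ (tail_prob P j (tnth y j))^-1 = n%:R / k%:R * tnth z j.
      have := congr1 (fun t : d.-tuple (\bar R) => tnth t j) e.
      rewrite !tnth_mktuple -(fineK (margin_cdf_fin P j (tnth y j))) -EFinB -/(tail_prob P j _) inver.
      by case: eqP => // _ [<-].
    split.
      rewrite /unit_std; suff -> : scale (k%:R / n%:R) (std_val P y) = z by [].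
      apply: eq_from_tnth => j; rewrite tnth_scale tnth_mktuple (proj2 (tE j)).
      by rewrite mulrA kn mul1r.
    move=> [j _ /=]; have /andP[t0 _] := tail_prob01 P j (tnth y j).
    by move=> t0'; have [+ _] := tE j; rewrite eq_le t0' t0.
  move=> [Dy ndeg]; exists (std_val P y).
    exists (unit_std y) => //; by rewrite /unit_std scaleA nk scale1.
  apply: eq_from_tnth => j; rewrite !tnth_mktuple.
  rewrite -(fineK (margin_cdf_fin P j (tnth y j))) -EFinB -/(tail_prob P j _) inver.
  case: eqP => // t0; exfalso; apply: ndeg; exists j => //=.
  by rewrite t0.
have -> : P (unit_std @^-1` D) = P ((unit_std @^-1` D `\` degenerate) `|` (unit_std @^-1` D `&` degenerate)).
  congr (P _); apply/seteqP; split => y /=; last by case=> [[]|[]].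
  by move=> Dy; have [|] := pselect (degenerate y); [right|left].
have mdeg := measurable_degenerate.
rewrite measureU.
- rewrite [X in (_ + X)%E](_ : _ = 0%E) ?adde0 //.
  by apply: (subset_measure0 (B := degenerate)) => //; [exact: measurableI|exact: prob_degenerate].
- exact: measurableD.
- exact: measurableI.
- by rewrite -subset0 => y [[_ nd] [_ /nd]].
Qed.

(** The p-norm is at most d^(1/p) times the maximum, so a norm of at least t forces one of the d
    tail probabilities below d^(1/p) k / (n t). The union bound gives the total power d^(1 +
    1/p). *)
Lemma prob_unit_std_ge (t : R) : 0 < t ->
  (P [set y | (t <= lp_norm p (unit_std y))%R] <=
     (d%:R * (d%:R `^ fine p^-1%E * (k%:R / n%:R) / t))%:E)%E.
Proof.
move=> t0; set b := d%:R `^ _.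
have [d0|d0] := posnP d.
  rewrite (_ : [set y | _] = set0) ?measure0 ?lee_fin.
    by rewrite mulr_ge0 ?divr_ge0 ?mulr_ge0 ?powR_ge0 ?(ltW t0).
  rewrite -subset0 => y /= ty; have : lp_norm p (unit_std y) <= 0.
    rewrite (le_trans (lp_norm_le_max p1 (lexx 0) _)) ?mulr0 // => j.
    by have := ltn_ord j; rewrite {2}d0.
  by move=> /(le_trans ty); rewrite leNgt t0.
have b0 : 0 < b by rewrite powR_gt0 // ltr0n.
apply: (@le_trans _ _ (P (\bigcup_(j in [set: 'I_d]) [set y : d.-tuple R | tail_prob P j (tnth y j) <= b * (k%:R / n%:R) / t]))).
  apply: le_measure; rewrite ?inE.
  - exact: (measurable_unit_std_pre (measurable_lp_norm_ge t p1)).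
  - apply: fin_bigcup_measurable; first exact: finite_finset.
    by move=> j _; exact: measurable_tail_prob_le.
  move=> y /= ty; apply: contrapT => h.
  have u0 : 0 < b * (k%:R / n%:R) / t by rewrite divr_gt0 // mulr_gt0 // divr_gt0.
  have small : \big[Num.max/0]_(j < d) `|tnth (unit_std y) j| < t / b.
    apply: bigmax_lt => [|j _]; first by rewrite divr_gt0.
    have tj : b * (k%:R / n%:R) / t < tail_prob P j (tnth y j).
      by rewrite ltNge; apply/negP => tj; apply: h; exists j.
    have tj0 := lt_trans u0 tj.
    rewrite /unit_std tnth_scale tnth_mktuple ger0_norm ?divr_ge0 ?(ltW tj0) //.
    rewrite ltr_pdivrMr // mulrAC ltr_pdivlMr //.
    by move: tj; rewrite ltr_pdivrMr // mulrC [t * _]mulrC.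
  have : lp_norm p (unit_std y) <= b * \big[Num.max/0]_(j < d) `|tnth (unit_std y) j|.
    apply: lp_norm_le_max => //; first exact: bigmax_ge_id.
    by move=> j; rewrite (bigmaxD1 j) // le_max lexx.
  move=> /(le_trans ty); rewrite leNgt => /negP; apply.
  by rewrite mulrC -ltr_pdivlMr.
apply: prob_bigcup_ord_le => j; first exact: measurable_tail_prob_le.
by apply: prob_tail_le => //; rewrite divr_ge0 ?mulr_ge0 ?divr_ge0 ?(ltW b0) ?(ltW t0).
Qed.

Lemma class_deviation (D : nat -> set (d.-tuple R)) (V : nat) (t L : R) :
  (forall m, measurable (D m)) -> vc_le (range D) V -> (0 < V)%N -> (0 < d)%N ->
  0 < t -> (forall m, D m `<=` [set y | t <= lp_norm p y]) ->
  let s := d%:R `^ (1 + fine p^-1%E) * t^-1 * k%:R in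
  0 <= L <= s ->
  exists2 E : set Omega, measurable E /\ (Pr E <= (expR (- L))%:E)%E &
    forall omega, ~ E omega -> forall m,
      `|\sum_(i < n) \1_(D m) (unit_std (X i omega)) -
        n%:R * fine (law_std_real P (scale (n%:R / k%:R) @` D m))| <= vc_threshold V s L.
Proof.
move=> mD DV V0 d0 t0 Dt s Ls.
have mC m := measurable_unit_std_pre (mD m).
have s0 : 0 < s by rewrite /s !mulr_gt0 ?powR_gt0 ?invr_gt0 // ltr0n.
exists [set omega | exists m, vc_threshold V s L < emp_gap P X (unit_std @^-1` D m) omega].
  split.
    rewrite (_ : [set omega | _] = \bigcup_m [set omega | vc_threshold V s L < emp_gap P X (unit_std @^-1` D m) omega]).
      by apply: bigcup_measurable => m _; exact: measurable_emp_gap_gt.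
    by apply/seteqP; split => omega /= [m]; [exists m|move=> _; exists m].
  apply: (@emp_gap_tail _ _ _ _ _ Pr P n X Xind Xlaw (fun m => unit_std @^-1` D m) V) => //.
    exact: vc_le_preimage.
  move=> m; have mU : measurable (\bigcup_(i < m) unit_std @^-1` D i) by apply: bigcup_measurable.
  have h := prob_unit_std_ge t0.
  have : (P (\bigcup_(i < m) unit_std @^-1` D i) <= (d%:R * (d%:R `^ fine p^-1%E * (k%:R / n%:R) / t))%:E)%E.
    apply: le_trans h; apply: le_measure; rewrite ?inE //.
      exact: (measurable_unit_std_pre (measurable_lp_norm_ge t p1)).
    by move=> y [i _] /= /Dt.
  rewrite -[X in (X <= _)%E]fineK ?fin_num_measure // lee_fin => hU.
  apply: (@le_trans _ _ (n%:R * (d%:R * (d%:R `^ fine p^-1%E * (k%:R / n%:R) / t)))).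
    by rewrite ler_wpM2l.
  rewrite /s powRD ?powRr1 //; last by rewrite pnatr_eq0 -lt0n d0 implybT.
  by rewrite le_eqVlt; apply/orP; left; apply/eqP; field; rewrite !gt_eqF.
move=> omega nE m; rewrite leNgt; apply/negP => bad; apply: nE; exists m.
by move: bad; rewrite /emp_gap law_std_realE.
Qed.

End ClassDeviation.

Arguments unit_std {R d} n P k y.

(** * Measurability of the supremum deviation *)

Section Separability.
Context {R : realType} {d n : nat}.
Variables (p : \bar R) (mu : {measure set (d.-tuple R) -> \bar R}).
Variables (calA : set (set (d.-tuple R))) (hull : bool -> set (d.-tuple R) -> R -> set (d.-tuple R)).
Variables (tau c : R).
Hypotheses (p1 : (1 <= p)%E) (muE : exponent_measure mu)
  (asA : assumption_A p mu calA hull tau c).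

Local Notation Phi := (angular p1 muE).

Lemma exists_dense_enumeration : calA !=set0 ->
  exists2 e : nat -> set (d.-tuple R), (forall m, calA (e m)) &
    forall A, calA A -> exists f : nat -> nat,
      forall x, sphere p x -> (\1_(e (f m)) x : R) @[m --> \oo] --> (\1_A x : R).
Proof.
move=> [A1 cA1]; have [calA0 [ctb sub dense]] := A_countable asA.
have /pfcard_geP[A00|[e]] := ctb.
  by have [A_ /(_ 0%N)] := dense _ cA1; rewrite A00.
exists e => [m|A cA]; first by apply: sub; exact: funS.
have [A_ A_0 A_cvg] := dense _ cA.
have /choice[f fP] : forall m, exists l, e l = A_ m.
  by move=> m; have [l _ <-] := @surj _ _ _ _ e _ (A_0 m); exists l.
by exists f => x xS; under eq_fun do rewrite fP; exact: A_cvg.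
Qed.

Lemma angular_cvg (A_ : nat -> set (d.-tuple R)) (A : set (d.-tuple R)) :
  (forall m, measurable (A_ m) /\ A_ m `<=` sphere p) -> measurable A -> A `<=` sphere p ->
  (forall x, sphere p x -> (\1_(A_ m) x : R) @[m --> \oo] --> (\1_A x : R)) ->
  Phi (A_ m) @[m --> \oo] --> Phi A.
Proof.
move=> mA_ mA AS cvg; have mS := @measurable_sphere R d p p1.
have := @dominated_cvg _ _ _ Phi (sphere p) mS (fun m x => (\1_(A_ m) x)%:E)
  (fun x => (\1_A x)%:E) (cst 1%E).
have -> : (fun m => \int[Phi]_(x in sphere p) (\1_(A_ m) x)%:E)%E = (fun m => Phi (A_ m)).
  apply/funext => m; have [mAm Am] := mA_ m.
  by rewrite integral_indic // setIidl.
rewrite integral_indic // setIidl //; apply => //.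
- move=> m; apply/measurable_EFinP; apply: measurable_indic; exact: (proj1 (mA_ m)).
- by move=> x xS; apply/cvg_EFin; [near=> m|exact: cvg].
- apply: finite_measure_integrable_cst; exact: mS.
- by move=> m x _; rewrite lee_fin ger0_norm // indicE lern1 leq_b1.
Unshelve. all: by end_near. Qed.

Variable k : nat.
Hypothesis n0 : (0 < n)%N.

Let emp_sphere (x : 'I_n -> d.-tuple R) i : (0 < d)%N -> sphere p (theta p (emp_std x i)).
Proof.
move=> d0; have pos j : 0 < tnth (emp_std x i) j.
  by rewrite emp_stdE // divr_gt0 // ltr_pwDl // exceed_ge0.
apply: theta_sphere => //; split=> [j|xE]; first exact: ltW.
by have := pos (Ordinal d0); rewrite xE tnth_mktuple ltxx.
Qed.

Lemma emp_angular_cvg (x : 'I_n -> d.-tuple R) (A_ : nat -> set (d.-tuple R)) (A : set (d.-tuple R)) :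
  (0 < d)%N ->
  (forall x, sphere p x -> (\1_(A_ m) x : R) @[m --> \oo] --> (\1_A x : R)) ->
  emp_angular_measure x p k (A_ m) @[m --> \oo] --> emp_angular_measure x p k A.
Proof.
move=> d0 cvg; apply: cvgM; first exact: cvg_cst.
apply: cvg_big => [|i _]; first exact: add_continuous.
set b := n%:R / k%:R <= lp_norm p (emp_std x i).
have bE B : \1_[set w | n%:R / k%:R <= lp_norm p w /\ B (theta p w)] (emp_std x i) =
    b%:R * \1_B (theta p (emp_std x i)) :> R.
  rewrite !indicE -natrM mulnb; congr (_%:R); congr nat_of_bool.
  apply/idP/andP => [/set_mem[? Bx]|[? /set_mem Bx]]; first by split => //; apply/mem_set.
  by apply/mem_set.
under eq_fun do rewrite bE.
rewrite bE; apply: cvgM; first exact: cvg_cst.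
exact/cvg/emp_sphere.
Qed.

Context {dO : measure_display} {Omega : measurableType dO}.
Variables (Pr : probability Omega R) (X : 'I_n -> {RV Pr >-> d.-tuple R}).

Lemma measurable_emp_std i : measurable_fun setT (fun omega => emp_std (fun i => X i omega) i).
Proof.
apply/measurable_fun_tnthP => j.
rewrite (_ : _ \o _ = fun omega => n.+1%:R * (1 + exceed (fun i => X i omega) j (tnth (X i omega) j))^-1); last first.
  by apply/funext => omega /=; rewrite emp_stdE.
apply: measurable_funM => //; apply: measurable_invr_ge0.
  by move=> omega; rewrite addr_ge0 // exceed_ge0.
have mXj l : measurable_fun setT (fun omega => tnth (X l omega) j).
  exact: (measurableT_comp (measurable_tnth j)).
apply: measurable_funD => //; apply: measurable_sum => l.
rewrite (_ : (fun _ => _) = \1_[set omega | tnth (X i omega) j < tnth (X l omega) j]).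
  apply: measurable_indic; rewrite -[X in measurable X]setTI.
  rewrite (_ : [set omega | _] = (fun omega => tnth (X i omega) j < tnth (X l omega) j) @^-1` [set true]) //.
  exact: measurable_fun_ltr.
by apply/funext => omega; rewrite !indicE.
Qed.

Lemma measurable_emp_angular A : measurable A ->
  measurable_fun setT (fun omega => emp_angular_measure (fun i => X i omega) p k A).
Proof.
move=> mA; apply: measurable_funM => //; apply: measurable_sum => i.
set S := [set w | _].
have mS : measurable S.
  rewrite (_ : S = [set w | n%:R / k%:R <= lp_norm p w] `&` theta p @^-1` A) //.
  apply: measurableI; first exact: measurable_lp_norm_ge.
  by rewrite -[X in measurable X]setTI; exact: measurable_theta.
have mI : measurable_fun setT (\1_S : d.-tuple R -> R) by exact: measurable_indic.
exact: (measurableT_comp mI (measurable_emp_std i)).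
Qed.

(** The angular measure, by dominated convergence, and the empirical one, a finite sum of
    indicators, both pass to pointwise limits on the sphere. The bound [b] is an extended real
    because the right-hand side of the final estimate may be infinite. *)
Lemma sup_deviationE (e : nat -> set (d.-tuple R)) (omega : Omega) (b : \bar R) :
  (0 < d)%N -> (forall m, calA (e m)) ->
  (forall A, calA A -> exists f : nat -> nat,
      forall x, sphere p x -> (\1_(e (f m)) x : R) @[m --> \oo] --> (\1_A x : R)) ->
  (ereal_sup [set `|(emp_angular_measure (fun i => X i omega) p k A)%:E
      - angular_measure p mu A| | A in calA] <= b)%E <->
  forall m, (`|emp_angular_measure (fun i => X i omega) p k (e m) - fine (Phi (e m))|%:E <= b)%E.
Proof.
move=> d0 ce dense.
have devE A : calA A -> (`|(emp_angular_measure (fun i => X i omega) p k A)%:E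
      - angular_measure p mu A|)%E =
    (`|emp_angular_measure (fun i => X i omega) p k A - fine (Phi A)|%:E)%E.
  move=> cA; have [mA _ _] := A_borel asA cA.
  by rewrite /angular_measure -(angularE p1 muE) -(fineK (fin_num_measure Phi _ mA)).
split=> [/ereal_supP h m|h].
  by rewrite -devE //; apply: h; exists (e m).
apply/ereal_supP => _ [A cA <-]; rewrite devE //.
have [f fA] := dense _ cA; have [mA AS _] := A_borel asA cA.
have cPhi : fine (Phi (e (f m))) @[m --> \oo] --> fine (Phi A).
  apply: fine_cvg; rewrite fineK ?fin_num_measure //.
  apply: (angular_cvg (A_ := fun m => e (f m))) => // m.
  by have [? ? _] := A_borel asA (ce (f m)).
have cdev : `|emp_angular_measure (fun i => X i omega) p k (e (f m)) - fine (Phi (e (f m)))|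
    @[m --> \oo] --> `|emp_angular_measure (fun i => X i omega) p k A - fine (Phi A)|.
  apply: cvg_norm; apply: cvgB => //.
  exact: (emp_angular_cvg (A_ := fun m => e (f m))).
case: b h => [r|_|h]; [move=> h|by rewrite leey|by have := h 0%N].
rewrite lee_fin -(cvg_lim _ cdev) //; apply: limr_le; first by apply/cvg_ex; eexists; exact: cdev.
by apply: nearW => m; have := h (f m); rewrite lee_fin.
Qed.

Lemma measurable_sup_deviation (b : \bar R) : (0 < d)%N ->
  measurable [set omega | (ereal_sup [set `|(emp_angular_measure (fun i => X i omega) p k A)%:E
      - angular_measure p mu A| | A in calA] <= b)%E].
Proof.
move=> d0; have [->|/set0P cA0] := eqVneq calA set0.
  rewrite (_ : [set omega | _] = setT) //; apply/seteqP; split => omega //= _.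
  by rewrite image_set0 ereal_sup0 leNye.
have [e ce dense] := exists_dense_enumeration cA0.
pose g m omega := `|emp_angular_measure (fun i => X i omega) p k (e m) - fine (Phi (e m))|.
rewrite (_ : [set omega | _] = \bigcap_m [set omega | ((g m omega)%:E <= b)%E]); last first.
  apply/seteqP; split => omega /=.
    by move=> /(sup_deviationE _ _ d0 ce dense) h m _; exact: h.
  by move=> h; apply/(sup_deviationE _ _ d0 ce dense) => m; exact: h.
apply: bigcap_measurable => [|m _]; first by exists 0%N.
have mg : measurable_fun setT (fun omega => (g m omega)%:E).
  apply/measurable_EFinP; apply: measurableT_comp => //; apply: measurable_funB => //.
  by apply: measurable_emp_angular; have [] := A_borel asA (ce m).
by have := mg measurableT _ (emeasurable_itv `]-oo, b]); rewrite !setTI; congr measurable.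
Qed.

End Separability.

(** * Conclusion *)

(** A deterministic statement: the sample is a fixed family, and randomness will enter only through
    the marginal deviation hypothesis and the positivity of the tails. *)
Lemma emp_angular_framing (R : realType) (d n k : nat) (P : probability (d.-tuple R) R)
    (x : 'I_n -> d.-tuple R) (p : \bar R) (mu : {measure set (d.-tuple R) -> \bar R})
    (calA : set (set (d.-tuple R))) (hull : bool -> set (d.-tuple R) -> R -> set (d.-tuple R))
    (tau c rho Delta1 D h : R) (A : set (d.-tuple R)) :
  (0 < d)%N -> (0 < n)%N -> (0 < k)%N -> (1 <= p)%E -> assumption_A p mu calA hull tau c ->
  k%:R / n%:R < rho < tau -> 0 <= Delta1 -> Delta1 * rho < 1 ->
  rho / (1 - Delta1 * rho) <= tau ->
  (forall j t, tail_prob P j t <= k%:R / n%:R / rho ->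
     `|exceed x j t - n%:R * tail_prob P j t| <= k%:R * Delta1) ->
  (forall j t, k%:R / n%:R / rho < tail_prob P j t ->
     exists2 t0, t <= t0 & tail_prob P j t0 = k%:R / n%:R / rho) ->
  (forall i j, 0 < tail_prob P j (tnth (x i) j)) ->
  2 * (Delta1 + k%:R^-1) <= h -> Delta1 + k%:R^-1 <= D < 1 -> calA A ->
  \sum_(i < n) \1_(framing p hull false A (1 - D) h) (unit_std n P k (x i) : d.-tuple R)
    <= k%:R * emp_angular_measure x p k A
    <= \sum_(i < n) \1_(framing p hull true A (1 + D) h) (unit_std n P k (x i) : d.-tuple R).
Proof.
move=> d0 n0 k0 p1 asA /andP[krho rhotau] D10 D1rho rhot Hdev Hivt Hpos h2 /andP[etaD D1] cA.
have nR : 0 < n%:R :> R by rewrite ltr0n.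
have kR : 0 < k%:R :> R by rewrite ltr0n.
have kn : 0 < k%:R / n%:R :> R by rewrite divr_gt0.
pose eta := Delta1 + k%:R^-1 : R.
have eta0 : 0 < eta by rewrite ltr_wpDl // invr_gt0.
pose w i := unit_std n P k (x i) : d.-tuple R.
pose v i := scale (k%:R / n%:R) (emp_std x i) : d.-tuple R.
have w0 i j : 0 < tnth (w i) j by apply: std_val_gt0.
have v0 i j : 0 < tnth (v i) j by apply: emp_std_gt0.
have wv i j : rho <= tnth (w i) j -> `|tnth (w i) j - tnth (v i) j| <= eta * (tnth (w i) j * tnth (v i) j).
  by apply: std_emp_close => //; exact: Hdev.
have wv_small i j : tnth (w i) j < rho -> tnth (v i) j <= tau.
  apply: (@emp_std_small _ _ _ P x k rho Delta1 tau i j) => //; [exact: Hdev|exact: Hivt].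
have -> : k%:R * emp_angular_measure x p k A =
    \sum_(i < n) \1_[set y : d.-tuple R | 1 <= lp_norm p y /\ A (theta p y)] (v i).
  rewrite /emp_angular_measure mulrA divff ?gt_eqF // mul1r; apply: eq_bigr => i _.
  rewrite !indicE; congr (_%:R); congr nat_of_bool.
  have nE : (1 <= lp_norm p (v i)) = (n%:R / k%:R <= lp_norm p (emp_std x i)).
    by rewrite lp_norm_scale ?(ltW kn) // -ler_pdivrMl // mulr1 invf_div.
  by apply/idP/idP => /set_mem /= [h1 h2']; apply/mem_set; split;
    rewrite ?nE // -?nE // ?theta_scale // -(@theta_scale _ _ p (k%:R / n%:R)).
have incl (B C : set (d.-tuple R)) (y z : 'I_n -> d.-tuple R) :
    (forall i, B (y i) -> C (z i)) -> \sum_(i < n) \1_B (y i) <= \sum_(i < n) \1_C (z i) :> R.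
  move=> BC; apply: ler_sum => i _; rewrite !indicE ler_nat.
  have [/set_mem yB|//] := boolP (y i \in B).
  by rewrite (mem_set (BC _ yB)).
apply/andP; split; apply: incl => i.
  by apply: (framing_inner_incl p1 asA eta0 h2 etaD rhotau (w0 i) (v0 i) d0 (wv i) cA D1).
by move=> [h1 hA]; exact: (framing_outer_incl p1 asA eta0 h2 etaD (w0 i) (v0 i) d0 (wv i) (wv_small i) cA).
Qed.

(** The assumption gives 2 sqrt L < sqrt (k rho) / 4, hence L <= k rho <= k. This is the condition L
    <= S of the exponential inequality, since S is at least k both for the margins and for the
    framing sets. *)
Lemma le_quarter_numerics (R : realType) (k rho L : R) : 0 < k -> 0 < rho < 1 -> 0 <= L ->
  (Num.sqrt (k * rho))^-1 * (60 + 2 * Num.sqrt L) + 2 / (3 * k) * L < 4^-1 -> L <= k.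
Proof.
move=> k0 /andP[rho0 rho1] L0.
have kr0 : 0 < k * rho by rewrite mulr_gt0.
set s := Num.sqrt (k * rho); have s0 : 0 < s by rewrite sqrtr_gt0.
have L3 : 0 <= 2 / (3 * k) * L by rewrite mulr_ge0 // divr_ge0 // mulr_ge0 // ltW.
move=> lt4; have : s^-1 * (60 + 2 * Num.sqrt L) < 4^-1 by lra.
rewrite mulrC ltr_pdivrMr // => lt4s.
have Ls : Num.sqrt L <= s by have := sqrtr_ge0 L; lra.
rewrite -(sqr_sqrtr L0); apply: (@le_trans _ _ (s ^+ 2)).
  by rewrite lerXn2r ?nnegrE ?sqrtr_ge0 // ltW.
by rewrite sqr_sqrtr ?(ltW kr0) // ler_piMr // ltW.
Qed.

(** Here k / rho is n times the tail level k / (n rho) up to which the margins are controlled, and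
    sqrt (k / rho) = k / sqrt (k rho). *)
Lemma marginal_threshold_le (R : realType) (k rho L : R) : 0 < k -> 0 < rho -> 0 <= L ->
  vc_threshold 1 (k / rho) L <=
  k * ((Num.sqrt (k * rho))^-1 * (60 + 2 * Num.sqrt L) + 2 / (3 * k) * L).
Proof.
move=> k0 rho0 L0; rewrite /vc_threshold mul1r [Num.sqrt (_ * L)]sqrtrM ?divr_ge0 ?(ltW k0) ?(ltW rho0) //.
have -> : Num.sqrt (k / rho) = k * (Num.sqrt (k * rho))^-1.
  have -> : k / rho = k ^+ 2 * (k * rho)^-1 by field; rewrite !gt_eqF.
  by rewrite sqrtrM ?sqr_ge0 // sqrtr_sqr gtr0_norm // sqrtrV // mulr_ge0 // ltW.
set t := _^-1; have t0 : 0 <= k * t by rewrite mulr_ge0 ?(ltW k0) // invr_ge0 sqrtr_ge0.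
have L3 : 0 <= k * (2 / (3 * k) * L).
  by rewrite mulr_ge0 ?(ltW k0) // mulr_ge0 // divr_ge0 // mulr_ge0 // ltW.
have := sqrtr_ge0 L; rewrite mulrDr; set l := Num.sqrt L => l0.
have : 0 <= (k * t) * 12 by rewrite mulr_ge0.
lra.
Qed.

Lemma class_threshold_le (R : realType) (V : nat) (k b L : R) : 0 < k -> 0 <= b -> 0 <= L ->
  vc_threshold V (b * k) L / k <= Num.sqrt (b / k) * (60 * Num.sqrt V%:R + 2 * Num.sqrt L).
Proof.
move=> k0 b0 L0; rewrite /vc_threshold [Num.sqrt (V%:R * _)]sqrtrM // [Num.sqrt (b * k * L)]sqrtrM ?mulr_ge0 ?(ltW k0) //.
have -> : Num.sqrt (b * k) = k * Num.sqrt (b / k).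
  have -> : b * k = k ^+ 2 * (b / k) by field; rewrite gt_eqF.
  by rewrite sqrtrM ?sqr_ge0 // sqrtr_sqr gtr0_norm.
set t := Num.sqrt (b / k); set v := Num.sqrt _; set l := Num.sqrt _.
have -> : (48 * (v * (k * t)) + 2 * (k * t * l)) / k = t * (48 * v + 2 * l).
  by field; rewrite gt_eqF.
rewrite ler_wpM2l ?sqrtr_ge0 // lerD2r ler_wpM2r ?sqrtr_ge0 //; lra.
Qed.

Lemma vc_dim_nat (R : realType) (T : Type) (F : set (set T)) : vc_dim R F \is a fin_num ->
  exists2 V : nat, vc_le F V & V%:R <= fine (vc_dim R F).
Proof.
move=> fin.
have le v (S : set T) : (S #= `I_v)%card -> shatters F S -> v%:R <= fine (vc_dim R F).
  move=> Sv sh; rewrite -lee_fin fineK //; apply: ereal_sup_ubound.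
  by exists v => //; right; exists S.
have ge0 : 0 <= fine (vc_dim R F).
  rewrite -lee_fin fineK //; apply: ereal_sup_ubound.
  by exists 0%N => //; left.
exists (Num.truncn (fine (vc_dim R F))); last by rewrite truncn_le.
by move=> v S Sv sh; rewrite truncn_ge_nat //; exact: le sh.
Qed.

Lemma vc_le_gt0 (T : Type) (F : set (set T)) (V : nat) (x : T) (C D : set T) :
  F C -> F D -> C x -> ~ D x -> vc_le F V -> (0 < V)%N.
Proof.
move=> FC FD Cx nDx; move=> /(_ 1%N [set x] card_set1); apply => B Bx.
have [Bx'|Bx'] := pselect (B x).
  exists C => //; apply/seteqP; split => y; first by move=> [-> _].
  by move=> /Bx ->.
exists D => //; apply/seteqP; split => y; first by move=> [-> /nDx].
by move=> By; have yx := Bx _ By; rewrite yx in By.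
Qed.

Lemma two_sided_deviation (R : realType) (k n E phi qm qp Sm Sp thr err gm gp M : R) : 0 < k ->
  Sm <= k * E <= Sp -> `|Sm - n * qm| <= thr -> `|Sp - n * qp| <= thr ->
  gp <= phi + err -> phi <= gm + err ->
  `|n / k * qm - gm| <= M -> `|n / k * qp - gp| <= M ->
  `|E - phi| <= M + thr / k + err.
Proof.
move=> k0 /andP[Sm1 Sp1]; rewrite ler_norml => /andP[Sm2 _]; rewrite ler_norml => /andP[_ Sp2].
move=> gp1 gm1; rewrite ler_norml => /andP[m1 _]; rewrite ler_norml => /andP[_ m2].
have Ep : E <= n / k * qp + thr / k.
  have -> : n / k * qp + thr / k = (n * qp + thr) / k by field; rewrite gt_eqF.
  by rewrite ler_pdivlMr //; lra.
have Em : n / k * qm - thr / k <= E.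
  have -> : n / k * qm - thr / k = (n * qm - thr) / k by field; rewrite gt_eqF.
  by rewrite ler_pdivrMr //; lra.
by rewrite ler_norml; apply/andP; split; lra.
Qed.

Section GoodEvent.
Context {R : realType} {d n k : nat} {dO : measure_display} {Omega : measurableType dO}.
Variables (Pr : probability Omega R) (P : probability (d.-tuple R) R)
  (X : 'I_n -> {RV Pr >-> d.-tuple R}) (p : \bar R)
  (mu : {measure set (d.-tuple R) -> \bar R}) (calA : set (set (d.-tuple R)))
  (hull : bool -> set (d.-tuple R) -> R -> set (d.-tuple R)) (tau c rho : R).
Hypotheses (d0 : (0 < d)%N) (n0 : (0 < n)%N) (k0 : (0 < k)%N)
  (Xind : mutually_independent X)
  (Xlaw : forall i B, measurable B -> distribution Pr (X i) B = P B)
  (cdfc : forall j : 'I_d, continuous (margin_cdf P j))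
  (p1 : (1 <= p)%E) (muE : exponent_measure mu)
  (asA : assumption_A p mu calA hull tau c)
  (krhotau : k%:R / n%:R < rho < tau).

Variables (D1 D2 h : R).
Local Notation Gamma s A := (framing p hull s A (if s then 1 + D2 else 1 - D2) h).
Local Notation calF := ([set Gamma false A | A in calA] `|` [set Gamma true A | A in calA]).
Hypotheses (D1_gt0 : 0 < D1) (D1rho : D1 * rho < 1) (rhot : rho / (1 - D1 * rho) <= tau)
  (etah : 2 * (D1 + k%:R^-1) <= h) (etaD2 : D1 + k%:R^-1 <= D2 < 1) (chd : c * h < d%:R)
  (mG : forall s A, calA A -> measurable (Gamma s A)).

Local Notation Phi := (angular p1 muE).

Let kR : 0 < k%:R :> R. Proof. by rewrite ltr0n. Qed.
Let nR : 0 < n%:R :> R. Proof. by rewrite ltr0n. Qed.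
Let rho0 : 0 < rho.
Proof. by case/andP: krhotau => + _; apply: lt_trans; rewrite divr_gt0. Qed.
Let D2_ge0 : 0 < D2.
Proof. by case/andP: etaD2 => + _; apply: lt_le_trans; rewrite addr_gt0 // invr_gt0. Qed.
Let D2_lt1 : D2 < 1. Proof. by case/andP: etaD2. Qed.
Let h_gt0 : 0 < h.
Proof. by apply: lt_le_trans etah; rewrite mulr_gt0 // addr_gt0 // invr_gt0. Qed.

Let radius_gt0 (s : bool) : 0 < (if s then 1 + D2 else 1 - D2).
Proof. by move: D2_ge0 D2_lt1; case: s; lra. Qed.

Definition model_gap (s : bool) (A : set (d.-tuple R)) : R :=
  `|n%:R / k%:R * fine (law_std_real P (scale (n%:R / k%:R) @` Gamma s A)) - fine (mu (Gamma s A))|.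

Lemma mu_framing_fin s A : calA A -> mu (Gamma s A) \is a fin_num.
Proof.
move=> cA; rewrite ge0_fin_numE //; have r0 := radius_gt0 s.
have mT := @measurable_tail_cone R d p p1 (if s then 1 + D2 else 1 - D2)^-1 setT measurableT.
apply: (@le_lt_trans _ _ (mu (tail_cone p (if s then 1 + D2 else 1 - D2)^-1 [set: d.-tuple R]))).
  apply: le_measure; rewrite ?inE //; first exact: mG.
  move=> x [x0 xr _]; split => //; apply: (punctured_orthantP p1) => //.
  by apply: lt_le_trans xr; rewrite invr_gt0.
rewrite (mu_tail_cone p1 muE) ?invr_gt0 //.
have : Phi setT \is a fin_num by exact: fin_num_measure.
rewrite angularE => fin; rewrite -ge0_fin_numE ?fin_numM //.
by rewrite mule_ge0 // lee_fin invrK ltW.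
Qed.

Lemma law_framing_fin s A : calA A ->
  law_std_real P (scale (n%:R / k%:R) @` Gamma s A) \is a fin_num.
Proof.
move=> cA; rewrite (law_std_realE cdfc n0 k0) ?fin_num_measure //; last exact: mG.
by apply: measurable_unit_std_pre; exact: mG.
Qed.

Lemma model_gapE s A : calA A -> (model_gap s A)%:E =
  (`|(n%:R / k%:R)%:E * law_std_real P (scale (n%:R / k%:R) @` Gamma s A) - mu (Gamma s A)|)%E.
Proof.
by move=> cA; rewrite -(fineK (law_framing_fin s cA)) -(fineK (mu_framing_fin s cA)).
Qed.

(** Chaining needs dimension at least 1. A point at radius (1 + Delta2)^-1 with angle in A lies in
    the outer framing set but below the radius of the inner one, so its singleton is shattered. *)
Lemma vc_framing_gt0 V : calA !=set0 -> vc_le calF V -> (0 < V)%N.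
Proof.
move=> [A cA]; have [_ AS [a Aa]] := A_borel asA cA.
have r0 := radius_gt0 true; have r0' := radius_gt0 false.
have ri : 0 < (1 + D2)^-1 by rewrite invr_gt0.
have [aS an] := AS _ Aa; have aid := theta_sphere_id (conj aS an).
have nE : lp_norm p (scale (1 + D2)^-1 a) = (1 + D2)^-1.
  by rewrite lp_norm_scale ?(ltW ri) // an mulr1.
apply: (@vc_le_gt0 _ _ _ (scale (1 + D2)^-1 a) (Gamma true A) (Gamma false A)).
- by right; exists A.
- by left; exists A.
- split; [exact: orthant_scale (ltW ri) aS|by rewrite nE|].
  rewrite theta_scale // aid; apply: (sub_hull_outer asA) => //.
  by rewrite nE mulr_gt0.
move=> [_ + _]; rewrite nE lef_pV2 ?posrE //.
by move: D2_ge0; lra.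
Qed.

Lemma good_event (L : R) (V : nat) (e : nat -> set (d.-tuple R)) :
  0 <= L <= k%:R -> vc_threshold 1 (k%:R / rho) L <= k%:R * D1 ->
  vc_le calF V -> (forall m, calA (e m)) ->
  let b := d%:R `^ (1 + fine p^-1%E) * (1 + D2) in
  exists2 bad : set Omega, measurable bad /\ (Pr bad <= (d.+1%:R * expR (- L))%:E)%E &
    forall omega, ~ bad omega -> forall m,
      `|emp_angular_measure (fun i => X i omega) p k (e m) - fine (Phi (e m))| <=
      Num.max (model_gap true (e m)) (model_gap false (e m)) +
      Num.sqrt (b / k%:R) * (60 * Num.sqrt V%:R + 2 * Num.sqrt L) +
      (d%:R * D2 + c * h * (1 + ln (d%:R / (c * h)))).
Proof.
move=> /andP[L0 Lk] margthr FV ce b.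
have V0 : (0 < V)%N by apply: vc_framing_gt0 FV; exists (e 0%N).
have rho1 : rho < 1.
  by case/andP: krhotau => _ /lt_trans; apply; case/andP: (A_tau asA).
have p0 : 0 < k%:R / n%:R / rho :> R by rewrite divr_gt0 // divr_gt0.
have kkr : k%:R <= k%:R / rho :> R by rewrite ler_pdivlMr // ler_piMr // ltW.
have /choice[E_ E_P] : forall j : 'I_d, exists E : set Omega,
    (measurable E /\ (Pr E <= (expR (- L))%:E)%E) /\
    forall omega, ~ E omega -> forall t, tail_prob P j t <= k%:R / n%:R / rho ->
      `|exceed (fun i => X i omega) j t - n%:R * tail_prob P j t| <= k%:R * D1.
  move=> j; have [||||E EP Edev] := @marginal_deviation _ _ _ _ _ Pr P X Xind Xlaw j (@cdfc j)
     (k%:R / n%:R / rho) (k%:R / rho) L n0.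
  - exact: ltW.
  - by rewrite le_eqVlt; apply/orP; left; apply/eqP; field; rewrite !gt_eqF.
  - exact: divr_gt0.
  - by rewrite L0 (le_trans Lk).
  exists E; split => // omega nE t tu; apply: le_trans margthr; exact: Edev.
(* Inner (even indices) and outer (odd indices) framing sets are interleaved in one sequence, so
   that a single exceptional event serves both. *)
pose D m : set (d.-tuple R) := Gamma (odd m) (e m./2).
have b1 : 1 <= b.
  apply: (@le_trans _ _ (1 * 1)); first by rewrite mulr1.
  apply: ler_pM => //; last by move: D2_ge0; lra.
  rewrite -[leLHS](powRr0 d%:R); apply: ler_powR; first by rewrite ler1n.
  rewrite addr_ge0 // fine_ge0 // inve_ge0 //.
  exact: le_trans p1.
have [|||||||E0 [mE0 PE0] E0dev] := @class_deviation _ _ _ _ _ Pr P X Xind Xlaw cdfc p k p1 n0 k0 D V (1 + D2)^-1 L.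
- by move=> m; exact: mG.
- move=> v S Sv sh; apply: (FV v S Sv) => B BS; have [_ [m _ <-] <-] := sh B BS.
  by exists (D m) => //; rewrite /D; case: (odd m); [right|left]; exists (e m./2).
- exact: V0.
- exact: d0.
- by rewrite invr_gt0; exact: (radius_gt0 true).
- move=> m y [_ + _] /=; apply: le_trans; have := radius_gt0 (odd m).
  by case: (odd m) => // r0; rewrite lef_pV2 ?posrE ?(radius_gt0 true) //; move: D2_ge0; lra.
- by rewrite invrK -/b L0 (le_trans Lk) // ler_peMl // ltW.
rewrite invrK -/b in PE0 E0dev.
(* Null events on which a tail probability vanishes at a sample point: there [std_val] has a
   coordinate 0, while the comparison requires positive ones. *)
pose N i := X i @^-1` degenerate P.
have mN i : measurable (N i).
  by rewrite -[X in measurable X]setTI; apply: (measurable_funPT (X i)) => //; exact: measurable_degenerate.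
have PN i : Pr (N i) = 0%E.
  have := Xlaw i (measurable_degenerate P); rewrite prob_degenerate //.
have mE j : measurable (E_ j) by have [[]] := E_P j.
have mUE : measurable (\bigcup_(j in [set: 'I_d]) E_ j).
  by apply: fin_bigcup_measurable => //; exact: finite_finset.
have mUN : measurable (\bigcup_(i in [set: 'I_n]) N i).
  by apply: fin_bigcup_measurable => //; exact: finite_finset.
exists (\bigcup_(j in [set: 'I_d]) E_ j `|` (E0 `|` \bigcup_(i in [set: 'I_n]) N i)).
  split; first by apply: measurableU => //; exact: measurableU.
  apply: (le_trans (measureU2 _ _ _)) => //; first exact: measurableU.
  rewrite -natr1 mulrDl mul1r EFinD; apply: leeD.
    by apply: prob_bigcup_ord_le => // j; have [[]] := E_P j.
  apply: (le_trans (measureU2 _ _ _)) => //.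
  rewrite -[X in (_ <= X)%E]adde0; apply: leeD => //.
  have := prob_bigcup_ord_le (P := Pr) (A := N) (u := 0) mN.
  by rewrite mulr0; apply => i; rewrite PN.
move=> omega nbad m.
have nE j : ~ E_ j omega by move=> Ej; apply: nbad; left; exists j.
have nE0 : ~ E0 omega by move=> E0o; apply: nbad; right; left.
have nN i : ~ N i omega by move=> Ni; apply: nbad; right; right; exists i.
have Hpos i j : 0 < tail_prob P j (tnth (X i omega) j).
  by rewrite ltNge; apply/negP => tj; apply: (nN i); exists j.
have Hdev j t : tail_prob P j t <= k%:R / n%:R / rho ->
    `|exceed (fun i => X i omega) j t - n%:R * tail_prob P j t| <= k%:R * D1.
  by have [_] := E_P j; apply.
have Hivt j t : k%:R / n%:R / rho < tail_prob P j t ->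
     exists2 t0, t <= t0 & tail_prob P j t0 = k%:R / n%:R / rho.
  exact: (tail_prob_ivt (@cdfc j)).
have bracket := emp_angular_framing d0 n0 k0 p1 asA krhotau (ltW D1_gt0) D1rho rhot
  Hdev Hivt Hpos etah etaD2 (ce m).
have dev s := E0dev omega nE0 (s + m.*2)%N.
have DE (s : bool) : D (s + m.*2)%N = Gamma s (e m).
  by rewrite /D half_bit_double oddD odd_double addbF oddb.
have devm := dev false; have devp := dev true; rewrite !DE in devm devp.
have mA : measurable (e m) by have [] := A_borel asA (ce m).
have Phifin : Phi (e m) \is a fin_num by rewrite fin_num_measure.
have outer := mu_framing_outer p1 muE asA (ce m) (ltW D2_ge0) h_gt0 chd (mG true (ce m)).
have D2r : 0 <= D2 < 1 by rewrite ltW.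
have inner := mu_framing_inner p1 muE asA (ce m) D2r h_gt0 chd (mG false (ce m)).
rewrite /angular_measure -(angularE p1 muE) -(fineK Phifin) -(fineK (mu_framing_fin true (ce m)))
  -EFinD lee_fin in outer.
rewrite /angular_measure -(angularE p1 muE) -(fineK Phifin) -(fineK (mu_framing_fin false (ce m)))
  -EFinD lee_fin in inner.
have gm : model_gap false (e m) <= Num.max (model_gap true (e m)) (model_gap false (e m)).
  by rewrite le_max lexx orbT.
have gp : model_gap true (e m) <= Num.max (model_gap true (e m)) (model_gap false (e m)).
  by rewrite le_max lexx.
apply: (le_trans (two_sided_deviation kR bracket devm devp outer inner gm gp)).
rewrite lerD2r lerD2l; apply: class_threshold_le => //.
exact: le_trans ler01 b1.
Qed.

Lemma prob_sup_deviation (L delta err : R) :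
  0 <= L <= k%:R -> vc_threshold 1 (k%:R / rho) L <= k%:R * D1 ->
  0 <= delta -> expR (- L) = delta / d.+1%:R ->
  d%:R * D2 + c * h * (1 + ln (d%:R / (c * h))) <= err ->
  ((1 - delta)%:E <= Pr [set omega |
    (ereal_sup [set `|(emp_angular_measure (fun i => X i omega) p k A)%:E
                      - angular_measure p mu A| | A in calA]
     <= ereal_sup [set `|(n%:R / k%:R)%:E
                           * law_std_real P (scale (n%:R / k%:R) @` Gamma s A)
                         - mu (Gamma s A)| | s in [set: bool] & A in calA]
        + (Num.sqrt (d%:R `^ (1 + fine (p^-1)%E) * (1 + D2) / k%:R))%:E
          * (60%:E * sqrte (vc_dim R calF) + (2 * Num.sqrt L)%:E)
        + err%:E)%E])%E.
Proof.
move=> Lk margthr delta0 expL errP.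
set gap := ereal_sup [set _ | s in _ & A in _]; set b := d%:R `^ _ * _.
set event := [set omega | _].
have mevent : measurable event by exact: (measurable_sup_deviation p1 muE asA).
have trivial_event : event = setT -> ((1 - delta)%:E <= Pr event)%E.
  by move=> ->; rewrite probability_setT lee_fin gerBl.
have [cA0|/set0P cA0] := eqVneq calA set0.
  apply: trivial_event; apply/seteqP; split => omega //= _.
  by rewrite /event /= {1}cA0 image_set0 ereal_sup0 leNye.
have gap_ge s A : calA A -> ((model_gap s A)%:E <= gap)%E.
  by move=> cA; rewrite model_gapE //; apply: ereal_sup_ubound; exists s => //; exists A.
have gap_ge0 : (0 <= gap)%E.
  by have [A cA] := cA0; apply: le_trans (gap_ge true A cA); rewrite lee_fin normr_ge0.
have d1R : 1 <= d%:R :> R by rewrite ler1n.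
have b0 : 0 < b.
  by rewrite mulr_gt0 ?powR_gt0 //; [exact: lt_le_trans d1R|move: D2_ge0; lra].
have sb0 : 0 < Num.sqrt (b / k%:R) by rewrite sqrtr_gt0 divr_gt0.
have vc_ge0 : (0 <= vc_dim R calF)%E.
  by apply: ereal_sup_ubound; exists 0%N => //; left.
(* With infinite dimension the right-hand side is +oo, the first supremum being nonnegative, and the
   event is everything. *)
have [vcoo|vcfin] := eqVneq (vc_dim R calF) +oo%E.
  apply: trivial_event; apply/seteqP; split => omega //= _.
  rewrite /event /= vcoo [sqrte _]/= mulry gtr0_sg // mul1e addye // mulry gtr0_sg // mul1e.
  by rewrite addey ?addye ?leey // gt_eqF // (lt_le_trans _ gap_ge0).
have vcf : vc_dim R calF \is a fin_num.
  by rewrite ge0_fin_numE // lt_neqAle vcfin leey.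
have [V FV Vle] := vc_dim_nat vcf.
have [e ce dense] := exists_dense_enumeration asA cA0.
have [bad [mbad Pbad] good] := good_event Lk margthr FV ce.
have sub : ~` bad `<=` event.
  move=> omega nbad; rewrite /event /=; apply/(sup_deviationE p1 muE asA _ n0 X _ _ d0 ce dense) => m.
  have := good omega nbad m; rewrite -lee_fin => /le_trans; apply.
  rewrite !EFinD; apply: leeD; last by rewrite lee_fin.
  apply: leeD.
    by rewrite EFin_max ge_max !gap_ge.
  have -> : (60%:E * sqrte (vc_dim R calF) + (2 * Num.sqrt L)%:E =
      (60 * Num.sqrt (fine (vc_dim R calF)) + 2 * Num.sqrt L)%:E)%E.
    by rewrite -{1}(fineK vcf) EFinD EFinM.
  rewrite -EFinM lee_fin.
  by rewrite ler_wpM2l ?(ltW sb0) // lerD2r ler_wpM2l // ler_wsqrtr.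
apply: (@le_trans _ _ (Pr (~` bad))); last by apply: le_measure; rewrite ?inE //; exact: measurableC.
rewrite probability_setC // EFinB; apply: leeB => //.
by apply: (le_trans Pbad); rewrite expL lee_fin mulrC divfK.
Qed.

End GoodEvent.

(** From 2 / k <= Delta1, twice the reciprocal error Delta1 + 1/k is at most 3 Delta1, the hull
    scale of the framing sets. The bound 1/4 - 1/k gives Delta2 < 1, and 1 / (3 c) gives 3 c Delta1
    < 1 <= d, as the radial integral requires. *)
Lemma radius_numerics (R : realType) (d : nat) (k c rho D1 : R) :
  (0 < d)%N -> 0 < k -> 0 < c -> 0 < rho -> rho < 1 -> 2 / k <= D1 ->
  D1 < Num.min (4^-1 - k^-1) (3 * c)^-1 ->
  [/\ 0 < D1 < 4^-1, D1 * rho < 1, D1 + k^-1 <= 4 * (D1 + k^-1) < 1,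
      2 * (D1 + k^-1) <= 3 * D1 & c * (3 * D1) < d%:R].
Proof.
move=> d0 k0 c0 rho0 rho1 kD1; rewrite lt_min => /andP[D1k D1c].
have ki : 0 < k^-1 by rewrite invr_gt0.
have D10 : 0 < D1 by apply: lt_le_trans kD1; rewrite divr_gt0.
have D1q : D1 < 4^-1 by lra.
split.
- by rewrite D10.
- by apply: (@lt_trans _ _ rho) => //; rewrite gtr_pMl //; lra.
- by lra.
- by lra.
- apply: (@lt_le_trans _ _ 1); last by rewrite ler1n.
  by move: D1c; rewrite -[(3 * c)^-1]div1r ltr_pdivlMr ?mulr_gt0 //; lra.
Qed.

(** The term 3 c Delta1 (1 + ln (d / (3 c Delta1))) is exactly the logarithmic term on the right;
    the second d Delta2 and the term in L are nonnegative slack. *)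
Lemma hull_error_le (R : realType) (d : nat) (c L k D1 D2 : R) :
  (0 < d)%N -> 0 < c -> 0 < k -> 0 <= L -> 0 < D1 -> 0 <= D2 ->
  d%:R * D2 + c * (3 * D1) * (1 + ln (d%:R / (c * (3 * D1)))) <=
  2 / (3 * k) * L + 2 * d%:R * D2 + 3 * c * (ln (d%:R / (3 * c)) - ln D1 + 1) * D1.
Proof.
move=> d0 c0 k0 L0 D10 D20.
have dR : 0 < d%:R :> R by rewrite ltr0n.
have c3 : 0 < 3 * c by rewrite mulr_gt0.
have -> : d%:R / (c * (3 * D1)) = d%:R / (3 * c) / D1 by field; rewrite !gt_eqF.
rewrite ln_div ?posrE ?divr_gt0 //.
set l := ln _ - ln _.
have LL : 0 <= 2 / (3 * k) * L by rewrite mulr_ge0 // divr_ge0 // mulr_ge0 // ltW.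
have : 0 <= d%:R * D2 by rewrite mulr_ge0 // ltW.
have -> : c * (3 * D1) * (1 + l) = 3 * c * (l + 1) * D1 by ring.
lra.
Qed.

Unset Implicit Arguments.

Theorem theorem3p1 (R : realType) (d n k : nat)
    (dOmega : measure_display) (Omega : measurableType dOmega)
    (Pr : probability Omega R)
    (P : probability (d.-tuple R) R)
    (X : 'I_n -> {RV Pr >-> d.-tuple R})
    (p : \bar R) (mu : {measure set (d.-tuple R) -> \bar R})
    (calA : set (set (d.-tuple R)))
    (hull : bool -> set (d.-tuple R) -> R -> set (d.-tuple R))
    (tau c rho delta : R) :
  (0 < d)%N ->
  mutually_independent X ->
  (forall i B, measurable B -> distribution Pr (X i) B = P B) ->
  (forall j : 'I_d, continuous (margin_cdf P j)) ->
  (1 <= p)%E ->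
  exponent_measure mu ->
  assumption_A p mu calA hull tau c ->
  assumption_B p calA hull ->
  Num.max 3 (6 * c) < k%:R < tau * n%:R ->
  k%:R / n%:R < rho < tau ->
  0 < delta < 1 ->
  let L := ln (d.+1%:R / delta) in
  let Delta1 := (Num.sqrt (k%:R * rho))^-1 * (60 + 2 * Num.sqrt L)
                + 2 / (3 * k%:R) * L in
  let Delta2 := 4 * (Delta1 + k%:R^-1) in
  let Gamma (s : bool) (A : set (d.-tuple R)) :=
    framing p hull s A (if s then 1 + Delta2 else 1 - Delta2) (3 * Delta1) in
  let calF := [set Gamma false A | A in calA] `|` [set Gamma true A | A in calA] in
  2 / k%:R <= Delta1 ->
  Delta1 < Num.min (4^-1 - k%:R^-1) (3 * c)^-1 ->
  rho / (1 - Delta1 * rho) <= tau ->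
  (forall s A, calA A -> measurable (Gamma s A)) ->
  let event := [set omega : Omega |
    (ereal_sup [set `|(emp_angular_measure (fun i => X i omega) p k A)%:E
                      - angular_measure p mu A| | A in calA]
     <= ereal_sup [set `|(n%:R / k%:R)%:E
                           * law_std_real P (scale (n%:R / k%:R) @` Gamma s A)
                         - mu (Gamma s A)| | s in [set: bool] & A in calA]
        + (Num.sqrt (d%:R `^ (1 + fine (p^-1)%E) * (1 + Delta2) / k%:R))%:E
          * (60%:E * sqrte (vc_dim R calF) + (2 * Num.sqrt L)%:E)
        + (2 / (3 * k%:R) * L + 2 * d%:R * Delta2
           + 3 * c * (ln (d%:R / (3 * c)) - ln Delta1 + 1) * Delta1)%:E)%E] in
  measurable event /\ ((1 - delta)%:E <= Pr event)%E.
Proof.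
move=> d0 Xind Xlaw cdfc p1 muE asA _ /andP[kmax ktau] krhotau /andP[de0 de1].
move=> L Delta1 Delta2 Gamma calF kD1 D1max rhot mG event.
have /andP[krho rhotau] := krhotau.
have kR : 0 < k%:R :> R by apply: le_lt_trans kmax; rewrite le_max ler0n.
have k0 : (0 < k)%N by rewrite -(ltr0n R).
have /andP[tau0 tau1] := A_tau asA.
have c0 := A_c asA.
have nR : 0 < n%:R :> R by rewrite -(pmulr_rgt0 _ tau0) (lt_trans kR).
have n0 : (0 < n)%N by rewrite -(ltr0n R).
have rho0 : 0 < rho by apply: lt_trans krho; rewrite divr_gt0.
have rho1 : rho < 1 by exact: lt_trans tau1.
have delta1 : 1 < d.+1%:R / delta.
  by rewrite ltr_pdivlMr // mul1r (lt_le_trans de1) // ler1n.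
have L0 : 0 < L by rewrite ln_gt0.
have expL : expR (- L) = delta / d.+1%:R.
  by rewrite expRN lnK ?posrE ?(lt_trans _ delta1) // invf_div.
have margthr : vc_threshold 1 (k%:R / rho) L <= k%:R * Delta1.
  by apply: marginal_threshold_le => //; exact: ltW.
have [/andP[D10 D1q] D1rho D2P etah chd] := radius_numerics d0 kR c0 rho0 rho1 kD1 D1max.
have Lk : 0 <= L <= k%:R.
  rewrite (ltW L0); apply: (le_quarter_numerics kR _ (ltW L0) D1q).
  by rewrite rho0.
have D20 : 0 <= Delta2 by rewrite mulr_ge0 // addr_ge0 ?invr_ge0 // ltW.
split; first exact: (measurable_sup_deviation p1 muE asA _ n0).
exact: (prob_sup_deviation d0 n0 k0 Xind Xlaw cdfc p1 muE asA krhotau D10 D1rho rhot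
  etah D2P chd mG Lk margthr (ltW de0) expL
  (hull_error_le d0 c0 kR (ltW L0) D10 D20)).
Qed.
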